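(* Assume the hidden Gibbs setting described in the context, and let $\theta^*\in\Theta$. Suppose the observed process $(Y_k)_{k\ge0}$ has distribution $\mathbb{P}^U_{\theta^*}$. Let $[\theta^*]=\{\theta\in\Theta:\mathbb{P}^U_\theta=\mathbb{P}^U_{\theta^*}\}$. Then for every open $E\subset\Theta$ containing $[\theta^*]$, \[ \lim_{n\to\infty}\Pi_n(\Theta\setminus E\mid Y_0^{n-1})=0\qquad \mathbb{P}^U_{\theta^*}\text{-almost surely}. \]
   Context: Hidden state space: $\mathcal{X}\subset\mathcal{A}^{\mathbb{Z}}$ ($\mathcal{A}$ finite) is a mixing shift of finite type, i.e. the set of sequences avoiding a fixed finite set of forbidden words, such that for any two words $u,v$ occurring in $\mathcal{X}$ there is $N$ with: for each $m\ge N$ some word $w$ of length $m$ makes $uwv$ occur. The map $S$ is the left shift $(Sx)_i=x_{i+1}$, and the metric is $d_{\mathcal{X}}(x,y)=2^{-n(x,y)}$ with $n(x,y)=\inf\{|m|:x_m\ne y_m\}$. Parameter family: $\Theta$ is a compact metric space with metric $d_\Theta$. $\{f_\theta\}$ is a regular family: for some $r>0$ each $f_\theta$ is $r$-Hölder and $\theta\mapsto f_\theta$ is continuous in the Hölder norm $\|f\|_r=\sup|f|+\sup_{x\ne y}|f(x)-f(y)|/d_{\mathcal{X}}(x,y)^r$. $\mu_\theta$ is the unique $S$-invariant Gibbs measure of $f_\theta$: for some $K>0$ and the pressure $\mathcal{P}(f_\theta)$, \[ K^{-1}\le\mu_\theta(x[0,m-1])/\exp(-m\mathcal{P}(f_\theta)+\textstyle\sum_{k<m}f_\theta(S^kx))\le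 K \] for all $x$ and $m\ge1$. $\Pi_0$ is a fully supported Borel probability measure on $\Theta$. Observations: $\mathcal{U}$ is a complete separable metric space with a $\sigma$-finite Borel measure $m$. $\varphi:\Theta\times\mathcal{X}\times\mathcal{U}\to[0,\infty)$, written $\varphi_\theta(u\mid x)$, is jointly continuous with $\int\varphi_\theta(u\mid x)\,dm(u)=1$ for all $\theta,x$. The process measure $\mathbb{P}^U_\theta$ on $\mathcal{U}^{\mathbb{N}}$ is the law of $(U_k)_{k\ge0}$ generated by drawing $X\sim\mu_\theta$ and then, conditionally on $X$, independent $U_k$ with densities $\varphi_\theta(\cdot\mid S^kX)$ with respect to $m$. Its likelihood is $p_\theta(u_0^{n-1})=\int\prod_{k=0}^{n-1}\varphi_\theta(u_k\mid S^kx)\,d\mu_\theta(x)$. The posterior is \[ \Pi_n(E\mid u_0^{n-1})=\int_Ep_\theta(u_0^{n-1})\,d\Pi_0(\theta)\Big/\int_\Theta p_\theta(u_0^{n-1})\,d\Pi_0(\theta). \] Assumptions on $L(\theta,x,u)=-\log\varphi_\theta(u\mid x)$, where $Y_0$ has the first-coordinate law under $\mathbb{P}^U_{\theta^*}$: - (i) $L$ is continuous. - (ii) There is a measurable $L^*:\mathcal{U}\to\mathbb{R}$ with $\sup_{\theta,x}|L(\theta,x,u)|\le L^*(u)$ and $\mathbb{E}_{\theta^*}[L^*(Y_0)]<\infty$. - (iii) For each $\delta>0$ there is a measurable $\rho_\delta:\mathcal{U}\to(0,\infty)$ with $|L(\theta,x,u)-L(\theta',x',u)|\le\rho_\delta(u)$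 whenever $\max(d_\Theta(\theta,\theta'),d_{\mathcal{X}}(x,x'))\le\delta$, and $\mathbb{E}_{\theta^*}[\rho_\delta(Y_0)]\to0$ as $\delta\to0^+$. - (L2) There exist $\alpha>0$ and a Borel $C:\Theta\times\mathcal{U}\to[0,\infty)$ such that each $L(\theta,\cdot,u)$ is $\alpha$-Hölder on $\mathcal{X}$ with constant $C(\theta,u)$, and for each $\beta>0$, $\sup_{(\theta,x)}\int\exp(\beta C(\theta,u))\varphi_\theta(u\mid x)\,dm(u)<\infty$. *)

(* Defs.v *)
From HB Require Import structures.
From mathcomp Require Import all_boot all_order all_algebra.
From mathcomp Require Import all_classical all_reals all_analysis.
Set Implicit Arguments. Unset Strict Implicit. Unset Printing Implicit Defensive.
Import Order.TTheory GRing.Theory Num.Theory.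
Import numFieldNormedType.Exports.
Local Open Scope classical_set_scope.
Local Open Scope ring_scope.

(** nonempty (pointed) metric spaces; the point is only needed so that
    MathComp-Analysis can equip the space with a measurable structure *)
#[short(type="pmetricType")]
HB.structure Definition PMetric (K : numDomainType) :=
  { M of Metric K M & isPointed M }.

#[short(type="pfinType")]
HB.structure Definition PFinite := { A of Finite A & isPointed A }.

Notation borel T := (g_sigma_algebraType (@open T)).

Definition Sshift {A : Type} (x : int -> A) : int -> A := fun i => x (i + 1).

Definition window {A : Type} (x : int -> A) (i : int) (n : nat) : seq A :=
  [seq x (i + (j%:Z)) | j <- iota 0 n].

Definition SFT {A : pfinType} (F : seq (seq A)) : set (int -> A) :=
  [set x | forall (i : int) (w : seq A), w \in F -> window x i (size w) <> w].

Definition occursIn {A : Type} (X : set (int -> A)) (w : seq A) : Prop :=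
  exists x i, X x /\ window x i (size w) = w.

Definition mixing {A : Type} (X : set (int -> A)) : Prop :=
  forall u v : seq A, occursIn X u -> occursIn X v ->
    exists N : nat, forall m : nat, (N <= m)%N ->
      exists w : seq A, size w = m /\ occursIn X (u ++ w ++ v).

Definition nX {R : realType} {A : Type} (x y : int -> A) : \bar R :=
  ereal_inf [set ((absz m)%:R : R)%:E | m in [set m : int | x m <> y m]].

Definition dX {R : realType} {A : Type} (x y : int -> A) : R :=
  match @nX R A x y with
  | r%:E => 2 `^ (- r)
  | _ => 0    (* n(x,y) = +oo, i.e. x = y *)
  end.

(** Hoelder norm on X: sup|f| + sup_{x<>y} |f x - f y| / d(x,y)^r
    (0 is added to each (nonnegative) set so that sup of the empty set is 0) *)
Definition holder_norm {R : realType} {A : Type} (X : set (int -> A)) (r : R)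
  (f : (int -> A) -> R) : \bar R :=
  (ereal_sup ([set 0%E] `|` [set (`|f x|)%:E | x in X]) +
   ereal_sup ([set 0%E] `|` [set (`|f p.1 - f p.2| / (dX p.1 p.2 `^ r))%:E
             | p in [set p : (int -> A) * (int -> A) | X p.1 /\ X p.2 /\ p.1 <> p.2]]))%E.

Definition regular_family {R : realType} {A : Type} (Theta : pmetricType R)
  (X : set (int -> A)) (f : Theta -> (int -> A) -> R) : Prop :=
  exists r : R, 0 < r /\
    (forall th, (holder_norm X r (f th) < +oo)%E) /\
    (forall th (e : R), 0 < e -> exists d : R, 0 < d /\
        forall th', mdist th th' < d ->
          (holder_norm X r (fun x => (f th' x - f th x)%R) < e%:E)%E).

Definition birkhoff {R : realType} {A : Type} (f : (int -> A) -> R) (m : nat)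
  (x : int -> A) : R := \sum_(k < m) f (iter k Sshift x).

Definition pressure {R : realType} {A : pfinType} (X : set (int -> A))
  (f : (int -> A) -> R) : R :=
  lim ((fun n : nat =>
     (n%:R)^-1 * ln (\sum_(w : (n.-tuple A)%type | `[< exists x, X x /\ window x 0 n = w >])
        expR (sup [set birkhoff f n x | x in [set x | X x /\ window x 0 n = w]])))
   @ \oo).

Definition cyl0 {A : Type} (x : int -> A) (m : nat) : set (int -> A) :=
  [set y | forall i : nat, (i < m)%N -> y i%:Z = x i%:Z].

(** sigma-algebra on A^Z generated by the coordinate cylinders (= Borel) *)
Definition cylX (A : pfinType) : set (set (int -> A)) :=
  [set C | exists (i : int) (a : A), C = [set x | x i = a]].
Notation seqX A := (g_sigma_algebraType (@cylX A)).

Definition cylU (U : ptopologicalType) : set (set (nat -> U)) :=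
  [set C | exists (k : nat) (B : set U),
      measurable (B : set (borel U)) /\ C = [set y | B (y k)]].
Notation seqU U := (g_sigma_algebraType (@cylU U)).

Definition invariant_Gibbs {R : realType} {A : pfinType} (X : set (int -> A))
  (f : (int -> A) -> R) (mu : probability (seqX A) R) : Prop :=
  mu X = 1%E /\
  (forall B : set (seqX A), measurable B -> mu (Sshift @^-1` B) = mu B) /\
  exists K : R, 0 < K /\
    forall x, X x -> forall m : nat, (0 < m)%N ->
      K^-1 <= fine (mu (cyl0 x m)) / expR (- (m%:R) * pressure X f + birkhoff f m x)
           <= K.

Definition joint_continuous {R : realType} {A : Type} (Theta U : pmetricType R)
  (X : set (int -> A)) (g : Theta -> (int -> A) -> U -> R) : Prop :=
  forall th x u, X x -> forall e : R, 0 < e -> exists d : R, 0 < d /\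
    forall th' x' u', X x' -> mdist th th' < d -> dX x x' < d -> mdist u u' < d ->
      `|g th' x' u' - g th x u| < e.

Definition negloglik {R : realType} {A : Type} {Theta U : Type}
  (phi : Theta -> (int -> A) -> U -> R) : Theta -> (int -> A) -> U -> R :=
  fun th x u => - ln (phi th x u).

Definition likelihood {R : realType} {A : pfinType} {Theta U : Type}
  (X : set (int -> A)) (mu : Theta -> probability (seqX A) R)
  (phi : Theta -> (int -> A) -> U -> R) (th : Theta) (n : nat) (u : nat -> U)
  : \bar R :=
  (\int[mu th]_(x in X) (\prod_(k < n) phi th (iter k Sshift x) (u k))%:E)%E.

Definition posterior {R : realType} {Theta : ptopologicalType} {U : Type}
  (Pi0 : probability (borel Theta) R) (p : Theta -> nat -> (nat -> U) -> \bar R)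
  (D : set Theta) (n : nat) (u : nat -> U) : R :=
  fine (\int[Pi0]_(th in D) p th n u)%E / fine (\int[Pi0]_th p th n u)%E.

(* Main.v *)
(* For th outside [th*], some finite-dimensional rectangle B has different probabilities
   under P_th and P_th*. The Gibbs property makes the hidden measure quasi-Bernoulli
   (M(uv) <= K M(u) M(v) on words, and a mixing lower bound after a gap), whence a law of
   large numbers and exponential moments for block averages; by the Hoelder control of
   the emissions these give exponential deviation bounds for the frequency of B in the
   observations, which is therefore an exponentially powerful test: almost surely
   p_th(Y_0^(n-1)) <= exp(- c n) p_th*(Y_0^(n-1)) for large n.
   For th close to th0, word weights and emissions differ by subexponential factors:
   p_th <= C exp(e n + 2 sum_(k < n) rho_d(Y_k)) p_th0, and a maximal inequality along
   scales d_j with E rho_(d_j) <= 4^-j makes the sum at most n 2^-j for all n and all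
   large j. Hence the exponential gap is uniform on the compact complement of E, while a
   neighbourhood of th*, charged by the prior, has likelihoods at least
   C^-1 exp(- c n / 2) p_th*. *)
Require Import Defs.
From HB Require Import structures.
From mathcomp Require Import all_boot all_order all_algebra.
From mathcomp Require Import all_classical all_reals all_analysis.
From mathcomp Require Import measurable_realfun ring lra zify.
Set Implicit Arguments. Unset Strict Implicit. Unset Printing Implicit Defensive.
Import Order.TTheory GRing.Theory Num.Theory.
Import numFieldNormedType.Exports.
Local Open Scope classical_set_scope.
Local Open Scope ring_scope.

(** The Gibbs constant [K] of each parameter is merely existential, so nothing bounds it uniformly
    near a given parameter, and pressures are never compared. Nearby measures are therefore compared
    through finite volume: the weight of a word is comparable to its Boltzmann weight divided by the
    partition function of its own length, with constants built only from the gluing gap, the sup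
    bound and the distortion bound of the potential. These are locally uniform, and the
    finite-volume quantities vary by at most the exponential of the length times the sup distance of
    the potentials. The law of large numbers is proved in mean square from stationarity and the
    mixing inequality; no ergodic theorem enters. Only upper deviations are proved directly: the
    complement of a rectangle splits into finitely many rectangles, which yields the lower ones. The
    parameter space is uncountable, so almost sure bounds need one null set for a whole
    neighbourhood. The event [tame dl J] serves this purpose: on it, likelihoods of neighbouring
    parameters are compared deterministically. *)

Section WordSums.
Context {R : realType} {A : finType}.
Implicit Types (g : seq A -> R).

(** Words stay untyped sequences, so cutting a word at any place is plain concatenation and involves
    no length cast. *)
Fixpoint wsum (n : nat) g : R :=
  if n is n'.+1 then \sum_(a : A) wsum n' (fun w => g (a :: w)) else g [::].

Lemma eq_wsum n g g' : (forall w, size w = n -> g w = g' w) ->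
  wsum n g = wsum n g'.
Proof.
elim: n g g' => [|n IH] g g' h /=; first exact: h.
by apply: eq_bigr => a _; apply: IH => w sw; apply: h; rewrite /= sw.
Qed.

Lemma le_wsum n g g' : (forall w, size w = n -> g w <= g' w) ->
  wsum n g <= wsum n g'.
Proof.
elim: n g g' => [|n IH] g g' h /=; first exact: h.
by apply: ler_sum => a _; apply: IH => w sw; apply: h; rewrite /= sw.
Qed.

Lemma wsumD n g g' : wsum n (fun w => g w + g' w) = wsum n g + wsum n g'.
Proof.
elim: n g g' => [|n IH] g g' //=.
by rewrite -big_split; apply: eq_bigr => a _; exact: IH.
Qed.

Lemma wsumZ n c g : wsum n (fun w => c * g w) = c * wsum n g.
Proof.
elim: n g => [|n IH] g //=.
by rewrite mulr_sumr; apply: eq_bigr => a _; exact: IH.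
Qed.

Lemma wsum0 n : wsum n (fun=> 0) = 0.
Proof.
by elim: n => //= n IH; rewrite big1.
Qed.

Lemma wsum_ge0 n g : (forall w, size w = n -> 0 <= g w) -> 0 <= wsum n g.
Proof. by move=> h; rewrite -(wsum0 n); apply: le_wsum. Qed.

Lemma wsum_sum n (I : Type) (r : seq I) (G : I -> seq A -> R) :
  wsum n (fun w => \sum_(i <- r) G i w) = \sum_(i <- r) wsum n (G i).
Proof.
elim: r => [|i r IH]; first by rewrite big_nil -[RHS](wsum0 n); apply: eq_wsum => w _; rewrite big_nil.
by rewrite big_cons -IH -wsumD; apply: eq_wsum => w _; rewrite big_cons.
Qed.

Lemma wsum_cat n p g :
  wsum (n + p) g = wsum n (fun u => wsum p (fun v => g (u ++ v))).
Proof.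
elim: n g => [|n IH] g //=.
by apply: eq_bigr => a _; rewrite IH.
Qed.

Lemma wsum_wsum n p (G : seq A -> seq A -> R) :
  wsum n (fun u => wsum p (fun v => G u v)) =
  wsum p (fun v => wsum n (fun u => G u v)).
Proof.
elim: n G => [|n IH] G //=.
by rewrite wsum_sum; apply: eq_bigr => a _; rewrite IH.
Qed.

Lemma wsum_ge_term n g w : (forall w, 0 <= g w) -> size w = n -> g w <= wsum n g.
Proof.
elim: n g w => [|n IH] g [|a w] //= g0 [sw].
rewrite (bigD1 a) //=; have h := IH (fun w => g (a :: w)) w (fun w => g0 _) sw.
by rewrite (le_trans h) // lerDl; apply: sumr_ge0 => b _; apply: wsum_ge0.
Qed.

Lemma wsum_const n c : wsum n (fun=> c) = (#|A| ^ n)%:R * c.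
Proof.
elim: n => [|n IH] /=; first by rewrite expn0 mul1r.
by rewrite IH sumr_const expnS natrM -[LHS]mulr_natl mulrA.
Qed.

Lemma wsum_pred1 n g w : size w = n ->
  wsum n (fun v => if v == w then g v else 0) = g w.
Proof.
elim: n g w => [|n IH] g [|a w] //= [sw].
rewrite (bigD1 a) //= (eq_wsum (g' := fun v => if v == w then g (a :: v) else 0)); last first.
  by move=> v _; rewrite eqseq_cons eqxx.
rewrite (IH (fun v => g (a :: v))) // big1 ?addr0 // => b ba.
by rewrite -[RHS](wsum0 n); apply: eq_wsum => v _; rewrite eqseq_cons (negbTE ba).
Qed.

End WordSums.

(** * Stationary processes given by their word weights *)

Section OneSidedSequences.
Context {R : realType} {A : finType} (a0 : A).

Definition nshift {T : Type} (k : nat) (x : nat -> T) : nat -> T := fun i => x (k + i)%N.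

Definition depends {T U : Type} (n : nat) (g : (nat -> T) -> U) :=
  forall x y, (forall i, (i < n)%N -> x i = y i) -> g x = g y.

Lemma depends_le {T U} n n' (g : (nat -> T) -> U) :
  (n <= n')%N -> depends n g -> depends n' g.
Proof. by move=> le dg x y xy; apply: dg => i /leq_trans /(_ le) /xy. Qed.

Lemma depends_shift {T U} k n (g : (nat -> T) -> U) :
  depends n g -> depends (k + n) (fun x => g (nshift k x)).
Proof.
by move=> dg x y xy; apply: dg => i lti; apply: xy; rewrite ltn_add2l.
Qed.

(** Padding by [a0] lets functions of sequences be evaluated on words; for a function that depends
    on the letters of the word only, the padding is invisible. *)
Definition wseq (w : seq A) : nat -> A := nth a0 w.

Lemma wseq_catl u v i : (i < size u)%N -> wseq (u ++ v) i = wseq u i.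
Proof. by rewrite /wseq nth_cat => ->. Qed.

Lemma wseq_catr u v : nshift (size u) (wseq (u ++ v)) = wseq v.
Proof.
apply/funext => i.
by rewrite /nshift /wseq nth_cat ltnNge leq_addr /= addKn.
Qed.

Variable M : seq A -> R.

(** Expectation of [g] under the process whose cylinder probabilities are [M]. Below, [M_nil] and
    [M_right] express Kolmogorov consistency and [M_left] expresses stationarity. *)
Definition wmean (n : nat) (g : (nat -> A) -> R) : R :=
  wsum n (fun w => M w * g (wseq w)).

Hypothesis M_ge0 : forall w, 0 <= M w.

Lemma le_wmean n g g' : (forall x, g x <= g' x) -> wmean n g <= wmean n g'.
Proof. by move=> h; apply: le_wsum => w _; rewrite ler_wpM2l. Qed.

Lemma eq_wmean n g g' : (forall x, g x = g' x) -> wmean n g = wmean n g'.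
Proof. by move=> h; apply: eq_wsum => w _; rewrite h. Qed.

Lemma wmean_ge0 n g : (forall x, 0 <= g x) -> 0 <= wmean n g.
Proof. by move=> h; apply: wsum_ge0 => w _; rewrite mulr_ge0. Qed.

Lemma wmeanD n g g' : wmean n (fun x => g x + g' x) = wmean n g + wmean n g'.
Proof. by rewrite -wsumD; apply: eq_wsum => w _; rewrite mulrDr. Qed.

Lemma wmeanZ n c g : wmean n (fun x => c * g x) = c * wmean n g.
Proof. by rewrite -wsumZ; apply: eq_wsum => w _; rewrite mulrCA. Qed.

Lemma wmean_sum n (I : Type) (r : seq I) (G : I -> (nat -> A) -> R) :
  wmean n (fun x => \sum_(i <- r) G i x) = \sum_(i <- r) wmean n (G i).
Proof. by rewrite -wsum_sum; apply: eq_wsum => w _; rewrite mulr_sumr. Qed.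

Hypothesis M_nil : M [::] = 1.
Hypothesis M_left : forall w, M w = \sum_(a : A) M (a :: w).
Hypothesis M_right : forall w, M w = \sum_(a : A) M (rcons w a).

Lemma wsum_M_right p u : wsum p (fun v => M (u ++ v)) = M u.
Proof.
elim: p u => [|p IH] u /=; first by rewrite cats0.
rewrite M_right; apply: eq_bigr => a _; rewrite -(IH (rcons u a)).
by apply: eq_wsum => v _; rewrite cat_rcons.
Qed.

Lemma wsum_M_left p v : wsum p (fun u => M (u ++ v)) = M v.
Proof.
elim: p => [|p IH] //=.
rewrite -IH -wsum_sum; apply: eq_wsum => u _; by rewrite -M_left.
Qed.

Lemma wmean_widen n n' g : (n <= n')%N -> depends n g -> wmean n' g = wmean n g.
Proof.
move=> le dg; rewrite -(subnKC le) /wmean wsum_cat; apply: eq_wsum => u su.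
rewrite -[X in _ = X * _](wsum_M_right (n' - n) u) mulrC -wsumZ; apply: eq_wsum => v _.
rewrite mulrC; congr (_ * _); apply: dg => i ltin.
by rewrite wseq_catl // su.
Qed.

Lemma wmean_cst n c : wmean n (fun=> c) = c.
Proof.
by rewrite (@wmean_widen 0 n) // /wmean /= M_nil mul1r.
Qed.

Lemma wmean_shift k n g : wmean (k + n) (fun x => g (nshift k x)) = wmean n g.
Proof.
rewrite /wmean wsum_cat wsum_wsum; apply: eq_wsum => v _.
rewrite -[X in _ = X * _](wsum_M_left k v) mulrC -wsumZ; apply: eq_wsum => u su.
by rewrite mulrC -su wseq_catr.
Qed.

Section Mixing.
Variables (N : nat) (c : R).
Hypothesis c_gt0 : 0 < c.
Hypothesis M_mixing : forall u v,
  c * (M u * M v) <= wsum N (fun w => M (u ++ w ++ v)).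

Lemma mixing_le1 : c <= 1.
Proof.
have := M_mixing [::] [::]; rewrite M_nil !mulr1 => /le_trans; apply.
have := wsum_M_right N [::]; rewrite M_nil => <-.
by apply: le_wsum => w _; rewrite /= cats0.
Qed.

(** Two independent copies are dominated by two blocks of one path separated by a gap of length [N].
    Finite range is asked of the first argument alone, since the second is read exactly at the
    shifted word. *)
Lemma wmean_mixing n p (G : (nat -> A) -> (nat -> A) -> R) :
  (forall x y, 0 <= G x y) -> (forall y, depends n (G ^~ y)) ->
  c * wmean n (fun x => wmean p (fun y => G x y)) <=
  wmean (n + (N + p)) (fun x => G x (nshift (n + N) x)).
Proof.
move=> G0 dG; rewrite /wmean -wsumZ wsum_cat; apply: le_wsum => u su.
rewrite mulrA -wsumZ wsum_cat wsum_wsum; apply: le_wsum => v _.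
rewrite (eq_wsum (g' := fun w => G (wseq u) (wseq v) * M (u ++ w ++ v))); last first.
  move=> w sw; rewrite mulrC; congr (_ * _).
  have -> : (n + N)%N = size (u ++ w) by rewrite size_cat su sw.
  rewrite [in LHS]catA wseq_catr; apply: dG => i ltin.
  by rewrite -catA wseq_catl // su.
rewrite wsumZ -!mulrA mulrA [leLHS]mulrA mulrC ler_wpM2l // -mulrA.
exact: M_mixing.
Qed.

End Mixing.

End OneSidedSequences.

(** * Law of large numbers in mean square *)

Section LawOfLargeNumbers.
Context {R : realType} {A : finType} (a0 : A).
Variable M : seq A -> R.
Hypothesis M_ge0 : forall w, 0 <= M w.
Hypothesis M_nil : M [::] = 1.
Hypothesis M_left : forall w, M w = \sum_(a : A) M (a :: w).
Hypothesis M_right : forall w, M w = \sum_(a : A) M (rcons w a).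
Variables (N : nat) (c : R).
Hypothesis c_gt0 : 0 < c.
Hypothesis M_mixing : forall u v,
  c * (M u * M v) <= wsum N (fun w => M (u ++ w ++ v)).
Local Notation E := (wmean a0 M).

(** Birkhoff sum along every [k]-th shift. The stride will be the length of a test rectangle, so
    that the tested blocks of observations are disjoint. *)
Definition stride_sum (k : nat) (h : (nat -> A) -> R) (m : nat) (x : nat -> A) : R :=
  \sum_(j < m) h (nshift (j * k) x).

Lemma stride_sumD k h m p x : stride_sum k h (m + p) x =
  stride_sum k h m x + stride_sum k h p (nshift (m * k) x).
Proof.
rewrite /stride_sum big_split_ord /=; congr (_ + _); apply: eq_bigr => j _.
by congr (h _); apply/funext => i; rewrite /nshift mulnDl addnA.
Qed.

Lemma depends_stride_sum n k h m : depends n h ->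
  depends (m * k + n) (stride_sum k h m).
Proof.
move=> dh x y xy; apply: eq_bigr => j _; apply: (depends_shift (k := j * k) dh) => i lti.
by apply: xy; rewrite (leq_trans lti) // leq_add2r leq_mul2r ltnW ?orbT.
Qed.

Lemma wmean_stride_sum n k h m : depends n h ->
  E (m * k + n) (stride_sum k h m) = m%:R * E n h.
Proof.
move=> dh; rewrite wmean_sum (eq_bigr (fun=> E n h)) ?sumr_const ?card_ord ?mulr_natl // => j _.
rewrite (@wmean_widen _ _ a0 M M_right (j * k + n)).
- exact: wmean_shift.
- by rewrite leq_add2r leq_mul2r ltnW ?orbT.
- exact: depends_shift.
Qed.

Section Centered.
Variables (n k : nat) (h : (nat -> A) -> R).
Hypothesis k_gt0 : (0 < k)%N.
Hypothesis h_dep : depends n h.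
Hypothesis h_le1 : forall x, `|h x| <= 1.
Hypothesis h_mean : E n h = 0.
Local Notation S := (stride_sum k h).
Let V m := E (m * k + n) (fun x => S m x ^+ 2).

Lemma stride_sum_bound m x : `|S m x| <= m%:R.
Proof.
rewrite (le_trans (ler_norm_sum _ _ _)) // (le_trans (ler_sum _ (fun j _ => h_le1 _))) //.
by rewrite sumr_const card_ord.
Qed.

Lemma variance_bound m : V m <= m%:R ^+ 2.
Proof.
rewrite -[leRHS](wmean_cst a0 M_nil M_right (m * k + n)); apply: le_wmean => // x.
by rewrite -real_normK ?num_real // ler_sqr ?nnegrE // stride_sum_bound.
Qed.

(* Splitting a sum into two nearly equal halves separated by a gap, mixing makes
   the halves differ by a fraction of their size in mean square, so the
   normalized variance contracts when the length doubles. *)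
Lemma variance_contraction m g : (n + N <= g * k)%N ->
  V (m + g + m) <= (1 - c / 4) * (4 * V m) + (1 + (c / 4)^-1) * g%:R ^+ 2.
Proof.
move=> gk; pose J := ((m + g) * k)%N; pose L := (J + (m * k + n))%N.
have NJ : (m * k + n + N <= J)%N by rewrite /J mulnDl -addnA leq_add2l.
have NJ' : (N <= J)%N by rewrite (leq_trans _ NJ) // leq_addl.
have mJN : (m * k + n <= J - N)%N by rewrite -(leq_add2r N) subnK.
have EL : ((m + g + m) * k + n = L)%N by rewrite /L /J !mulnDl !addnA.
have dS := @depends_stride_sum n k h m h_dep.
have dS2 : depends (m * k + n) (fun x => S m x ^+ 2).
  by move=> x y xy; rewrite (dS x y).
have V1 : E L (fun x => S m x ^+ 2) = V m.
  by apply: wmean_widen => //; rewrite /L leq_addl.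
have V2 : E L (fun x => S m (nshift J x) ^+ 2) = V m.
  exact: (wmean_shift _ M_left _ _ (fun x => S m x ^+ 2)).
have ES0 : E (m * k + n) (S m) = 0.
  by rewrite wmean_stride_sum // h_mean mulr0.
(* For two independent copies the cross term vanishes by centering, and the mean square of the
   difference is [2 * V m]; mixing retains the fraction [c] of it. *)
have V3 : c * (2 * V m) <= E L (fun x => (S m x - S m (nshift J x)) ^+ 2).
  have dG y : depends (J - N) (fun x => (S m x - S m y) ^+ 2).
    by apply: (depends_le mJN); move=> x x' xx'; rewrite (dS x x').
  have := @wmean_mixing _ _ a0 M N c M_mixing (J - N) (m * k + n)
    (fun x y => (S m x - S m y) ^+ 2) (fun x y => sqr_ge0 _) dG.
  have -> : ((J - N) + (N + (m * k + n)) = L)%N by rewrite addnA subnK.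
  rewrite subnK //; apply: le_trans; rewrite ler_pM2l //.
  rewrite (@eq_wmean _ _ a0 M (J - N) _ (fun x => S m x ^+ 2 + V m)); last first.
    move=> x; rewrite (@eq_wmean _ _ a0 M _ _
      (fun y => S m x ^+ 2 + ((- 2 * S m x) * S m y + S m y ^+ 2))); last first.
      by move=> y; ring.
    by rewrite !wmeanD // (wmeanZ _ _ _ (- 2 * S m x)) ES0 wmean_cst // mulr0 add0r.
  rewrite wmeanD wmean_cst // (@wmean_widen _ _ a0 M M_right (m * k + n)) //.
    by rewrite -/(V m) mulr_natl mulr2n.
(* Young's inequality with parameter [c / 4] detaches the gap sum, and the parallelogram law
   rewrites the square of the sum of the two halves. The factor [(1 + c / 4) * (4 - 2 * c)] is then
   at most [4 * (1 - c / 4)]. *)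
have V4 : V (m + g + m) <= E L (fun x => (1 + c / 4) * (2 * S m x ^+ 2 +
     (2 * S m (nshift J x) ^+ 2 + - 1 * (S m x - S m (nshift J x)) ^+ 2)) +
     (1 + (c / 4)^-1) * g%:R ^+ 2).
  rewrite /V EL; apply: le_wmean => // x; rewrite !stride_sumD -/J.
  set r := S g _; set a := S m x; set b := S m _.
  have rg : r ^+ 2 <= g%:R ^+ 2.
    by rewrite -real_normK ?num_real // ler_sqr ?nnegrE // stride_sum_bound.
  set t := c / 4; have t0 : 0 < t by rewrite divr_gt0.
  have -> : (1 + t) * (2 * a ^+ 2 + (2 * b ^+ 2 + -1 * (a - b) ^+ 2)) = (1 + t) * (a + b) ^+ 2 by ring.
  apply: (@le_trans _ _ ((1 + t) * (a + b) ^+ 2 + (1 + t^-1) * r ^+ 2)); last first.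
    by rewrite lerD2l ler_pM2l // ltr_pwDr // ?invr_ge0 ?invr_gt0 // ltW.
  have : 0 <= t^-1 * (t * (a + b) - r) ^+ 2 by rewrite mulr_ge0 ?sqr_ge0 ?invr_ge0 // ltW.
  have -> : t^-1 * (t * (a + b) - r) ^+ 2 = t * (a + b) ^+ 2 - 2 * (a + b) * r + t^-1 * r ^+ 2.
    by field; exact: lt0r_neq0.
  lra.
apply: (le_trans V4); rewrite wmeanD wmeanZ // !wmeanD // !wmeanZ // V1 V2 wmean_cst //.
rewrite lerD2r.
have V0 : 0 <= V m by apply: wmean_ge0 => // x; exact: sqr_ge0.
have c4 : 0 < 1 + c / 4 by rewrite ltr_pwDl // divr_ge0 // ltW.
apply: (@le_trans _ _ ((1 + c / 4) * (4 * V m - c * (2 * V m)))).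
  rewrite ler_pM2l //; lra.
nra.
Qed.

Lemma variance_small (e : R) (m0 : nat) : 0 < e ->
  exists m, (m0 <= m)%N /\ V m <= e * m%:R ^+ 2.
Proof.
move=> e0; pose q : R := 1 - c / 4.
have c1 : c <= 1 by exact: (mixing_le1 M_nil M_right M_mixing).
have /andP[q0 q1] : 0 < q < 1 by rewrite /q; move: c_gt0 => ?; apply/andP; split; lra.
pose g := (n + N).+1.
have gk : (n + N <= g * k)%N by rewrite (leq_trans (leqnSn _)) // leq_pmulr.
set K := (1 + (c / 4)^-1) * g%:R ^+ 2.
have K0 : 0 <= K by rewrite mulr_ge0 ?sqr_ge0 // addr_ge0 // invr_ge0 divr_ge0 // ltW.
(* Starting the doubling from a length at least [m1] makes the additive gap error a small multiple
   of the squared length at every stage. *)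
have [m1 hm1] : exists m1 : nat, K <= e * (c / 4) * m1%:R.
  have ec : 0 < e * (c / 4) by rewrite mulr_gt0 // divr_gt0.
  exists (Num.trunc (K / (e * (c / 4)))).+1; rewrite mulrC -ler_pdivrMr //.
  by rewrite ltW // -truncn_le_nat.
pose s i := iter i (fun m => (m + g + m)%N) (m0 + m1 + 1)%N.
have s_ge i : (m0 + m1 + 1 + i <= s i)%N.
  elim: i => [|i IH]; first by rewrite addn0.
  rewrite /= -/(s i); lia.
have [i hi] : exists i, q ^+ i <= e / 2.
  have qn : `|q| < 1 by rewrite gtr0_norm //.
  have /cvgrPdist_le := cvg_expr qn.
  move=> /(_ (e / 2)); rewrite divr_gt0 // => /(_ isT) [i _ /(_ i (leqnn i))].
  rewrite /= sub0r normrN gtr0_norm ?exprn_gt0 // => iq.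
  by exists i.
(* One doubling sends a bound [y] on the normalized variance to [q * y + (1 - q) * e / 4], a map
   with fixed point [e / 4]; the gap only lengthens the sum, which helps the normalization. *)
have main j : V (s j) <= (q ^+ j + e / 4) * (s j)%:R ^+ 2.
  elim: j => [|j IH].
    rewrite expr0 (le_trans (variance_bound _)) // ler_peMl ?sqr_ge0 //.
    by rewrite lerDl divr_ge0 // ltW.
  rewrite /= -/(s j) (le_trans (variance_contraction _ gk)) //.
  set v := V (s j) in IH *; set a := (s j)%:R in IH *.
  have a1 : 1 <= a by rewrite ler1n; have := s_ge j; lia.
  have am : m1%:R <= a by rewrite ler_nat; have := s_ge j; lia.
  have Ka : K <= e * (1 - q) * a ^+ 2.
    have -> : 1 - q = c / 4 by rewrite /q; ring.
    apply: (le_trans hm1); rewrite ler_pM2l ?mulr_gt0 ?divr_gt0 //.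
    by apply: (le_trans am); rewrite expr2 ler_peMl //; lra.
  have s4 : (2 * a) ^+ 2 <= (s j + g + s j)%:R ^+ 2 :> R.
    by rewrite ler_sqr ?nnegrE ?mulr_ge0 // /a -natrM ler_nat; lia.
  apply: (@le_trans _ _ ((q ^+ j.+1 + e / 4) * (2 * a) ^+ 2)); last first.
    by rewrite ler_wpM2l // addr_ge0 ?exprn_ge0 ?divr_ge0 //; lra.
  rewrite -/K -/q.
  apply: (@le_trans _ _ (q * (4 * ((q ^+ j + e / 4) * a ^+ 2)) + e * (1 - q) * a ^+ 2)).
    by rewrite lerD // ler_pM2l ?ler_pM2l //; lra.
  have idn (p b d y : R) : p * (4 * ((y + d / 4) * b)) + d * (1 - p) * b =
    (p * y + d / 4) * (4 * b) by field.
  have sqr2 (z : R) : (2 * z) ^+ 2 = 4 * z ^+ 2 by ring.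
  by rewrite idn sqr2 (exprS q).
exists (s i); split; first by have := s_ge i; lia.
rewrite (le_trans (main i)) // ler_wpM2r ?sqr_ge0 //; lra.
Qed.

End Centered.

End LawOfLargeNumbers.

(** * Exponential moments of block sums *)

Section ExponentialMoments.
Context {R : realType} {A : finType} (a0 : A).
Variable M : seq A -> R.
Hypothesis M_ge0 : forall w, 0 <= M w.
Hypothesis M_nil : M [::] = 1.
Hypothesis M_left : forall w, M w = \sum_(a : A) M (a :: w).
Hypothesis M_right : forall w, M w = \sum_(a : A) M (rcons w a).
Variables (N : nat) (c : R).
Hypothesis c_gt0 : 0 < c.
Hypothesis M_mixing : forall u v,
  c * (M u * M v) <= wsum N (fun w => M (u ++ w ++ v)).
Variable K : R.
Hypothesis K_ge0 : 0 <= K.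
Hypothesis M_quasi : forall u v, M (u ++ v) <= K * (M u * M v).
Local Notation E := (wmean a0 M).

Lemma wmean_quasi n p (f g : (nat -> A) -> R) :
  (forall x, 0 <= f x) -> (forall x, 0 <= g x) -> depends n f ->
  E (n + p) (fun x => f x * g (nshift n x)) <= K * (E n f * E p g).
Proof.
move=> f0 g0 df; rewrite /wmean wsum_cat mulrCA mulrC.
set B := K * wsum p _; rewrite -wsumZ; apply: le_wsum => u su.
rewrite /B mulrC mulrA -wsumZ; apply: le_wsum => v _.
rewrite -su wseq_catr (df _ (wseq a0 u)) => [|i ltin]; last by rewrite wseq_catl ?su.
have -> : M u * f (wseq a0 u) * K * (M v * g (wseq a0 v)) =
  (K * (M u * M v)) * (f (wseq a0 u) * g (wseq a0 v)) by ring.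
by rewrite ler_wpM2r // mulr_ge0.
Qed.

Variables (n k : nat) (h : (nat -> A) -> R).
Hypothesis k_gt0 : (0 < k)%N.
Hypothesis h_dep : depends n h.
Hypothesis h_01 : forall x, 0 <= h x <= 1.
Local Notation S := (stride_sum k h).
Local Notation p := (E n h).

Lemma stride_sum_le m x : S m x <= m%:R.
Proof.
rewrite -[leRHS]mulr_natl mulr1 -[m in leRHS]card_ord -sum1_card natr_sum.
by apply: ler_sum => j _; case/andP: (h_01 (nshift (j * k) x)).
Qed.

Let e b m := E (m * k + n) (fun x => expR (b * S m x)).

Lemma exp_moment_trivial b m : 0 <= b -> e b m <= expR (b * m%:R).
Proof.
move=> b0; rewrite -[leRHS](wmean_cst a0 M_nil M_right (m * k + n)).
by apply: le_wmean => // x; rewrite ler_expR ler_wpM2l // stride_sum_le.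
Qed.

Lemma exp_moment_ge0 b m : 0 <= e b m.
Proof. by apply: wmean_ge0 => // x; exact: expR_ge0. Qed.

(** The windows of length [n] overhang the end of their block. Giving up [g] terms, each at most 1,
    makes the remaining two groups read disjoint letters, and the quasi-Bernoulli bound splits
    them. *)
Lemma exp_moment_add b l g m : 0 <= b -> (n <= g * k)%N ->
  e b (l + g + m) <= (expR (b * g%:R) * K * e b l) * e b m.
Proof.
move=> b0 ng; pose J := ((l + g) * k)%N.
have dS := @depends_stride_sum _ _ n k h l h_dep.
have lJ : (l * k + n <= J)%N by rewrite /J mulnDl leq_add2l.
have dF : depends (l * k + n) (fun x => expR (b * S l x)).
  by move=> x y xy; rewrite (dS x y).
have := @wmean_quasi J (m * k + n) (fun x => expR (b * S l x))
  (fun x => expR (b * S m x)) (fun=> expR_ge0 _) (fun=> expR_ge0 _) (depends_le lJ dF).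
rewrite (wmean_widen a0 M_right lJ dF) => H.
apply: (@le_trans _ _ (expR (b * g%:R) * (K * (e b l * e b m)))); last by rewrite !mulrA.
apply: le_trans (ler_wpM2l (expR_ge0 (b * g%:R)) H).
rewrite -wmeanZ /e.
have -> : ((l + g + m) * k + n = J + (m * k + n))%N by rewrite /J; lia.
apply: le_wmean => // x; rewrite -!expRD ler_expR -!mulrDr ler_wpM2l //.
rewrite !stride_sumD -/J.
have := stride_sum_le g (nshift (l * k) x); lra.
Qed.

Lemma exp_moment_blocks b l g r q : 0 <= b -> (n <= g * k)%N ->
  e b (q * (l + g) + r) <= (expR (b * g%:R) * K * e b l) ^+ q * expR (b * r%:R).
Proof.
move=> b0 ng; elim: q => [|q IH]; first by rewrite expr0 mul1r exp_moment_trivial.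
rewrite mulSn -addnA (le_trans (exp_moment_add _ _ b0 ng)) // exprS -[leRHS]mulrA.
by rewrite ler_wpM2l // !mulr_ge0 ?expR_ge0 ?exp_moment_ge0.
Qed.

(* On a long block the average is close to its mean in L2, so a block of length l
   with b = tau / l has exponential moment about expR (tau * p); the quasi-Bernoulli
   constant paid at each block boundary is absorbed by taking tau large. *)
Lemma exp_moment_bound (eta b0 : R) : 0 < eta -> 0 < b0 ->
  exists b C, [/\ 0 < b, b <= b0 & forall m,
    E (m * k + n) (fun x => expR (b * S m x)) <= C * expR (b * m%:R * (p + eta))].
Proof.
move=> eta0 b00.
have p0 : 0 <= p by apply: wmean_ge0 => // x; case/andP: (h_01 x).
have p1 : p <= 1.
  rewrite -(wmean_cst a0 M_nil M_right n 1); apply: le_wmean => // x.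
  by case/andP: (h_01 x).
(* Chosen so that [expR (tau * eta / 4)], which is at least [1 + tau * eta / 4], absorbs the cost
   [expR 1 * K * 2] of one block: [expR 1] for its gap, [K] for its boundary and 2 for the
   fluctuation within it. *)
pose tau := 4 * (2 * expR 1 * (K + 1)) / eta.
have tau0 : 0 < tau by rewrite !mulr_gt0 ?expR_gt0 ?invr_gt0 // ltr_wpDl.
have K1 : 0 <= K + 1 by rewrite addr_ge0.
have tauK : expR 1 * K * 2 <= expR (tau * eta / 4).
  apply: (@le_trans _ _ (1 + tau * eta / 4)); last exact: expR_ge1Dx.
  have -> : tau * eta / 4 = 2 * expR 1 * (K + 1) by rewrite /tau; field; exact: lt0r_neq0.
  have := expR_gt0 (1 : R); nra.
pose g := n.
have ng : (n <= g * k)%N by rewrite leq_pmulr.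
pose h' x := h x - p.
have h'1 x : `|h' x| <= 1.
  by case/andP: (h_01 x) => ? ?; rewrite ler_norml /h'; apply/andP; split; lra.
have h'dep : depends n h' by move=> x y xy; rewrite /h' (h_dep xy).
have h'mean : E n h' = 0.
  by rewrite wmeanD wmean_cst // subrr.
(* The variance level at which the event of exceeding the mean by [eta / 4], weighted by the largest
   possible value [expR tau], contributes at most 1. *)
pose v := expR (- tau) * (eta / 4) ^+ 2.
have v0 : 0 < v by rewrite mulr_gt0 ?expR_gt0 // exprn_gt0 // divr_gt0.
pose l0 := (Num.trunc (tau * g%:R + tau / b0)).+1.
have [l [l0l Vl]] := variance_small M_ge0 M_nil M_left M_right c_gt0 M_mixing
  k_gt0 h'dep h'1 h'mean l0 v0.
have lb : tau * g%:R + tau / b0 <= l%:R.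
  by apply: (@le_trans _ _ l0%:R); rewrite ?ler_nat // ltW // -truncn_le_nat.
have l_gt0 : 0 < (l%:R : R) by rewrite ltr0n (leq_trans _ l0l).
pose b := tau / l%:R.
have b_gt0 : 0 < b by rewrite divr_gt0.
have bl : b * l%:R = tau by rewrite /b divfK // gt_eqF.
have gt0 : 0 <= tau * g%:R by rewrite mulr_ge0 // ltW.
have tb0 : 0 <= tau / b0 by rewrite divr_ge0 // ltW.
have bg : b * g%:R <= 1.
  by rewrite /b mulrAC ler_pdivrMr // mul1r; lra.
have bb0 : b <= b0.
  rewrite /b ler_pdivrMr // mulrC -ler_pdivrMr //; lra.
have S' x : stride_sum k h' l x = S l x - l%:R * p.
  by rewrite /stride_sum /h' sumrB sumr_const card_ord mulr_natl.
(* With [z] the centered block average, which is at most 1, [expR (tau * z)] is bounded by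
   [expR (tau * eta / 4)] when [z <= eta / 4] and by [expR tau * (4 / eta * z) ^+ 2] otherwise. *)
have el : e b l <= 2 * expR (tau * p + tau * eta / 4).
  apply: (@le_trans _ _ (E (l * k + n) (fun x => expR (tau * p) *
     (expR (tau * eta / 4) + (expR tau * (4 / eta) ^+ 2 / l%:R ^+ 2) * stride_sum k h' l x ^+ 2)))).
    apply: le_wmean => // x; set s := S l x.
    have -> : b * s = tau * p + tau * ((s - l%:R * p) / l%:R).
      by rewrite /b; field; rewrite gt_eqF.
    rewrite expRD ler_pM2l ?expR_gt0 // S' -/s; set y := s - _.
    have -> : expR tau * (4 / eta) ^+ 2 / l%:R ^+ 2 * y ^+ 2 =
      expR tau * ((4 / eta) * (y / l%:R)) ^+ 2 by field; rewrite !gt_eqF.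
    set z := y / _.
    have z1 : z <= 1.
      rewrite /z ler_pdivrMr // mul1r /y; have := stride_sum_le l x; rewrite -/s.
      have : 0 <= l%:R * p by rewrite mulr_ge0.
      lra.
    have [zs|zb] := leP z (eta / 4).
      apply: (@le_trans _ _ (expR (tau * eta / 4))).
        by rewrite ler_expR -mulrA ler_pM2l.
      by rewrite lerDl mulr_ge0 ?expR_ge0 ?sqr_ge0.
    apply: (@le_trans _ _ (expR tau * (4 / eta * z) ^+ 2)); last first.
      by rewrite lerDr expR_ge0.
    apply: (@le_trans _ _ (expR tau)); first by rewrite ler_expR ler_piMr // ltW.
    rewrite ler_pMr ?expR_gt0 // exprn_ege1 //.
    rewrite mulrAC ler_pdivlMr // mul1r -ler_pdivrMl // mulrC; exact: ltW.
  rewrite wmeanZ wmeanD wmeanZ wmean_cst // expRD [leRHS]mulrCA ler_pM2l ?expR_gt0 //.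
  set W := E _ _.
  have WV : expR tau * (4 / eta) ^+ 2 / l%:R ^+ 2 * W <= 1.
    apply: (@le_trans _ _ (expR tau * (4 / eta) ^+ 2 / l%:R ^+ 2 * (v * l%:R ^+ 2))).
      rewrite ler_pM2l //.
      by rewrite !mulr_gt0 ?expR_gt0 ?exprn_gt0 ?invr_gt0 ?exprn_gt0 ?divr_gt0.
    rewrite /v expRN le_eqVlt; apply/orP; left; apply/eqP; field.
    by rewrite !gt_eqF // expR_gt0.
  have : 1 <= expR (tau * eta / 4).
    by rewrite -expR0 ler_expR divr_ge0 // mulr_ge0 // ltW.
  lra.
pose q0 := expR (b * g%:R) * K * e b l.
have q0_ge0 : 0 <= q0 by rewrite !mulr_ge0 ?expR_ge0 ?exp_moment_ge0.
have q0_le : q0 <= expR (b * (l + g)%:R * (p + eta)).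
  apply: (@le_trans _ _ (expR (tau * (p + eta / 2)))); last first.
    rewrite ler_expR natrD (mulrDr b) bl.
    have : 0 <= b * g%:R * (p + eta) by rewrite mulr_ge0 ?(mulr_ge0 (ltW b_gt0)) ?ler0n ?(addr_ge0 p0 (ltW eta0)).
    have : tau * (eta / 2) <= tau * eta by rewrite ler_pM2l //; lra.
    lra.
  apply: (@le_trans _ _ (expR 1 * K * (2 * expR (tau * p + tau * eta / 4)))).
    by rewrite /q0 ler_pM ?mulr_ge0 ?expR_ge0 ?exp_moment_ge0 // ler_wpM2r // ler_expR.
  rewrite mulrA.
  have -> : tau * (p + eta / 2) = tau * eta / 4 + (tau * p + tau * eta / 4) by field.
  by rewrite [leRHS]expRD ler_pM2r ?expR_gt0.
exists b, (expR (b * (l + g)%:R)); split => // m.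
have lg0 : (0 < l + g)%N by rewrite addn_gt0 -(ltr_nat R) l_gt0.
rewrite -/(e b m) (divn_eq m (l + g)) (le_trans (exp_moment_blocks _ _ _ (ltW b_gt0) ng)) //.
set q := (m %/ _)%N; set r := (m %% _)%N.
rewrite -/q0 mulrC ler_pM ?exprn_ge0 ?expR_ge0 //.
  by rewrite ler_expR ler_wpM2l ?(ltW b_gt0) // ler_nat ltnW // ltn_mod.
rewrite (@le_trans _ _ (expR (b * (l + g)%:R * (p + eta)) ^+ q)) //.
  by rewrite lerXn2r ?nnegrE ?expR_ge0.
rewrite -expRM_natl ler_expR mulrA ler_wpM2r ?(addr_ge0 p0 (ltW eta0)) //.
rewrite [X in _ <= b * X]natrD natrM.
have : 0 <= b * r%:R by rewrite mulr_ge0 // ltW.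
lra.
Qed.

End ExponentialMoments.

(** * Gluing and finite approximation in a mixing subshift of finite type *)

Section SubshiftsOfFiniteType.
Context {A : pfinType} (F : seq (seq A)).
Local Notation X := (SFT F).
Local Notation a0 := (point : A).

Definition zshift {T : Type} (k : int) (x : int -> T) : int -> T := fun i => x (i + k).

Lemma iter_Sshift {T : Type} k (x : int -> T) : iter k Sshift x = zshift k%:Z x.
Proof.
elim: k => [|k IH]; first by apply/funext => i; rewrite /zshift addr0.
by rewrite iterS IH; apply/funext => i; rewrite /Sshift /zshift -addrA -addn1 PoszD (addrC 1).
Qed.

Lemma iter_SshiftE {T : Type} k (x : int -> T) i : iter k Sshift x i = x (i + k%:Z).
Proof. by rewrite iter_Sshift. Qed.

Lemma size_window {T : Type} (x : int -> T) i n : size (window x i n) = n.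
Proof. by rewrite size_map size_iota. Qed.

Lemma nth_window (x : int -> A) i n k : (k < n)%N ->
  nth a0 (window x i n) k = x (i + k%:Z).
Proof. by move=> kn; rewrite (nth_map 0%N) ?size_iota // nth_iota. Qed.

Lemma eq_window (x y : int -> A) i j n :
  (forall k, (k < n)%N -> x (i + k%:Z) = y (j + k%:Z)) <-> window x i n = window y j n.
Proof.
split=> [h|h k kn]; last by rewrite -!(nth_window _ _ kn) h.
by apply/eq_in_map => k; rewrite mem_iota => /andP[_]; exact: h.
Qed.

Lemma window_zshift {T : Type} (x : int -> T) k i n :
  window (zshift k x) i n = window x (i + k) n.
Proof. by apply: eq_map => j; rewrite /zshift addrAC. Qed.

Lemma window_cat {T : Type} (x : int -> T) i n p :
  window x i (n + p) = window x i n ++ window x (i + n%:Z) p.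
Proof.
rewrite /window iotaD map_cat; congr (_ ++ _).
rewrite add0n -[n in iota n]addn0 iotaDl -map_comp; apply: eq_map => j /=.
by rewrite PoszD addrA.
Qed.

Lemma SFT_zshift k x : X x -> X (zshift k x).
Proof. by move=> Xx i w wF; rewrite window_zshift; exact: Xx. Qed.

Lemma SFT_iter k x : X x -> X (iter k Sshift x).
Proof. by rewrite iter_Sshift; exact: SFT_zshift. Qed.

Lemma occursIn_window x i n : X x -> occursIn X (window x i n).
Proof. by move=> Xx; exists x, i; rewrite size_window. Qed.

(** Forbidden words have length at most [s], so only the [s] letters on either side of the gap
    matter. They form finitely many pairs, hence one gap length serves all. A window of length at
    most [s] of the glued sequence lies within [x], within [y], or within a point [t] that carries
    both sides and the gap word. *)
Lemma SFT_specification : mixing X -> exists N : nat, forall x y (n : int), X x -> X y ->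
  exists z, [/\ X z, forall i : int, i < n -> z i = x i &
                forall i : int, n + N%:Z <= i -> z i = y (i - (n + N%:Z))].
Proof.
move=> mix; pose s := \max_(w <- F) size w.
have sF w : w \in F -> (size w <= s)%N by move=> wF; rewrite /s (big_rem w) //= leq_maxl.
have gap (p : (s.-tuple A * s.-tuple A)%type) : exists N : nat,
    occursIn X p.1 -> occursIn X p.2 -> forall m : nat, (N <= m)%N ->
      exists w : seq A, size w = m /\ occursIn X (p.1 ++ w ++ p.2).
  have [[ou ov] | no] := pselect (occursIn X p.1 /\ occursIn X p.2).
    by have [N hN] := mix _ _ ou ov; exists N.
  by exists 0%N => ou ov; case: no.
have [g hg] := choice gap.
exists (\max_p g p)%N; set N := (\max_p g p)%N => x y n Xx Xy.
have su : size (window x (n - s%:Z) s) == s by rewrite size_window.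
have sv : size (window y 0 s) == s by rewrite size_window.
have gN : (g (Tuple su, Tuple sv) <= N)%N by exact: leq_bigmax.
have [w /= [sw [t [p [Xt]]]]] := hg (Tuple su, Tuple sv) (occursIn_window _ _ Xx) (occursIn_window _ _ Xy) N gN.
rewrite !size_cat !size_window sw => wt.
pose z (i : int) := if i < n then x i else
  if i < n + N%:Z then nth a0 w (absz (i - n)) else y (i - (n + N%:Z)).
have zx (i : int) : i < n -> z i = x i by rewrite /z => ->.
have zy (i : int) : n + N%:Z <= i -> z i = y (i - (n + N%:Z)).
  by move=> ni; rewrite /z !ltNge ni (le_trans _ ni) // lerDl.
have zt (i : int) : n - s%:Z <= i -> i < n + N%:Z + s%:Z -> z i = t (p + (i - (n - s%:Z))).
  move=> li ri; pose k := `|(i - (n - s%:Z))%R|%N.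
  have ks : (k < s + (N + s))%N by rewrite /k; lia.
  have -> : i - (n - s%:Z) = k%:Z by rewrite /k; lia.
  rewrite -(nth_window t p ks) wt !nth_cat !size_window sw /z.
  case: ifP => [ilt|ige].
    have ks' : (k < s)%N by rewrite /k; lia.
    by rewrite ks' nth_window //; congr x; rewrite /k; lia.
  have ks' : (s <= k)%N by rewrite /k; lia.
  rewrite ltnNge ks' /=; case: ifP => [ilt2|ige2].
    have kN : (k - s < N)%N by rewrite /k; lia.
    by rewrite kN; congr (nth _ w); rewrite /k; lia.
  have kN : (N <= k - s)%N by rewrite /k; lia.
  rewrite ltnNge kN /= nth_window; last by rewrite /k; lia.
  by congr y; rewrite /k; lia.
exists z; split => // i v vF; have := sF _ vF; set l := size v => ls.
have reduce x' (i' : int) : X x' -> (forall k, (k < l)%N -> z (i + k%:Z) = x' (i' + k%:Z)) ->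
    window z i l <> v.
  by move=> Xx' /eq_window ->; exact: Xx'.
have [il|il] := leP (i + l%:Z) n.
  by apply: (reduce x i) => // k kl; rewrite zx //; lia.
have [il2|il2] := leP (n + N%:Z) i.
  apply: (reduce y (i - (n + N%:Z))) => // k kl; rewrite zy; last lia.
  by congr y; lia.
apply: (reduce t (p + (i - (n - s%:Z)))) => // k kl; rewrite zt; last 2 first.
- by lia.
- by lia.
by congr t; lia.
Qed.

Definition occurs (w : seq A) := exists x, X x /\ window x 0 (size w) = w.

Definition word_rep (w : seq A) : int -> A :=
  if pselect (occurs w) is left e then projT1 (cid e) else fun=> a0.

Lemma word_repP w : occurs w -> X (word_rep w) /\ window (word_rep w) 0 (size w) = w.
Proof. by rewrite /word_rep; case: pselect => // e _; case: cid. Qed.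

Lemma occurs_window x i n : X x -> occurs (window x i n).
Proof.
move=> Xx; exists (zshift i x); split; first exact: SFT_zshift.
by rewrite size_window window_zshift add0r.
Qed.

(** The shift places [w] at coordinates from [- s] on. Applied to a central window of [x] it gives a
    point of the subshift close to [x] that takes finitely many values. *)
Definition approximant (s : nat) (w : seq A) : int -> A := zshift s%:Z (word_rep w).

Lemma approximantP s n x : X x -> let x' := approximant s (window x (- s%:Z) n) in
  X x' /\ forall i : int, - s%:Z <= i -> i < n%:Z - s%:Z -> x' i = x i.
Proof.
move=> Xx; have wo := occurs_window (- s%:Z) n Xx.
have [Xr rw] := word_repP wo; split; first exact: SFT_zshift.
move=> i li ri; rewrite size_window in rw; move/eq_window in rw.
have jn : (`|(i + s%:Z)%R| < n)%N by lia.
have := rw _ jn; rewrite /approximant /zshift.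
have -> : 0 + `|(i + s%:Z)%R|%N%:Z = i + s%:Z by lia.
by move=> ->; congr x; lia.
Qed.

Lemma birkhoffD {R : realType} (f : (int -> A) -> R) n p x :
  birkhoff f (n + p) x = birkhoff f n x + birkhoff f p (iter n Sshift x).
Proof.
rewrite /birkhoff big_split_ord /=; congr (_ + _); apply: eq_bigr => k _.
by congr f; rewrite -iterD addnC.
Qed.

End SubshiftsOfFiniteType.
Arguments SFT_iter {A F} k {x} _.
Arguments SFT_zshift {A F} k {x} _.

(** * Boltzmann weights of words and partition functions *)

Section GibbsWords.
Context {R : realType} {A : pfinType} (F : seq (seq A)).
Local Notation X := (SFT F).
Local Notation a0 := (point : A).
Variable N : nat.
Hypothesis gluing : forall x y (n : int), X x -> X y ->
  exists z, [/\ X z, forall i : int, i < n -> z i = x i &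
                forall i : int, n + N%:Z <= i -> z i = y (i - (n + N%:Z))].

Lemma glue_words x y n p : X x -> X y -> exists z, [/\ X z,
  window z 0 n = window x 0 n & window z (n + N)%:Z p = window y 0 p].
Proof.
move=> Xx Xy; have [z [Xz zx zy]] := gluing n%:Z Xx Xy; exists z; split => //.
  by apply/eq_window => k kn; rewrite zx //; lia.
by apply/eq_window => k kp; rewrite zy; [congr y|]; lia.
Qed.

Variable f : (int -> A) -> R.
Variables B D : R.
Hypothesis f_bound : forall x, X x -> `|f x| <= B.
Hypothesis f_distortion : forall n x y, X x -> X y -> window x 0 n = window y 0 n ->
  `|birkhoff f n x - birkhoff f n y| <= D.

Lemma birkhoff_bound n x : X x -> `|birkhoff f n x| <= n%:R * B.
Proof.
move=> Xx; rewrite (le_trans (ler_norm_sum _ _ _)) //.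
apply: (@le_trans _ _ (\sum_(k < n) B)); last by rewrite sumr_const card_ord mulr_natl.
by apply: ler_sum => k _; exact/f_bound/SFT_iter.
Qed.

(** The weight is read at an arbitrary point carrying the word; by bounded distortion any other such
    point changes it by a factor at most [expR D]. *)
Definition gibbs_weight (w : seq A) : R :=
  if pselect (occurs F w) then expR (birkhoff f (size w) (word_rep F w)) else 0.
Local Notation a := gibbs_weight.
Definition partition_function n := wsum n a.
Local Notation Z := partition_function.

Lemma gibbs_weight_ge0 w : 0 <= a w.
Proof. by rewrite /a; case: pselect => // _; exact: expR_ge0. Qed.

Lemma partition_function_ge0 n : 0 <= Z n.
Proof. by apply: wsum_ge0 => w _; exact: gibbs_weight_ge0. Qed.

Lemma gibbs_weight_window n x : X x ->
  expR (birkhoff f n x - D) <= a (window x 0 n) <= expR (birkhoff f n x + D).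
Proof.
move=> Xx; have wo := occurs_window 0 n Xx; rewrite /a; case: pselect => // ?.
have [Xr] := word_repP wo; rewrite size_window => /(f_distortion Xr Xx).
by rewrite ler_norml !ler_expR => /andP[? ?]; apply/andP; split; lra.
Qed.

Lemma gibbs_weight_cat u v : a (u ++ v) <= expR (2 * D) * (a u * a v).
Proof.
rewrite {1}/a; case: pselect => [wo|?]; last first.
  by rewrite !mulr_ge0 ?expR_ge0 ?gibbs_weight_ge0.
have [] := word_repP wo; set x := word_rep _ _ => Xx.
rewrite size_cat window_cat => /eqP; rewrite eqseq_cat ?size_window //.
rewrite add0r => /andP[/eqP eu /eqP ev].
have Sv : window (iter (size u) Sshift x) 0 (size v) = v.
  by rewrite iter_Sshift window_zshift add0r.
have /andP[hu _] := gibbs_weight_window (size u) Xx.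
have /andP[hv _] := gibbs_weight_window (size v) (SFT_iter (size u) Xx).
rewrite eu in hu; rewrite Sv in hv.
apply: (le_trans _ (ler_wpM2l (expR_ge0 _) (ler_pM (expR_ge0 _) (expR_ge0 _) hu hv))).
by rewrite -!expRD ler_expR birkhoffD; lra.
Qed.

Lemma gibbs_weight_glue u v :
  expR (- (3 * D) - N%:R * B) * (a u * a v) <= wsum N (fun s => a (u ++ s ++ v)).
Proof.
have s0 : 0 <= wsum N (fun s => a (u ++ s ++ v)).
  by apply: wsum_ge0 => s _; exact: gibbs_weight_ge0.
rewrite {1 2}/a; case: pselect => [wu|?]; last by rewrite mul0r mulr0.
case: pselect => [wv|?]; last by rewrite !mulr0.
have [] := word_repP wu; set x := word_rep _ u => Xx ux.
have [] := word_repP wv; set y := word_rep _ v => Xy vy.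
have [z [Xz zx zy]] := glue_words (size u) (size v) Xx Xy.
rewrite vy PoszD in zy; rewrite ux in zx.
set n := size u in zx zy *; set p := size v in zy *.
have zE : window z 0 (n + (N + p)) = u ++ window z n N ++ v.
  by rewrite window_cat zx add0r window_cat zy.
apply: le_trans (wsum_ge_term (n := N) (w := window z n N) _ (size_window _ _ _)); last first.
  by move=> ?; exact: gibbs_weight_ge0.
rewrite -zE; have /andP[h _] := gibbs_weight_window (n + (N + p)) Xz.
apply: le_trans h; rewrite -!expRD ler_expR !birkhoffD.
have h1 := f_distortion (n := n) Xz Xx; rewrite zx ux in h1; have {h1} := h1 erefl.
have := birkhoff_bound N (SFT_iter n Xz).
have h2 := f_distortion (n := p) (SFT_iter N (SFT_iter n Xz)) Xy.
have e : window (iter N Sshift (iter n Sshift z)) 0 p = v.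
  by rewrite !iter_Sshift !window_zshift add0r addrC zy.
rewrite e vy in h2; have {h2} := h2 erefl.
by rewrite !ler_norml => /andP[? ?] /andP[? ?] /andP[? ?]; lra.
Qed.

Lemma partition_function_trivial n x : X x -> Z n <= (#|A| ^ n)%:R * expR (n%:R * B).
Proof.
move=> Xx; rewrite -wsum_const; apply: le_wsum => w sw.
rewrite /a; case: pselect => [wo|?]; last exact: expR_ge0.
have [Xr _] := word_repP wo; rewrite sw ler_expR.
by have := birkhoff_bound n Xr; rewrite ler_norml => /andP[].
Qed.

(** Unnormalized finite-volume probability that [w] sits at position [p]. *)
Definition occurrences p q w := wsum p (fun u => wsum q (fun v => a (u ++ w ++ v))).

Lemma occurrences_total p n q : Z (p + (n + q)) = wsum n (occurrences p q).
Proof.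
rewrite /occurrences wsum_wsum /Z wsum_cat; apply: eq_wsum => u _.
by rewrite wsum_cat.
Qed.

(** Gaps of length [N] are split off on both sides although an upper bound does not require them:
    this gives it the same main factor [Z p * a w * Z q] as the lower bound, where gluing consumes
    these gaps. Four cuts at [2 * D] each produce [8 * D]. *)
Lemma occurrences_upper p q w :
  occurrences (p + N) (N + q) w <= expR (8 * D) * Z N ^+ 2 * (Z p * a w * Z q).
Proof.
rewrite /occurrences wsum_cat.
have -> : expR (8 * D) * Z N ^+ 2 * (Z p * a w * Z q) =
  wsum p (fun u => wsum N (fun s => wsum N (fun t => wsum q (fun v =>
    expR (8 * D) * a u * a s * a w * a t * a v)))).
  rewrite -[LHS]mulrA [Z p * _ * _]mulrAC expr2.
  have -> : expR (8 * D) * (Z N * Z N * (Z p * Z q * a w)) =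
    expR (8 * D) * a w * Z N * Z N * Z q * Z p by ring.
  rewrite -wsumZ; apply: eq_wsum => u _.
  have -> : expR (8 * D) * a w * Z N * Z N * Z q * a u =
    expR (8 * D) * a w * Z N * Z q * a u * Z N by ring.
  rewrite -wsumZ; apply: eq_wsum => s _.
  have -> : expR (8 * D) * a w * Z N * Z q * a u * a s =
    expR (8 * D) * a w * Z q * a u * a s * Z N by ring.
  rewrite -wsumZ; apply: eq_wsum => t _.
  have -> : expR (8 * D) * a w * Z q * a u * a s * a t =
    expR (8 * D) * a u * a s * a w * a t * Z q by ring.
  by rewrite -wsumZ.
apply: le_wsum => u _; apply: le_wsum => s _; rewrite wsum_cat.
apply: le_wsum => t _; apply: le_wsum => v _; rewrite -catA.
have c8 : expR (8 * D) = expR (2 * D) * (expR (2 * D) * (expR (2 * D) * expR (2 * D))).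
  by rewrite -!expRD; congr expR; ring.
have h1 := gibbs_weight_cat u (s ++ w ++ t ++ v).
have h2 := gibbs_weight_cat s (w ++ t ++ v).
have h3 := gibbs_weight_cat w (t ++ v).
have h4 := gibbs_weight_cat t v.
have E0 := expR_ge0 (2 * D).
apply: (le_trans h1).
have -> : expR (8 * D) * a u * a s * a w * a t * a v = expR (2 * D) * (a u *
  (expR (2 * D) * (a s * (expR (2 * D) * (a w * (expR (2 * D) * (a t * a v))))))).
  by rewrite c8; ring.
do 2 (rewrite ler_wpM2l // ?gibbs_weight_ge0 //); apply: (le_trans h2).
do 2 (rewrite ler_wpM2l // ?gibbs_weight_ge0 //); apply: (le_trans h3).
by do 2 (rewrite ler_wpM2l // ?gibbs_weight_ge0 //).
Qed.

Lemma occurrences_lower p q w :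
  expR (- (3 * D) - N%:R * B) ^+ 2 * (Z p * a w * Z q) <= occurrences (p + N) (N + q) w.
Proof.
set c := expR _; rewrite /occurrences wsum_cat.
have -> : c ^+ 2 * (Z p * a w * Z q) = wsum p (fun u => wsum q (fun v =>
    c * (c * (a u * a w) * a v))).
  have -> : c ^+ 2 * (Z p * a w * Z q) = c ^+ 2 * a w * Z q * Z p by ring.
  rewrite -wsumZ; apply: eq_wsum => u _.
  have -> : c ^+ 2 * a w * Z q * a u = c ^+ 2 * a w * a u * Z q by ring.
  by rewrite -wsumZ; apply: eq_wsum => v _; ring.
apply: le_wsum => u _.
rewrite [leRHS](eq_wsum (g' := fun s => wsum q (fun v => wsum N (fun t => a ((u ++ s ++ w) ++ t ++ v))))); last first.
  move=> s _; rewrite wsum_cat wsum_wsum; apply: eq_wsum => v _; apply: eq_wsum => t _.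
  by rewrite -!catA.
rewrite wsum_wsum; apply: le_wsum => v _.
apply: (@le_trans _ _ (wsum N (fun s => c * (a v * a (u ++ s ++ w))))); last first.
  by apply: le_wsum => s _; rewrite [a v * _]mulrC; exact: gibbs_weight_glue.
rewrite !wsumZ ler_wpM2l ?expR_ge0 // [leRHS]mulrC ler_wpM2r ?gibbs_weight_ge0 //.
exact: gibbs_weight_glue.
Qed.

End GibbsWords.

(** * Word weights of a Gibbs measure, and bounds free of its Gibbs constant *)

Section GibbsWordMeasures.
Context {R : realType} {A : pfinType} (F : seq (seq A)).
Local Notation X := (SFT F).
Local Notation a0 := (point : A).
Variable N : nat.
Hypothesis gluing : forall x y (n : int), X x -> X y ->
  exists z, [/\ X z, forall i : int, i < n -> z i = x i &
                forall i : int, n + N%:Z <= i -> z i = y (i - (n + N%:Z))].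
Variable f : (int -> A) -> R.
Variables B D : R.
Hypothesis f_bound : forall x, X x -> `|f x| <= B.
Hypothesis f_distortion : forall n x y, X x -> X y -> window x 0 n = window y 0 n ->
  `|birkhoff f n x - birkhoff f n y| <= D.
Variable M : seq A -> R.
Hypothesis M_ge0 : forall w, 0 <= M w.
Hypothesis M_nil : M [::] = 1.
Hypothesis M_left : forall w, M w = \sum_(a : A) M (a :: w).
Hypothesis M_right : forall w, M w = \sum_(a : A) M (rcons w a).
Hypothesis M_supp : forall w, ~ occurs F w -> M w = 0.
Variables K P : R.
Hypothesis K_gt0 : 0 < K.
Let G n x := expR (- n%:R * P + birkhoff f n x).
Hypothesis M_gibbs : forall n x, X x -> K^-1 * G n x <= M (window x 0 n) <= K * G n x.

Lemma gibbs_factorD n p x : G (n + p) x = G n x * G p (iter n Sshift x).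
Proof. by rewrite /G -expRD birkhoffD natrD; congr expR; ring. Qed.

Lemma gibbs_factor_le n x : X x -> G n x <= K * M (window x 0 n).
Proof. by move=> /(M_gibbs n) /andP[+ _]; rewrite ler_pdivrMl. Qed.

Lemma gibbs_quasi u v : M (u ++ v) <= K ^+ 3 * (M u * M v).
Proof.
have [wo|/M_supp->] := pselect (occurs F (u ++ v)); last first.
  by rewrite mulr_ge0 ?exprn_ge0 ?mulr_ge0 ?(ltW K_gt0).
have [] := word_repP wo; set x := word_rep _ _ => Xx.
rewrite size_cat window_cat => /eqP; rewrite eqseq_cat ?size_window //.
rewrite add0r => /andP[/eqP eu /eqP ev].
have Sv : window (iter (size u) Sshift x) 0 (size v) = v.
  by rewrite iter_Sshift window_zshift add0r.
have hu := gibbs_factor_le (size u) Xx; rewrite eu in hu.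
have hv := gibbs_factor_le (size v) (SFT_iter (size u) Xx); rewrite Sv in hv.
have /andP[_ h] := M_gibbs (size u + size v) Xx.
rewrite window_cat eu add0r ev gibbs_factorD in h; apply: (le_trans h).
have -> : K ^+ 3 * (M u * M v) = K * ((K * M u) * (K * M v)) by ring.
by rewrite ler_pM2l // ler_pM ?expR_ge0.
Qed.

(** The Gibbs bound is used three times, for the glued word and for its two ends; the exponential
    bounds the Gibbs factor of the gap from below. *)
Definition gibbs_mixing_const := K ^- 3 * expR (- (N%:R * (`|P| + B))).

Lemma gibbs_mixing_const_gt0 : 0 < gibbs_mixing_const.
Proof. by rewrite mulr_gt0 ?expR_gt0 // invr_gt0 exprn_gt0. Qed.

Lemma gibbs_mixing u v :
  gibbs_mixing_const * (M u * M v) <= wsum N (fun s => M (u ++ s ++ v)).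
Proof.
have s0 : 0 <= wsum N (fun s => M (u ++ s ++ v)) by apply: wsum_ge0.
have [wu|/M_supp->] := pselect (occurs F u); last by rewrite mul0r mulr0.
have [wv|/M_supp->] := pselect (occurs F v); last by rewrite !mulr0.
have [] := word_repP wu; set x := word_rep _ u => Xx ux.
have [] := word_repP wv; set y := word_rep _ v => Xy vy.
have [z [Xz zx zy]] := glue_words (@gluing) (size u) (size v) Xx Xy.
rewrite vy PoszD in zy; rewrite ux in zx.
set n := size u in zx zy *; set p := size v in zy *.
have zE : window z 0 (n + (N + p)) = u ++ window z n N ++ v.
  by rewrite window_cat zx add0r window_cat zy.
have ev : window (iter N Sshift (iter n Sshift z)) 0 p = v.
  by rewrite !iter_Sshift !window_zshift add0r addrC zy.
apply: le_trans (wsum_ge_term (n := N) (w := window z n N) _ (size_window _ _ _)); last first.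
  by move=> ?; exact: M_ge0.
rewrite -zE; have /andP[h _] := M_gibbs (n + (N + p)) Xz; apply: le_trans h.
rewrite !gibbs_factorD.
have /andP[_ hu] := M_gibbs n Xz; rewrite zx in hu.
have /andP[_ hv] := M_gibbs p (SFT_iter N (SFT_iter n Xz)); rewrite ev in hv.
have hN : expR (- (N%:R * (`|P| + B))) <= G N (iter n Sshift z).
  rewrite ler_expR.
  have := birkhoff_bound (@f_bound) N (SFT_iter n Xz).
  rewrite ler_norml => /andP[? _].
  have : N%:R * P <= N%:R * `|P| by rewrite ler_wpM2l // ler_norm.
  lra.
have -> : gibbs_mixing_const * (M u * M v) =
  K^-1 * ((K^-1 * M u) * (expR (- (N%:R * (`|P| + B))) * (K^-1 * M v))).
  by rewrite /gibbs_mixing_const; field; exact: lt0r_neq0.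
rewrite ler_pM2l ?invr_gt0 //.
have K1 : 0 <= K^-1 by rewrite invr_ge0 ltW.
have hu' : K^-1 * M u <= G n z by rewrite ler_pdivrMl.
have hv' : K^-1 * M v <= G p (iter N Sshift (iter n Sshift z)) by rewrite ler_pdivrMl.
by rewrite !ler_pM ?mulr_ge0 ?expR_ge0.
Qed.

Local Notation a := (gibbs_weight F f).
Local Notation Z := (partition_function F f).
Local Notation E := (wmean a0 M).

Lemma gibbs_weight_le v : a v <= K ^+ 2 * Z (size v) * M v.
Proof.
rewrite {1}/gibbs_weight; case: pselect => [wo|?]; last first.
  by rewrite mulr_ge0 // mulr_ge0 ?sqr_ge0 // partition_function_ge0.
set n := size v; have [Xr rv] := word_repP wo.
have hv := gibbs_factor_le n Xr; rewrite rv in hv.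
(* Summing the Gibbs upper bound over all words of length [n] compares the total mass 1 with the
   partition function, which eliminates the pressure. *)
have hZ : 1 <= K * expR (- n%:R * P) * Z n.
  rewrite -{1}M_nil -(wsum_M_right M_right n [::]) -wsumZ; apply: le_wsum => w sw /=.
  rewrite /gibbs_weight; case: pselect => [wo'|no]; last by rewrite M_supp ?mulr0.
  have [Xr' rv'] := word_repP wo'; rewrite sw in rv' *.
  by have /andP[_] := M_gibbs n Xr'; rewrite rv' /G expRD mulrA.
have e0 := expR_gt0 (- n%:R * P).
rewrite -(ler_pM2l e0) -expRD (le_trans hv) //.
have -> : expR (- n%:R * P) * (K ^+ 2 * Z n * M v) = (K * M v) * (K * expR (- n%:R * P) * Z n) by ring.
by rewrite ler_peMr // mulr_ge0 // ltW.
Qed.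

Definition word_indicator (w : seq A) (x : nat -> A) : R := (mkseq x (size w) == w)%:R.

Lemma depends_word_indicator w : depends (size w) (word_indicator w).
Proof.
move=> x y xy; rewrite /word_indicator; congr ((_ == _)%:R).
by apply/eq_in_map => i; rewrite mem_iota => /andP[_]; exact: xy.
Qed.

Lemma word_indicator_cat u w' t w : size w' = size w ->
  word_indicator w (nshift (size u) (wseq a0 (u ++ w' ++ t))) = (w' == w)%:R.
Proof.
move=> sw; rewrite wseq_catr /word_indicator -sw; congr ((_ == _)%:R).
apply: (@eq_from_nth _ a0); rewrite ?size_mkseq // => i iw.
by rewrite nth_mkseq // wseq_catl.
Qed.

Lemma wsum_word_indicator (b : seq A -> R) p q w :
  wsum (p + (size w + q)) (fun v => b v * word_indicator w (nshift p (wseq a0 v))) =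
  wsum p (fun u => wsum q (fun v => b (u ++ w ++ v))).
Proof.
rewrite wsum_cat; apply: eq_wsum => u <-; rewrite wsum_cat.
rewrite -[RHS](wsum_pred1 (n := size w) (fun w => wsum q (fun v => b (u ++ w ++ v)))) //.
apply: eq_wsum => w' sw; have [->|ww'] := eqVneq w' w.
  by apply: eq_wsum => t _; rewrite word_indicator_cat // eqxx mulr1.
rewrite -[RHS](wsum0 (A := A) q); apply: eq_wsum => t _.
by rewrite word_indicator_cat // (negbTE ww') mulr0.
Qed.

Lemma wmean_word_indicator w : E (size w) (word_indicator w) = M w.
Proof.
have := wsum_word_indicator M 0 0 w; rewrite /= cats0 addn0 => <-.
by apply: eq_wsum.
Qed.

Lemma partition_function_gt0 n : 0 < Z n.
Proof.
rewrite lt_def partition_function_ge0 andbT; apply/eqP => Z0.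
have : wsum n (fun v => M ([::] ++ v)) <= wsum (A := A) n (fun=> 0).
  apply: le_wsum => w sw /=.
  have [wo|/M_supp->] := pselect (occurs F w); last by [].
  have := wsum_ge_term (gibbs_weight_ge0 F f) sw; rewrite -/(Z n) Z0.
  by rewrite /gibbs_weight; case: pselect => // ?; rewrite leNgt expR_gt0.
by rewrite wsum_M_right // M_nil wsum0 ler10.
Qed.

(** The ratio of the constants of [occurrences_upper] and [occurrences_lower]; neither [K] nor [P]
    occurs in it. *)
Definition gibbs_const := expR (8 * D) * Z N ^+ 2 * expR (- (3 * D) - N%:R * B) ^- 2.

Lemma gibbs_const_gt0 : 0 < gibbs_const.
Proof. by rewrite !mulr_gt0 ?invr_gt0 ?exprn_gt0 ?expR_gt0 ?partition_function_gt0. Qed.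

(** [occurrences] is comparable to [Z p * a w * Z q]. Summing over the words of length [n] compares
    [Z L] with [Z p * Z n * Z q], and eliminating [Z p * Z q] leaves the ratio of [a w] to [Z n]. *)
Lemma occurrences_ratio p q w (n := size w) (L := (p + N + (n + (N + q)))%N) :
  occurrences F f (p + N) (N + q) w * Z n <= gibbs_const * a w * Z L /\
  a w * Z L <= gibbs_const * (occurrences F f (p + N) (N + q) w * Z n).
Proof.
rewrite /L occurrences_total /gibbs_const.
have up := occurrences_upper N (@f_distortion) p q.
have lo := occurrences_lower (@gluing) (@f_bound) (@f_distortion) p q.
move: (expR_gt0 (- (3 * D) - N%:R * B)) up lo; set c := expR (- _ - _).
set C1 := expR (8 * D) * _ => c0 up lo.
have C10 : 0 < C1 by rewrite mulr_gt0 ?expR_gt0 // exprn_gt0 // partition_function_gt0.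
have c20 : 0 < c ^+ 2 by rewrite exprn_gt0.
have Cc0 : 0 <= C1 * c ^- 2 by rewrite mulr_ge0 ?invr_ge0 ?(ltW C10) ?(ltW c20).
have Zp := partition_function_ge0 F f p; have Zq := partition_function_ge0 F f q.
have Zn := partition_function_ge0 F f n.
have aw := gibbs_weight_ge0 F f w.
have sumE : wsum n (fun w => Z p * a w * Z q) = Z p * Z n * Z q.
  have -> : Z p * Z n * Z q = (Z p * Z q) * Z n by ring.
  by rewrite -wsumZ; apply: eq_wsum => v _; ring.
have up' : wsum n (occurrences F f (p + N) (N + q)) <= C1 * (Z p * Z n * Z q).
  by rewrite -sumE -wsumZ; apply: le_wsum => v _; exact: up.
have lo' : c ^+ 2 * (Z p * Z n * Z q) <= wsum n (occurrences F f (p + N) (N + q)).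
  by rewrite -sumE -wsumZ; apply: le_wsum => v _; exact: lo.
split.
  apply: (le_trans (ler_wpM2r Zn (up w))).
  apply: le_trans (ler_wpM2l _ lo'); last by rewrite mulr_ge0.
  rewrite le_eqVlt; apply/orP; left; apply/eqP; field; exact: lt0r_neq0.
apply: (le_trans (ler_wpM2l aw up')).
apply: le_trans (ler_wpM2l Cc0 (ler_wpM2r Zn (lo w))).
rewrite le_eqVlt; apply/orP; left; apply/eqP; field; exact: lt0r_neq0.
Qed.

(* Under the finite-volume weights [a v / Z L], which are dominated by [K ^+ 2 * M],
   the frequency of [w] tends to [M w] by the law of large numbers, while its
   expectation is comparable to [a w / Z n] up to [gibbs_const]. *)
Lemma frequency_approx w (n := size w) (d : R) : 0 < d ->
  exists m : nat, [/\ (0 < m)%N &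
    `|\sum_(j < m) occurrences F f (j + N) (N + (m - j)) w - m%:R * (M w * Z (N + ((m * 1 + n) + N)))|
    <= 2 * d * m%:R * Z (N + ((m * 1 + n) + N))].
Proof.
move=> d0; pose h x := word_indicator w x - M w.
have M1 : M w <= 1.
  rewrite -M_nil -(wsum_M_right M_right n [::]).
  exact: (wsum_ge_term (g := fun v => M ([::] ++ v)) (fun=> M_ge0 _)).
have h1 x : `|h x| <= 1.
  rewrite /h /word_indicator; have := M_ge0 w.
  by case: (_ == _) => /= ?; rewrite ler_norml; apply/andP; split; lra.
have hd : depends n h by move=> x y xy; rewrite /h (depends_word_indicator xy).
have h0 : E n h = 0 by rewrite wmeanD wmean_word_indicator wmean_cst // subrr.
(* The division by [K ^+ 2] compensates in advance the factor lost in passing from [M] to the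
   finite-volume weights. *)
have e0 : 0 < d ^+ 2 / K ^+ 2 by rewrite divr_gt0 // exprn_gt0.
have [m [m0 Vm]] := variance_small M_ge0 M_nil M_left M_right gibbs_mixing_const_gt0
  gibbs_mixing (ltn0Sn 0) hd h1 h0 1 e0.
exists m; split => //; set L := (N + _)%N.
set H := fun v => stride_sum 1 h m (nshift N (wseq a0 v)).
have HE : wsum L (fun v => a v * H v) =
  \sum_(j < m) occurrences F f (j + N) (N + (m - j)) w - m%:R * (M w * Z L).
  rewrite (eq_wsum (g' := fun v => \sum_(j < m) (a v * word_indicator w (nshift (j + N) (wseq a0 v))
     + - M w * a v))); last first.
    move=> v _; rewrite /H /stride_sum mulr_sumr; apply: eq_bigr => j _.
    have -> : nshift (j * 1) (nshift N (wseq a0 v)) = nshift (j + N) (wseq a0 v).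
      by apply/funext => i; rewrite /nshift; congr wseq; lia.
    by rewrite /h; ring.
  rewrite wsum_sum.
  have -> : m%:R * (M w * Z L) = \sum_(j < m) M w * Z L.
    by rewrite sumr_const card_ord mulr_natl.
  rewrite -sumrB; apply: eq_bigr => j _; rewrite wsumD wsumZ mulNr; congr (_ - _).
  have -> : L = ((j + N) + (size w + (N + (m - j))))%N.
    by rewrite /L -/n; have := ltn_ord j; lia.
  exact: wsum_word_indicator.
rewrite -HE.
have m_gt0 : 0 < m%:R :> R by rewrite ltr0n.
have H2 : wsum L (fun v => a v * H v ^+ 2) <= d ^+ 2 * m%:R ^+ 2 * Z L.
  apply: (@le_trans _ _ (wsum L (fun v => K ^+ 2 * Z L * (M v * H v ^+ 2)))).
    apply: le_wsum => v sv; rewrite mulrA ler_wpM2r ?sqr_ge0 //.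
    by rewrite -sv gibbs_weight_le.
  rewrite wsumZ /H.
  have -> : wsum L (fun v => M v * stride_sum 1 h m (nshift N (wseq a0 v)) ^+ 2) =
     E (m * 1 + n) (fun x => stride_sum 1 h m x ^+ 2).
    have dH : depends (N + (m * 1 + n)) (fun x => stride_sum 1 h m (nshift N x) ^+ 2).
      apply: (depends_shift (g := fun x => stride_sum 1 h m x ^+ 2)) => x y xy.
      by congr (_ ^+ 2); exact: (depends_stride_sum hd xy).
    rewrite -(wmean_shift a0 M_left N _ (fun x => stride_sum 1 h m x ^+ 2)).
    rewrite -(wmean_widen (n' := L) a0 M_right _ dH) //.
    by rewrite /L leq_add2l leq_addr.
  apply: (le_trans (ler_wpM2l _ Vm)).
    by rewrite mulr_ge0 ?sqr_ge0 ?partition_function_ge0.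
  rewrite le_eqVlt; apply/orP; left; apply/eqP; field; exact: lt0r_neq0.
(* In place of Cauchy-Schwarz: [s * H v] is at most [y + y^-1 * H v ^+ 2] with [y = d * m%:R], for
   both signs. *)
have H1 (s : R) : s = 1 \/ s = -1 -> s * wsum L (fun v => a v * H v) <= 2 * d * m%:R * Z L.
  move=> s1.
  apply: (@le_trans _ _ (wsum L (fun v => d * m%:R * a v + (d * m%:R)^-1 * (a v * H v ^+ 2)))).
    rewrite -wsumZ; apply: le_wsum => v _.
    have av := gibbs_weight_ge0 F f v.
    have -> : d * m%:R * a v + (d * m%:R)^-1 * (a v * H v ^+ 2) =
      a v * (d * m%:R + (d * m%:R)^-1 * H v ^+ 2) by ring.
    rewrite mulrCA ler_wpM2l //; set y := d * m%:R.
    have y0 : 0 < y by rewrite mulr_gt0.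
    rewrite -(ler_pM2l y0) mulrDr mulVKf ?lt0r_neq0 //.
    have : 0 <= (y - s * H v) ^+ 2 by exact: sqr_ge0.
    have : 0 <= y ^+ 2 by exact: sqr_ge0.
    have : 0 <= H v ^+ 2 by exact: sqr_ge0.
    by case: s1 => -> *; nra.
  rewrite wsumD !wsumZ -/(Z L).
  have : (d * m%:R)^-1 * wsum L (fun v => a v * H v ^+ 2) <= d * m%:R * Z L.
    rewrite ler_pdivrMl ?mulr_gt0 // (le_trans H2) //.
    rewrite le_eqVlt; apply/orP; left; apply/eqP; ring.
  lra.
rewrite ler_norml; apply/andP; split.
  by have := H1 (-1) (or_intror erefl); lra.
by have := H1 1 (or_introl erefl); lra.
Qed.

(** The finite-volume frequency of [w] is close to [M w], and at every position it is comparable to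
    [a w / Z n]. The Gibbs constant [K] decides only how large a volume must be taken, so it
    disappears when the error [d] tends to 0 with [n] fixed. *)
Lemma gibbs_uniform w (n := size w) :
  M w * Z n <= gibbs_const * a w /\ a w <= gibbs_const * (M w * Z n).
Proof.
have Zn := partition_function_gt0 n.
have C0 := gibbs_const_gt0.
have key d : 0 < d -> M w * Z n <= gibbs_const * a w + 2 * d * Z n /\
    a w <= gibbs_const * (M w * Z n) + gibbs_const * (2 * d * Z n).
  move=> d0; have [m [m0 hm]] := frequency_approx w d0.
  move: hm; rewrite -/n; set L := (N + _)%N => hm.
  have ZL := partition_function_gt0 L.
  have mR : 0 < m%:R :> R by rewrite ltr0n.
  set T := \sum_(j < m) _ in hm.
  have [T1 T2] : T * Z n <= m%:R * (gibbs_const * a w * Z L) /\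
      m%:R * (a w * Z L) <= gibbs_const * (T * Z n).
    have c1 (r : R) : m%:R * r = \sum_(j < m) r by rewrite sumr_const card_ord mulr_natl.
    have LE (j : 'I_m) : L = (j + N + (n + (N + (m - j))))%N.
      by rewrite /L; have := ltn_ord j; lia.
    split.
      rewrite /T mulr_suml c1; apply: ler_sum => j _.
      by rewrite (LE j); have [] := occurrences_ratio j (m - j) w.
    rewrite /T mulr_suml mulr_sumr c1; apply: ler_sum => j _.
    by rewrite (LE j); have [] := occurrences_ratio j (m - j) w.
  move: hm; rewrite ler_norml => /andP[h1 h2].
  have mZ : 0 < m%:R * Z L by rewrite mulr_gt0.
  split; rewrite -(ler_pM2l mZ).
    apply: (@le_trans _ _ ((T + 2 * d * m%:R * Z L) * Z n)); last by lra.
    have -> : m%:R * Z L * (M w * Z n) = (m%:R * (M w * Z L)) * Z n by ring.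
    by rewrite ler_pM2r //; lra.
  apply: (@le_trans _ _ (gibbs_const * (T * Z n))); first by lra.
  have -> : m%:R * Z L * (gibbs_const * (M w * Z n) + gibbs_const * (2 * d * Z n)) =
    gibbs_const * ((m%:R * (M w * Z L) + 2 * d * m%:R * Z L) * Z n) by ring.
  by rewrite ler_pM2l // ler_pM2r //; lra.
split; apply/ler_addgt0Pr => e e0.
  have /key[h _] : 0 < e / (2 * Z n) by rewrite divr_gt0 // mulr_gt0.
  apply: (le_trans h); rewrite le_eqVlt; apply/orP; left; apply/eqP; field.
  exact: lt0r_neq0.
have /key[_ h] : 0 < e / (2 * Z n * gibbs_const) by rewrite divr_gt0 // mulr_gt0 // mulr_gt0.
apply: (le_trans h); rewrite le_eqVlt; apply/orP; left; apply/eqP; field.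
by rewrite !lt0r_neq0.
Qed.

End GibbsWordMeasures.

(** * Integration of functions of finitely many hidden coordinates *)

Section MonotoneIntegral.
Context {d : measure_display} {T : measurableType d} {R : realType}.
Local Open Scope ereal_scope.

(** No measurability is asked, because the integral of a nonnegative function is a supremum over the
    simple functions below it. The likelihood as a function of the parameter is treated in this
    way. *)
Lemma le_integral_nonneg (mu : {measure set T -> \bar R}) (D : set T) (f g : T -> \bar R) :
  (forall x, D x -> 0 <= f x) -> (forall x, D x -> f x <= g x) ->
  \int[mu]_(x in D) f x <= \int[mu]_(x in D) g x.
Proof.
move=> f0 fg; have g0 x : D x -> 0 <= g x by move=> Dx; rewrite (le_trans _ (fg _ Dx)) ?f0.
rewrite !ge0_integralE //; apply: le_ereal_sup => _ [h hf <-]; exists h => // x.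
apply: (le_trans (hf x)); rewrite /patch; case: ifPn => // /set_mem; exact: fg.
Qed.

End MonotoneIntegral.

Lemma measurable_fun_generated {d} {aT : measurableType d} {T : pointedType}
    (G : set (set T)) (f : aT -> g_sigma_algebraType G) :
  (forall C, G C -> measurable (f @^-1` C)) -> measurable_fun [set: aT] f.
Proof.
move=> mf; apply: (@measurability _ _ aT (g_sigma_algebraType G) setT f G) => //.
by move=> _ [C GC <-]; rewrite setTI; exact: mf.
Qed.

Section WordWeights.
Context {R : realType} {A : pfinType} (F : seq (seq A)).
Local Notation X := (SFT F).
Local Notation a0 := (point : A).

Lemma measurable_coordinate i a : measurable ([set x | x i = a] : set (seqX A)).
Proof. by apply: sub_sigma_algebra; exists i, a. Qed.

Definition windowset (i : int) (w : seq A) : set (seqX A) :=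
  [set x | window x i (size w) = w].

Lemma windowset_cons i a w :
  windowset i (a :: w) = [set x | x i = a] `&` windowset (i + 1) w.
Proof.
have E x : window x i (size w).+1 = x i :: window x (i + 1) (size w).
  by rewrite -add1n window_cat /window /= addr0.
apply/seteqP; split => x /=; rewrite /windowset /= E; first by case=> -> ->.
by case=> -> ->.
Qed.

Lemma measurable_windowset i w : measurable (windowset i w).
Proof.
elim: w i => [|a w IH] i.
  by rewrite (_ : windowset _ _ = setT) //; apply/seteqP; split.
by rewrite windowset_cons; apply: measurableI => //; exact: measurable_coordinate.
Qed.

Lemma measurable_SFT : measurable (X : set (seqX A)).
Proof.
have -> : X = \bigcap_(k : nat) (\bigcap_(w in [set` F]) ~` windowset k%:Z w `&`
    \bigcap_(w in [set` F]) ~` windowset (- k%:Z) w).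
  apply/seteqP; split => [x Xx k _|x Xx i w wF].
    by split => w wF; exact: Xx.
  have [Xp Xn] := Xx `|i|%N I.
  have [ip|iN] := leP 0 i.
    by have := Xp w wF; rewrite /windowset /= gez0_abs.
  by have := Xn w wF; rewrite /windowset /= lez0_abs ?opprK // ltW.
have mF (k : int) : measurable (\bigcap_(w in [set` F]) ~` windowset k w).
  apply: fin_bigcap_measurable => [|w _]; first exact: finite_seq.
  by apply: measurableC; exact: measurable_windowset.
by apply: bigcapT_measurable => k; apply: measurableI.
Qed.

Lemma measurable_Sshift : measurable_fun [set: seqX A] (Sshift : seqX A -> seqX A).
Proof.
apply: measurable_fun_generated => _ [i [a ->]].
exact: (measurable_coordinate (i + 1) a).
Qed.

Variable mu : probability (seqX A) R.
Hypothesis mu_inv : forall B : set (seqX A), measurable B -> mu (Sshift @^-1` B) = mu B.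
Hypothesis mu_X : mu X = 1%E.

Lemma measurable_iter_Sshift k :
  measurable_fun [set: seqX A] (iter k Sshift : seqX A -> seqX A).
Proof.
elim: k => [|k IH]; first exact: measurable_id.
exact: (measurableT_comp measurable_Sshift IH).
Qed.

Lemma iter_Sshift_inv k (B : set (seqX A)) : measurable B ->
  mu (iter k Sshift @^-1` B) = mu B.
Proof.
elim: k B => [|k IH] B mB //.
rewrite -(mu_inv mB) -(IH (Sshift @^-1` B)) //.
rewrite -[X in measurable X]setTI; exact: measurable_Sshift.
Qed.

Definition word_weight (w : seq A) : R := fine (mu (windowset 0 w)).
Local Notation M := word_weight.

Lemma word_weightE w : mu (windowset 0 w) = (M w)%:E.
Proof. by rewrite /M fineK // fin_num_measure //; exact: measurable_windowset. Qed.

Lemma word_weight_shift k w : mu (windowset k%:Z w) = (M w)%:E.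
Proof.
rewrite -word_weightE -(iter_Sshift_inv k (measurable_windowset 0 w)); congr (mu _).
by apply/seteqP; split => x; rewrite /windowset /= iter_Sshift window_zshift add0r.
Qed.

Lemma word_weight_ge0 w : 0 <= M w.
Proof. exact: fine_ge0. Qed.

Lemma word_weight_nil : M [::] = 1.
Proof.
rewrite /M (_ : windowset _ _ = setT) ?probability_setT //.
by apply/seteqP; split.
Qed.

Lemma measure_coordinate_split (B : set (seqX A)) (i : int) : measurable B ->
  mu B = (\sum_(a : A) mu ([set x | x i = a] `&` B))%E.
Proof.
move=> mB; rewrite fsbig_seq ?index_enum_uniq // -measure_fin_bigcup.
- congr (mu _); apply/seteqP; split=> [x Bx|x [a _ []] //].
  by exists (x i) => //=; rewrite mem_index_enum.
- exact: finite_seq.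
- by move=> a b _ _ [x [[/= <- _] [/= <- _]]].
- by move=> a _; apply: measurableI => //; exact: measurable_coordinate.
Qed.

Lemma word_weight_left w : M w = \sum_(a : A) M (a :: w).
Proof.
apply: EFin_inj; rewrite -(word_weight_shift 1 w) -sumEFin.
rewrite (measure_coordinate_split 0 (measurable_windowset _ _)).
by apply: eq_bigr => a _; rewrite -word_weightE windowset_cons add0r.
Qed.

Lemma windowset_rcons i w a :
  windowset i (rcons w a) = [set x | x (i + (size w)%:Z) = a] `&` windowset i w.
Proof.
have E x : window x i (size w).+1 = rcons (window x i (size w)) (x (i + (size w)%:Z)).
  by rewrite -addn1 window_cat cats1 /window /= addr0.
apply/seteqP; split => x /=; rewrite /windowset /= size_rcons E.
  by move/rcons_inj => [-> ->].
by case=> -> ->.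
Qed.

Lemma word_weight_right w : M w = \sum_(a : A) M (rcons w a).
Proof.
apply: EFin_inj; rewrite -word_weightE -sumEFin.
rewrite (measure_coordinate_split (0 + (size w)%:Z) (measurable_windowset _ _)).
by apply: eq_bigr => a _; rewrite -word_weightE windowset_rcons.
Qed.

Lemma word_weight_supp w : ~ occurs F w -> M w = 0.
Proof.
move=> nw; apply: EFin_inj; rewrite -word_weightE; apply/eqP; rewrite -measure_le0.
have -> : 0%E = mu (~` X) by rewrite probability_setC ?mu_X ?subee //; exact: measurable_SFT.
apply: le_measure; rewrite ?inE.
- exact: measurable_windowset.
- by apply: measurableC; exact: measurable_SFT.
- by move=> x /= xw Xx; apply: nw; exists x.
Qed.

Lemma cyl0_window x m : (cyl0 x m : set (seqX A)) = windowset 0 (window x 0 m).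
Proof.
apply/seteqP; split => y; rewrite /windowset /cyl0 /= size_window.
  by move=> h; apply/eq_window => k km; rewrite !add0r h.
by move=> /eq_window h k km; have := h _ km; rewrite !add0r.
Qed.

Local Notation E := (wmean a0 M).

Lemma integral_wsum {d} {T : measurableType d} (nu : probability T R) (D : set T)
    (C : seq A -> set T) (c : seq A -> R) n :
  measurable D -> (forall w, measurable (C w)) -> (forall w, 0 <= c w) ->
  measurable_fun D (fun x => wsum n (fun w => \1_(C w) x * c w)) /\
  (\int[nu]_(x in D) (wsum n (fun w => \1_(C w) x * c w))%:E =
    (wsum n (fun w => fine (nu (C w `&` D)) * c w))%:E)%E.
Proof.
move=> mD; elim: n C c => [|n IH] C c mC c0 /=.
  split.
    by apply: measurable_funM => //; apply: measurable_indic.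
  under eq_integral do rewrite mulrC EFinM.
  rewrite ge0_integralZl ?lee_fin //.
  - by rewrite integral_indic // mulrC EFinM fineK // fin_num_measure //; exact: measurableI.
  - by apply/measurable_EFinP; apply: measurable_indic.
have IHa a := IH (fun w => C (a :: w)) (fun w => c (a :: w)) (fun w => mC _) (fun w => c0 _).
split.
  by apply: measurable_sum => a; have [] := IHa a.
under eq_integral do rewrite -sumEFin.
rewrite ge0_integral_sum //.
- by rewrite -sumEFin; apply: eq_bigr => a _; have [_ ->] := IHa a.
- by move=> a; apply/measurable_EFinP; have [] := IHa a.
- by move=> a x _; rewrite lee_fin wsum_ge0 // => w _; rewrite mulr_ge0.
Qed.

(** The part of a two-sided sequence from coordinate [- s] on, so that central windows become
    prefixes. *)
Definition half (s : nat) (x : int -> A) : nat -> A := fun i => x (i%:Z - s%:Z).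

Lemma word_weight_unshift s w : mu (windowset (- s%:Z) w) = (M w)%:E.
Proof.
rewrite -word_weightE -(iter_Sshift_inv s (measurable_windowset (- s%:Z) w)); congr (mu _).
by apply/seteqP; split => x; rewrite /windowset /= iter_Sshift window_zshift addNr.
Qed.

Lemma measureI_SFT (C : set (seqX A)) : measurable C -> mu (C `&` X) = mu C.
Proof.
move=> mC; have mX := measurable_SFT.
have nX : mu (~` X) = 0%E by rewrite probability_setC ?mu_X ?subee.
apply/eqP; rewrite eq_le; apply/andP; split.
  by apply: le_measure; rewrite ?inE //; exact: measurableI.
rewrite -{1}(setIT C) -(setUv X) setIUr (le_trans (measureU2 _ _ _)) //;
  try by apply: measurableI => //; exact: measurableC.
rewrite [X in (_ + X)%E](_ : _ = 0%E) ?adde0 //.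
apply/eqP; rewrite -measure_le0 -nX le_measure ?inE //;
  by [apply: measurableI => //; exact: measurableC|exact: measurableC].
Qed.

Lemma half_decomposition s n (g : (nat -> A) -> R) x : depends n g ->
  g (half s x) = wsum n (fun w => \1_(windowset (- s%:Z) w) x * g (wseq a0 w)).
Proof.
move=> dg; pose w := window x (- s%:Z) n.
have sw : size w = n by rewrite size_window.
rewrite (dg _ (wseq a0 w)); last first.
  by move=> i ltin; rewrite /wseq nth_window // /half addrC.
rewrite -(wsum_pred1 (fun w => g (wseq a0 w)) sw); apply: eq_wsum => v sv.
rewrite indicE; case: eqVneq => [->|vw].
  by rewrite mem_set ?mul1r // /windowset /= size_window.
rewrite memNset ?mul0r // /windowset /= sv => e.
by rewrite -e eqxx in vw.
Qed.

(** Bridge from the hidden measure to word weights; invariance under the shift makes the starting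
    coordinate [- s] disappear. *)
Lemma integral_windows (s n : nat) (g : (nat -> A) -> R) :
  (forall x, 0 <= g x) -> depends n g ->
  (\int[mu]_(x in X) (g (half s x))%:E = (E n g)%:E)%E.
Proof.
move=> g0 dg; under eq_integral do rewrite (half_decomposition s _ dg).
have [_ ->] := integral_wsum mu n measurable_SFT (measurable_windowset (- s%:Z)) (fun w => g0 (wseq a0 w)).
congr (_%:E); apply: eq_wsum => w _; congr (_ * _).
by rewrite measureI_SFT ?word_weight_unshift //; exact: measurable_windowset.
Qed.

Lemma measurable_windows (s n : nat) (g : (nat -> A) -> R) :
  (forall x, 0 <= g x) -> depends n g ->
  measurable_fun [set: seqX A] (fun x => g (half s x)).
Proof.
move=> g0 dg.
rewrite (_ : (fun x => _) = fun x => wsum n (fun w => \1_(windowset (- s%:Z) w) x * g (wseq a0 w))).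
  by have [] := integral_wsum mu n measurableT (measurable_windowset (- s%:Z)) (fun w => g0 (wseq a0 w)).
by apply/funext => x; exact: half_decomposition.
Qed.

End WordWeights.

(** * Hoelder potentials: bounded distortion and comparison of nearby Gibbs measures *)

Section HolderFamilies.
Context {R : realType} {A : pfinType} (F : seq (seq A)).
Local Notation X := (SFT F).
Local Notation dX := (@dX R A).

Lemma dX_agree (m : nat) (x y : int -> A) :
  (forall i : int, (`|i| < m)%N -> x i = y i) -> dX x y <= 2^-1 ^+ m.
Proof.
move=> xy; have : (m%:R%:E <= @nX R A x y)%E.
  apply/ereal_infP => _ [i /= xyi <-]; rewrite lee_fin ler_nat leqNgt.
  by apply/negP => /xy.
rewrite /Defs.dX; case: nX => [s| |]; last 2 first.
- by rewrite exprn_ge0.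
- by rewrite exprn_ge0.
rewrite lee_fin => ms; rewrite exprVn -powR_mulrn // -powRN.
by rewrite ler_powR ?ler1n // lerN2.
Qed.

Lemma dX_ge0 (x y : int -> A) : 0 <= dX x y.
Proof. by rewrite /Defs.dX; case: nX => // s; exact: powR_ge0. Qed.

Lemma holder_normP (r e : R) (g : (int -> A) -> R) : (holder_norm X r g < e%:E)%E ->
  (forall x, X x -> `|g x| <= e) /\
  (forall x y, X x -> X y -> x <> y -> `|g x - g y| <= e * dX x y `^ r).
Proof.
rewrite /holder_norm; set s1 := ereal_sup _; set s2 := ereal_sup _ => h.
have s10 : (0 <= s1)%E by apply: ereal_sup_ubound; left.
have s20 : (0 <= s2)%E by apply: ereal_sup_ubound; left.
split=> [x Xx|x y Xx Xy xy].
  rewrite -lee_fin; apply: le_trans (ltW h); apply: le_trans (leeDl _ s20).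
  by apply: ereal_sup_ubound; right; exists x.
have [d0|d0] := eqVneq (dX x y) 0.
  (* at distance 0 the quotient is [_ / 0 = 0], but distinct points are never at distance 0 *)
  exfalso; move: d0; rewrite /Defs.dX.
  have [i xi] : exists i, x i <> y i.
    by apply/not_existsP => h'; apply: xy; apply/funext => i; exact: contrapT.
  have : (@nX R A x y <= (`|i|%N%:R)%:E)%E by apply: ereal_inf_lbound; exists i.
  have : (0 <= @nX R A x y)%E by apply/ereal_infP => _ [j _ <-]; rewrite lee_fin.
  by case: nX => // s _ _ /eqP; rewrite gt_eqF // powR_gt0.
have dr : 0 < dX x y `^ r by rewrite powR_gt0 // lt_def d0 dX_ge0.
rewrite -ler_pdivrMr // -lee_fin; apply: le_trans (ltW h); apply: le_trans (leeDr _ s10).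
by apply: ereal_sup_ubound; right; exists (x, y).
Qed.

Lemma geometric_sum_le (q : R) n : 0 <= q -> q < 1 -> \sum_(k < n) q ^+ k <= (1 - q)^-1.
Proof.
move=> q0 q1; have q1' : 0 < 1 - q by rewrite subr_gt0.
rewrite -(ler_pM2l q1') mulfV ?gt_eqF //.
have -> : (1 - q) * \sum_(k < n) q ^+ k = 1 - q ^+ n.
  by rewrite -[RHS]opprB subrX1 -mulNr opprB.
by rewrite gerBl exprn_ge0.
Qed.

(** After [k] shifts the two points agree on a central window reaching to the nearer end of the
    common word. The [k]-th difference is thus geometric in the smaller of [k] and [n - k.+1];
    bounding it by the sum of both powers gives two geometric series. *)
Lemma holder_distortion (r H : R) (g : (int -> A) -> R) : 0 < r -> 0 <= H ->
  (forall x y, X x -> X y -> x <> y -> `|g x - g y| <= H * dX x y `^ r) ->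
  forall n x y, X x -> X y -> window x 0 n = window y 0 n ->
  `|birkhoff g n x - birkhoff g n y| <= H * (2 * (1 - 2^-1 `^ r)^-1).
Proof.
move=> r0 H0 gH n x y Xx Xy xy; set q := 2^-1 `^ r.
have q0 : 0 <= q by exact: powR_ge0.
have q1 : q < 1.
  have := @gt0_ltr_powR R r r0 2^-1 1; rewrite powR1; apply; rewrite ?nnegrE //.
  by rewrite invf_lt1 // ltr1n.
rewrite -sumrB (le_trans (ler_norm_sum _ _ _)) //.
apply: (@le_trans _ _ (\sum_(k < n) H * (q ^+ k + q ^+ (rev_ord k)))).
  apply: ler_sum => k _.
  have [e|ne] := pselect (iter k Sshift x = iter k Sshift y).
    by rewrite e subrr normr0 mulr_ge0 // addr_ge0 // exprn_ge0.
  apply: (le_trans (gH _ _ (SFT_iter k Xx) (SFT_iter k Xy) ne)); rewrite ler_wpM2l //.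
  have agree m : (m <= k)%N -> (m <= n - k.+1)%N ->
      dX (iter k Sshift x) (iter k Sshift y) `^ r <= q ^+ m.
    move=> mk mn; rewrite /q -powR_mulrn ?powR_ge0 // -powRrM mulrC powRrM powR_mulrn ?invr_ge0 //.
    rewrite ge0_ler_powR ?nnegrE ?dX_ge0 ?exprn_ge0 ?invr_ge0 ?(ltW r0) //.
    apply: dX_agree => i im; rewrite !iter_SshiftE.
    have [j jn ->] : exists2 j : nat, (j < n)%N & i + k%:Z = j%:Z.
      have := ltn_ord k => kn; exists `|(i + k%:Z)%R|%N; lia.
    by have /eq_window := xy; move=> /(_ j jn); rewrite !add0r.
  have [kn|kn] := leqP k (n - k.+1).
    by rewrite (le_trans (agree k _ _)) // lerDl exprn_ge0.
  by rewrite (le_trans (agree (n - k.+1)%N _ _)) ?(ltnW kn) // lerDr exprn_ge0.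
rewrite -mulr_sumr ler_wpM2l // big_split /= mulr_natl mulr2n.
rewrite lerD ?geometric_sum_le //.
rewrite (reindex_inj rev_ord_inj) /=.
rewrite (eq_bigr (fun k : 'I_n => q ^+ k)) ?geometric_sum_le // => k _.
by congr (_ ^+ _); have := ltn_ord k; lia.
Qed.

End HolderFamilies.

Section CompareGibbs.
Context {R : realType} {A : pfinType} (F : seq (seq A)).
Local Notation X := (SFT F).
Variable N : nat.
Hypothesis gluing : forall x y (n : int), X x -> X y ->
  exists z, [/\ X z, forall i : int, i < n -> z i = x i &
                forall i : int, n + N%:Z <= i -> z i = y (i - (n + N%:Z))].
Hypothesis X_neq0 : exists x, X x.
Variables B D : R.

Definition admissible (f : (int -> A) -> R) :=
  (forall x, X x -> `|f x| <= B) /\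
  (forall n x y, X x -> X y -> window x 0 n = window y 0 n ->
    `|birkhoff f n x - birkhoff f n y| <= D).

(** [gibbs_const] with the partition function of length [N] replaced by its trivial bound, so that
    the potential enters through [B] and [D] only. *)
Definition uniform_const := expR (8 * D) * ((#|A| ^ N)%:R * expR (N%:R * B)) ^+ 2 *
  expR (- (3 * D) - N%:R * B) ^- 2.

Lemma uniform_const_ge0 : 0 <= uniform_const.
Proof.
by rewrite !mulr_ge0 ?invr_ge0 ?mulr_ge0 ?expR_ge0.
Qed.

Lemma gibbs_const_le f : admissible f -> gibbs_const F N f B D <= uniform_const.
Proof.
move=> [fB fD]; have [x Xx] := X_neq0.
rewrite /gibbs_const /uniform_const ler_wpM2r ?invr_ge0 ?sqr_ge0 // ler_wpM2l ?expR_ge0 //.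
rewrite ler_sqr ?nnegrE ?partition_function_ge0 ?mulr_ge0 ?expR_ge0 //.
exact: (partition_function_trivial fB _ Xx).
Qed.

Lemma gibbs_weight_near (f g : (int -> A) -> R) e w :
  (forall x, X x -> `|f x - g x| <= e) ->
  gibbs_weight F f w <= expR ((size w)%:R * e) * gibbs_weight F g w.
Proof.
move=> fg; rewrite /gibbs_weight; case: pselect => [wo|?]; last by rewrite mulr0.
have [Xr _] := word_repP wo.
rewrite -expRD ler_expR -lerBlDr -sumrB.
apply: (@le_trans _ _ (\sum_(k < size w) e)); last by rewrite sumr_const card_ord mulr_natl.
by apply: ler_sum => k _; rewrite (le_trans (ler_norm _)) // fg //; exact: SFT_iter.
Qed.

Lemma partition_function_near (f g : (int -> A) -> R) e n :
  (forall x, X x -> `|f x - g x| <= e) ->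
  partition_function F f n <= expR (n%:R * e) * partition_function F g n.
Proof.
move=> fg; rewrite -wsumZ; apply: le_wsum => w sw.
by rewrite -sw; exact: gibbs_weight_near.
Qed.

Lemma word_weight_near (f g : (int -> A) -> R) e (M M' : seq A -> R) w :
  (forall x, X x -> `|f x - g x| <= e) -> 0 <= M w -> 0 <= M' w ->
  0 < partition_function F f (size w) ->
  M w * partition_function F f (size w) <= uniform_const * gibbs_weight F f w ->
  gibbs_weight F g w <= uniform_const * (M' w * partition_function F g (size w)) ->
  M w <= uniform_const ^+ 2 * expR (2 * (size w)%:R * e) * M' w.
Proof.
move=> fg M0 M0' Zf h1 h2; have U0 := uniform_const_ge0.
have gf x : X x -> `|g x - f x| <= e by move=> /fg; rewrite distrC.
rewrite -(ler_pM2r Zf) (le_trans h1) //.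
set E := expR ((size w)%:R * e).
have E0 : 0 <= E by exact: expR_ge0.
have EE : expR (2 * (size w)%:R * e) = E * E by rewrite -expRD; congr expR; ring.
apply: (@le_trans _ _ (uniform_const * (E * (uniform_const * (M' w * (E * partition_function F f (size w))))))).
  rewrite ler_wpM2l // (le_trans (gibbs_weight_near w fg)) // ler_wpM2l // (le_trans h2) //.
  by rewrite ler_wpM2l // ler_wpM2l // partition_function_near.
by rewrite EE le_eqVlt; apply/orP; left; apply/eqP; ring.
Qed.

End CompareGibbs.

Section RegularFamilies.
Context {R : realType} {A : pfinType} (F : seq (seq A)) (Theta : pmetricType R).
Local Notation X := (SFT F).
Variable f : Theta -> (int -> A) -> R.
Hypothesis hmix : mixing X.
Hypothesis hf : regular_family X f.
Variable mu : Theta -> probability (seqX A) R.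
Hypothesis hmu : forall th, invariant_Gibbs X (f th) (mu th).
Local Notation M th := (word_weight (mu th)).

Lemma SFT_nonempty (th : Theta) : exists x, X x.
Proof.
have [muX _] := hmu th; apply/set0P/negP => /eqP X0.
by move: muX; rewrite X0 measure0 => /esym/eqP; rewrite onee_eq0.
Qed.

Lemma word_weight_gibbs th : exists K P : R, 0 < K /\ forall n x, X x ->
  K^-1 * expR (- n%:R * P + birkhoff (f th) n x) <= M th (window x 0 n) <=
  K * expR (- n%:R * P + birkhoff (f th) n x).
Proof.
have [muX [_ [K [K0 hK]]]] := hmu th.
have [x0 Xx0] := SFT_nonempty th.
exists K, (pressure X (f th)); split => // -[|n] x Xx; last first.
  have /andP[h1 h2] := hK _ Xx n.+1 isT.
  rewrite cyl0_window in h1 h2.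
  by rewrite -ler_pdivlMr ?expR_gt0 // h1 -ler_pdivrMr ?expR_gt0.
have /andP[h1 h2] := hK _ Xx0 1%N isT.
(* The Gibbs bounds concern positive lengths; the empty word requires [1 <= K], which follows from
   [K^-1 <= K]. *)
have K1 : 1 <= K.
  have h : K^-1 <= K by exact: le_trans h2.
  rewrite -(ler_pM2l K0) mulfV ?gt_eqF // -expr2 in h.
  by rewrite -(@ler_sqr _ 1 K) ?nnegrE ?ler01 ?(ltW K0) // expr1n.
rewrite word_weight_nil /birkhoff big_ord0 oppr0 mul0r addr0 expR0 !mulr1.
by rewrite K1 andbT invf_le1.
Qed.

Lemma regular_family_admissible th0 : exists B D d : R, 0 < d /\
  forall th, mdist th0 th < d -> admissible F B D (f th).
Proof.
have [r [r0 [hfin hcont]]] := hf.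
have [d [d0 hd]] := hcont th0 1 ltr01.
have [b hb] : exists b : R, (holder_norm X r (f th0) < b%:E)%E.
  have := hfin th0; case: (holder_norm _ _ _) => [s _| |_]; last 2 first.
  - by rewrite ltxx.
  - by exists 0; rewrite ltNyr.
  by exists (s + 1); rewrite lte_fin ltrDl.
have [b1 b2] := holder_normP hb.
have [x0 Xx0] := SFT_nonempty th0.
have b0 : 0 <= b by rewrite (le_trans _ (b1 _ Xx0)).
exists (1 + b), ((1 + b) * (2 * (1 - 2^-1 `^ r)^-1)), d; split => // th /hd /holder_normP[c1 c2].
have E x : f th x = (f th x - f th0 x) + f th0 x by rewrite subrK.
split=> [x Xx|].
  by rewrite E (le_trans (ler_normD _ _)) // lerD ?c1 ?b1.
apply: holder_distortion; rewrite ?addr_ge0 //= => x y Xx Xy xy.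
rewrite E (E y) opprD addrACA (le_trans (ler_normD _ _)) // mulrDl lerD //; first exact: c2.
exact: b2.
Qed.

(** The potentials are taken within [e / 2] because both the Boltzmann weight and the partition
    function change, each by one such exponential factor. [C] is the same for the whole
    neighbourhood, as admissibility is locally uniform. *)
Lemma word_weight_compare th0 (e : R) : 0 < e -> exists d C : R, [/\ 0 < d, 0 < C &
  forall th w, mdist th0 th < d ->
    M th w <= C * expR ((size w)%:R * e) * M th0 w /\
    M th0 w <= C * expR ((size w)%:R * e) * M th w].
Proof.
move=> e0; have [N gluing] := SFT_specification hmix.
have [B [D [d1 [d10 hadm]]]] := regular_family_admissible th0.
have [r [r0 [_ hcont]]] := hf.
have e20 : 0 < e / 2 by rewrite divr_gt0.
have [d2 [d20 hd2]] := hcont th0 (e / 2) e20.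
have U0 := uniform_const_ge0 (A := A) N B D.
exists (Num.min d1 d2), (uniform_const (A := A) N B D ^+ 2 + 1); split.
- by rewrite lt_min d10.
- by rewrite ltr_wpDl // sqr_ge0.
move=> th w; rewrite lt_min => /andP[h1 h2].
have a0 : admissible F B D (f th0) by apply: hadm; rewrite mdistxx.
have a1 := hadm _ h1.
have fg x : X x -> `|f th x - f th0 x| <= e / 2.
  by have [+ _] := holder_normP (hd2 _ h2); apply.
have gf x : X x -> `|f th0 x - f th x| <= e / 2 by move=> /fg; rewrite distrC.
have uni t : admissible F B D (f t) ->
   [/\ 0 <= M t w, 0 < partition_function F (f t) (size w),
     M t w * partition_function F (f t) (size w) <= uniform_const (A := A) N B D * gibbs_weight F (f t) w &
     gibbs_weight F (f t) w <= uniform_const (A := A) N B D * (M t w * partition_function F (f t) (size w))].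
  move=> [ab ad]; have [muX [minv _]] := hmu t; have [K [P [K0 hK]]] := word_weight_gibbs t.
  have M0 := word_weight_ge0 (mu t).
  have Mr := word_weight_right (mu t).
  have Ml := word_weight_left minv.
  have Ms := word_weight_supp muX.
  have gc := gibbs_const_le N (SFT_nonempty t) (conj ab ad).
  have Zt := partition_function_gt0 (f t) (word_weight_nil (mu t)) Mr Ms (size w).
  have [u1 u2] := gibbs_uniform gluing ab ad M0 (word_weight_nil (mu t)) Ml Mr Ms K0 hK w.
  split => //.
    by rewrite (le_trans u1) // ler_wpM2r // gibbs_weight_ge0.
  by rewrite (le_trans u2) // ler_wpM2r // mulr_ge0 // ltW.
have [M1 Z1 p1 q1] := uni th a1; have [M2 Z2 p2 q2] := uni th0 a0.
have E : 2 * (size w)%:R * (e / 2) = (size w)%:R * e by field.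
have := word_weight_near fg M1 M2 Z1 p1 q2; have := word_weight_near gf M2 M1 Z2 p2 q1.
rewrite E => k1 k2.
have U1 : uniform_const (A := A) N B D ^+ 2 <= uniform_const (A := A) N B D ^+ 2 + 1 by rewrite lerDl.
by split; [apply: (le_trans k2)|apply: (le_trans k1)];
  rewrite ler_wpM2r // ler_wpM2r ?expR_ge0.
Qed.

End RegularFamilies.

Lemma measurable_prode {d} {T : measurableType d} {R : realType} n
    (h : nat -> T -> \bar R) : (forall k, measurable_fun [set: T] (h k)) ->
  measurable_fun [set: T] (fun x => \prod_(k < n) h k x)%E.
Proof.
move=> mh; elim: n => [|n IH].
  by under eq_fun do rewrite big_ord0; exact: measurable_cst.
by under eq_fun do rewrite big_ord_recr; exact: emeasurable_funM.
Qed.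

(** * Observation sequences and iterated integrals *)

Section ObservationSequences.
Context {R : realType} {U : ptopologicalType}.
Local Notation seqs := (seqU U).

Definition rectangle (n : nat) (B : nat -> set U) : set seqs :=
  [set y : nat -> U | forall k : nat, (k < n)%N -> B k (y k)].

Lemma measurable_eval k : measurable_fun [set: seqs] (fun y : seqs => y k : borel U).
Proof.
move=> _ B mB; rewrite setTI.
by apply: sub_sigma_algebra; exists k, B.
Qed.

Lemma measurable_rectangle n (B : nat -> set U) :
  (forall k, measurable (B k : set (borel U))) -> measurable (rectangle n B).
Proof.
move=> mB.
have -> : rectangle n B = \bigcap_(k in `I_n) [set y : seqs | B k (y k)].
  by apply/seteqP; split => y h k /h.
apply: bigcap_measurableType => k _.
by rewrite -[X in measurable X]setTI; exact: (measurable_eval (k)).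
Qed.

Lemma measure_eq_rectangles (m1 m2 : {measure set seqs -> \bar R}) :
  (m1 setT < +oo)%E ->
  (forall n B, (forall k, measurable (B k : set (borel U))) ->
     m1 (rectangle n B) = m2 (rectangle n B)) ->
  forall E : set seqs, measurable E -> m1 E = m2 E.
Proof.
move=> fin m12 E mE.
pose G : set (set seqs) := [set C | exists n B,
  (forall k, measurable (B k : set (borel U))) /\ C = rectangle n B].
have GT : G setT.
  by exists 0%N, (fun=> setT); split => //; apply/seteqP; split.
apply: (@g_sigma_algebra_measure_unique _ R seqs G _ (fun=> setT)) => //.
- by move=> _ [n [B [mB ->]]]; exact: measurable_rectangle.
- by rewrite bigcup_const //; exists 0%N.
- move=> _ _ [n [B [mB ->]]] [p [B' [mB' ->]]].
  exists (maxn n p), (fun k => (if (k < n)%N then B k else setT) `&`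
    (if (k < p)%N then B' k else setT)); split.
    by move=> k; apply: measurableI; case: ifP.
  apply/seteqP; split => [y [h h'] k _|y h].
    by split; case: ifP => //; [exact: h|exact: h'].
  by split => k kn; have := h k; rewrite leq_max kn ?orbT /= => /(_ isT) [].
- by move=> _ [n [B [mB ->]]]; exact: m12.
- move: E mE; apply: sub_sigma_algebra2 => _ [k [B [mB ->]]].
  exists k.+1, (fun j => if j == k then B else setT); split.
    by move=> j; case: ifP.
  apply/seteqP; split => [y By j _|y h] /=; first by case: eqP => // ->.
  by have := h k (leqnn _); rewrite eqxx.
Qed.

Lemma measurable_nshift k : measurable_fun [set: seqs] (nshift k : seqs -> seqs).
Proof.
apply: measurable_fun_generated => _ [i [B [mB ->]]].
by rewrite -[X in measurable X]setTI; exact: (measurable_eval (k + i)).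
Qed.

Definition update (k : nat) (y : nat -> U) (u : U) : nat -> U :=
  fun i => if i == k then u else y i.

Lemma measurable_update k :
  measurable_fun [set: seqs * borel U] (fun p : seqs * borel U => update k p.1 p.2 : seqs).
Proof.
apply: measurable_fun_generated => _ [i [B [mB ->]]].
set P := _ @^-1` _; have [ik|ik] := eqVneq i k.
  have -> : P = snd @^-1` B by rewrite /P /preimage /update /= ik eqxx.
  by rewrite -[X in measurable X]setTI; exact: measurable_snd.
have -> : P = fst @^-1` ((fun y : seqs => y i : borel U) @^-1` B).
  by rewrite /P /preimage /update /= (negbTE ik).
rewrite -[X in measurable X]setTI; apply: measurable_fst => //.
by rewrite -[X in measurable X]setTI; exact: measurable_eval.
Qed.

Variable m : {sigma_finite_measure set (borel U) -> \bar R}.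
Local Open Scope ereal_scope.
Implicit Types (f g : seqs -> \bar R).

(** Plays the role of the product of [n] copies of [m]: coordinates [n - 1] down to 0 are integrated
    in turn, the later ones are those of the argument. *)
Fixpoint iter_integral (n : nat) f : seqs -> \bar R :=
  if n is n'.+1 then iter_integral n' (fun y => \int[m]_u f (update n' y u)) else f.
Local Notation J := iter_integral.

Lemma iter_integral_ge0 n f : (forall y, 0 <= f y) -> forall y, 0 <= J n f y.
Proof. by elim: n f => //= n IH f f0; apply: IH => y; apply: integral_ge0. Qed.

Lemma le_iter_integral n f g : (forall y, 0 <= f y) -> (forall y, f y <= g y) ->
  forall y, J n f y <= J n g y.
Proof.
elim: n f g => //= n IH f g f0 fg; apply: IH => y; first exact: integral_ge0.
by apply: le_integral_nonneg => u _; [exact: f0|exact: fg].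
Qed.

Lemma measurable_iter_integral_step n f : (forall y, 0 <= f y) ->
  measurable_fun [set: seqs] f ->
  measurable_fun [set: seqs] (fun y : seqs => \int[m]_u f (update n y u)).
Proof.
move=> f0 mf.
apply: (@measurable_fun_fubini_tonelli_F _ _ seqs (borel U) R m
  (fun p : seqs * borel U => f (update n p.1 p.2))) => //.
exact: (measurableT_comp mf (measurable_update n)).
Qed.

Lemma measurable_section_update n f y : measurable_fun [set: seqs] f ->
  measurable_fun [set: borel U] (fun u => f (update n y u)).
Proof.
move=> mf.
exact: (measurableT_comp mf (measurableT_comp (measurable_update n)
  (@pair1_measurable _ _ seqs (borel U) y))).
Qed.

Lemma iter_integral_cvg_sum n (f : nat -> seqs -> \bar R) :
  (forall i y, 0 <= f i y) -> (forall i, measurable_fun [set: seqs] (f i)) -> forall y,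
  J n (fun y => \sum_(i <oo) f i y) y = \sum_(i <oo) J n (f i) y.
Proof.
elim: n f => //= n IH f f0 mf y; rewrite -IH.
- congr (J n _ y); apply/funext => y'; rewrite integral_nneseries //.
  by move=> i; exact: measurable_section_update.
- by move=> i y'; apply: integral_ge0.
- by move=> i; exact: measurable_iter_integral_step.
Qed.

Lemma iter_integral0 n y : J n (fun=> 0) y = 0.
Proof.
elim: n y => //= n IH y; rewrite -[RHS](IH y); congr (J n _ y); apply/funext => y'.
exact: integral0.
Qed.

Lemma iter_integralZ n (c : R) f y : (0 <= c)%R -> (forall y, 0 <= f y) ->
  measurable_fun [set: seqs] f -> J n (fun y => c%:E * f y) y = c%:E * J n f y.
Proof.
move=> c0; elim: n f => //= n IH f f0 mf; rewrite -IH.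
- congr (J n _ y); apply/funext => y'; rewrite ge0_integralZl //.
  exact: measurable_section_update.
- by move=> y'; apply: integral_ge0.
- exact: measurable_iter_integral_step.
Qed.

(** Tonelli, one coordinate at a time. The weight [w] is general because the integral of the last
    kernel is absorbed into it at each step of the induction. *)
Lemma iter_integral_prod {d} {T : measurableType d} (mu : {finite_measure set T -> \bar R})
  n (w : T -> \bar R) (K : nat -> T -> U -> \bar R) y :
  (forall x, 0 <= w x) -> measurable_fun setT w ->
  (forall k x u, 0 <= K k x u) ->
  (forall k, measurable_fun [set: T * borel U] (fun p : T * borel U => K k p.1 p.2)) ->
  J n (fun y => \int[mu]_x (w x * \prod_(k < n) K k x (y k))) y =
  \int[mu]_x (w x * \prod_(k < n) \int[m]_u K k x u).
Proof.
move=> w0 mw K0 mK; elim: n w w0 mw => [|n IH] w w0 mw /=.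
  by apply: eq_integral => x _; rewrite !big_ord0.
have mI k : measurable_fun setT (fun x => \int[m]_u K k x u).
  exact: (@measurable_fun_fubini_tonelli_F _ _ T (borel U) R m (fun p => K k p.1 p.2)).
have I0 k x : 0 <= \int[m]_u K k x u by apply: integral_ge0.
transitivity (J n (fun y => \int[mu]_x ((w x * \int[m]_u K n x u) * \prod_(k < n) K k x (y k))) y).
  congr (J n _ y); apply/funext => y'.
  have E u x : \prod_(k < n.+1) K k x (update n y' u k) = \prod_(k < n) K k x (y' k) * K n x u.
    rewrite big_ord_recr /= /update eqxx; congr (_ * _); apply: eq_bigr => k _.
    by rewrite ltn_eqF.
  under eq_integral => u _ do under eq_integral => x _ do rewrite E.
  have p0 x : 0 <= \prod_(k < n) K k x (y' k) by apply: prode_ge0.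
  have mp : measurable_fun setT (fun x => \prod_(k < n) K k x (y' k)).
    apply: (@measurable_prode _ _ _ n (fun k x => K k x (y' k))) => k.
    exact: (measurableT_comp (mK k) (@pair2_measurable _ _ T (borel U) (y' k))).
  have := @fubini_tonelli _ _ T (borel U) R mu m
    (fun p => w p.1 * (\prod_(k < n) K k p.1 (y' k) * K n p.1 p.2)).
  move=> <- /=; last 2 first.
  - apply: emeasurable_funM; first exact: (measurableT_comp mw measurable_fst).
    by apply: emeasurable_funM => //; exact: (measurableT_comp mp measurable_fst).
  - by move=> [x u] /=; rewrite !mule_ge0.
  apply: eq_integral => x _.
  have mKx : measurable_fun [set: borel U] (K n x).
    exact: (measurableT_comp (mK n) (@pair1_measurable _ _ T (borel U) x)).
  rewrite ge0_integralZl //; last 2 first.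
  - by apply: emeasurable_funM.
  - by move=> u _; rewrite mule_ge0.
  rewrite ge0_integralZl // muleAC -muleA; congr (_ * _); exact: muleC.
rewrite IH //.
- by apply: eq_integral => x _; rewrite big_ord_recr /= -muleA; congr (_ * _); exact: muleC.
- by move=> x; rewrite mule_ge0.
- exact: emeasurable_funM.
Qed.

End ObservationSequences.

Section SigmaFiniteCopy.
Context {d} {T : measurableType d} {R : realType} (m : {measure set T -> \bar R}).
Hypothesis m_sfinite : sigma_finite [set: T] m.

Definition sigma_finite_copy : set T -> \bar R := m.
HB.instance Definition _ := Measure.copy sigma_finite_copy m.
HB.instance Definition _ := @Measure_isSigmaFinite.Build d T R sigma_finite_copy m_sfinite.
Definition sigma_finite_version : {sigma_finite_measure set T -> \bar R} :=
  sigma_finite_copy.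

End SigmaFiniteCopy.

Lemma dXxx {R : realType} {A : Type} (x : int -> A) : dX x x = 0 :> R.
Proof.
rewrite /dX /nX (_ : [set i | _] = set0) ?image_set0 ?ereal_inf0 //.
by apply/seteqP; split => i.
Qed.

Definition continuous_emission {R : realType} {A : pfinType} (F : seq (seq A))
    {U : pmetricType R} (phi : (int -> A) -> U -> R) :=
  forall x u, SFT F x -> forall e : R, 0 < e -> exists d : R, 0 < d /\
  forall x' u', SFT F x' -> dX x x' < d -> mdist u u' < d -> `|phi x' u' - phi x u| < e.

(** * Likelihoods as densities of the observation laws *)

Section EmissionDensity.
Context {R : realType} {A : pfinType} (F : seq (seq A)) (U : pmetricType R).
Local Notation X := (SFT F).
Local Notation seqs := (seqU U).
Variable m : {sigma_finite_measure set (borel U) -> \bar R}.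
Variable phi : (int -> A) -> U -> R.
Hypothesis phi_gt0 : forall x u, X x -> 0 < phi x u.
Hypothesis phi_cont : continuous_emission F phi.

Lemma metric_continuous_measurable (g : U -> R) :
  (forall u (e : R), 0 < e -> exists d : R, 0 < d /\
    forall u', mdist u u' < d -> `|g u' - g u| < e) ->
  measurable_fun [set: borel U] g.
Proof.
move=> gc.
have /continuousP cg : continuous g.
  move=> u; apply/cvgrPdist_lt => e e0; have [d [d0 hd]] := gc u e e0.
  have nu : nbhs u [set u' | mdist u u' < d].
    by rewrite -metricType_numDomainType.filter_from_mdist_nbhs; exists d.
  by apply: filterS nu => u' /= /hd; rewrite distrC.
apply: (measurability _ (RGenOpens.measurableE R)) => _ [_ [a [b ->] <-]].
rewrite setTI; apply: sub_sigma_algebra; exact/cg/interval_open.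
Qed.

Lemma measurable_emission x : X x -> measurable_fun [set: borel U] (phi x).
Proof.
move=> Xx; apply: metric_continuous_measurable => u e e0.
have [d [d0 hd]] := phi_cont u Xx e0; exists d; split => // u' uu'.
by apply: hd => //; rewrite dXxx.
Qed.

(** Hypotheses on [phi] concern points of the subshift; extension by 0 gives a function that is
    nonnegative and measurable on the whole product space. *)
Definition emission (x : seqX A) (u : borel U) : R := \1_X x * phi x u.

Lemma emissionE x u : X x -> emission x u = phi x u.
Proof. by move=> Xx; rewrite /emission indicE mem_set // mul1r. Qed.

Lemma emission_ge0 x u : 0 <= emission x u.
Proof.
rewrite /emission indicE; have [/set_mem Xx|_] := boolP (x \in X); last by rewrite mul0r.
by rewrite mul1r ltW // phi_gt0.
Qed.

Lemma approximant_dist k x : X x ->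
  dX x (approximant F k (window x (- k%:Z) (k + k))) <= 2^-1 ^+ k :> R.
Proof.
by move=> Xx; have [_ h] := approximantP k (k + k) Xx; apply: dX_agree => i ik; rewrite h //; lia.
Qed.

Lemma measurable_wsum {d} {T : measurableType d} n (g : seq A -> T -> R) :
  (forall w, size w = n -> measurable_fun [set: T] (g w)) ->
  measurable_fun [set: T] (fun x => wsum n (fun w => g w x)).
Proof.
elim: n g => [|n IH] g mg /=; first exact: mg.
by apply: measurable_sum => a; apply: IH => w sw; apply: mg; rewrite /= sw.
Qed.

(** Replacing [x] by the approximant of its window of radius [k] gives finite sums of products of an
    indicator in [x] and a measurable function of [u]. Continuity makes them converge pointwise. *)
Lemma measurable_emission_joint :
  measurable_fun [set: seqX A * borel U] (fun p : seqX A * borel U => emission p.1 p.2).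
Proof.
pose g (k : nat) (w : seq A) (p : seqX A * borel U) : R :=
  \1_(windowset (- k%:Z) w `&` X) p.1 *
  (if pselect (occurs F w) then phi (approximant F k w) p.2 else 0).
apply: (@measurable_fun_cvg _ _ _ setT (fun k p => wsum (k + k) (fun w => g k w p))).
  move=> k; apply: measurable_wsum => w _; apply: measurable_funM.
    apply: (measurableT_comp _ measurable_fst); apply: measurable_indic.
    by apply: measurableI; [exact: measurable_windowset|exact: measurable_SFT].
  case: pselect => [wo|?]; last exact: measurable_cst.
  apply: (measurableT_comp _ measurable_snd); apply: measurable_emission.
  by apply: SFT_zshift; have [] := word_repP wo.
move=> [x u] _.
suff: (fun k => wsum (k + k) (fun w => g k w (x, u))) @ \oo --> emission x u by [].
have [Xx|nXx] := pselect (X x); last first.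
  rewrite /emission indicE memNset // mul0r.
  rewrite (_ : (fun k => _) = fun=> 0); first exact: cvg_cst.
  apply/funext => k; rewrite -[RHS](wsum0 (A := A) (k + k)); apply: eq_wsum => w _.
  by rewrite /g /= indicE memNset ?mul0r // => -[].
rewrite emissionE // (_ : (fun k => _) =
  fun k : nat => phi (approximant F k (window x (- k%:Z) (k + k))) u); last first.
  apply/funext => k; set w := window x _ _.
  have sw : size w = (k + k) by rewrite size_window.
  rewrite -(wsum_pred1 (fun w => phi (approximant F k w) u) sw); apply: eq_wsum => v sv.
  rewrite /g /= indicE; case: eqVneq => [->|vw].
    rewrite mem_set; last by split => //; change (window x (- k%:Z) (size w) = w); rewrite sw.
    rewrite mul1r; case: pselect => // nw; exfalso; apply: nw; exact: occurs_window.
  rewrite memNset ?mul0r // /windowset /= sv => -[e _].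
  by move: vw; rewrite -e /w eqxx.
apply/cvgrPdist_lt => e e0; have [d [d0 hd]] := phi_cont u Xx e0.
have half1 : `|2^-1 : R| < 1 by rewrite ger0_norm // invf_lt1 // ltr1n.
have /cvgrPdist_lt/(_ d d0) := cvg_expr half1.
apply: filterS => k; rewrite sub0r normrN ger0_norm ?exprn_ge0 // => kd.
have [Xk _] := approximantP k (k + k) Xx.
rewrite distrC; apply: hd => //; last by rewrite mdistxx.
exact: le_lt_trans (approximant_dist k Xx) kd.
Qed.

Variable mu : probability (seqX A) R.

Definition lik (n : nat) (y : nat -> U) : \bar R :=
  (\int[mu]_(x in X) (\prod_(k < n) phi (iter k Sshift x) (y k))%:E)%E.

Local Open Scope ereal_scope.
Definition ekernel (k : nat) (x : seqX A) (u : borel U) : \bar R :=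
  (emission (iter k Sshift x) u)%:E.
Definition eindicator (x : seqX A) : \bar R := (\1_X x)%:E.

Lemma measurable_ekernel k : measurable_fun [set: seqX A * borel U]
  (fun p : seqX A * borel U => ekernel k p.1 p.2).
Proof.
apply/measurable_EFinP.
apply: (measurableT_comp measurable_emission_joint
  (g := fun p : seqX A * borel U => (iter k Sshift p.1 : seqX A, p.2))).
apply: measurable_fun_pair => //.
exact: (measurableT_comp (measurable_iter_Sshift k) measurable_fst).
Qed.

Lemma ekernel_ge0 k x u : 0 <= ekernel k x u.
Proof. by rewrite lee_fin emission_ge0. Qed.

Lemma restrict_indic_mule (g : seqX A -> \bar R) x : (forall x, 0 <= g x) ->
  (g \_ X) x = eindicator x * g x.
Proof.
by move=> g0; rewrite /eindicator patchE indicE; case: ifPn => _; rewrite ?mul1e ?mul0e.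
Qed.

Lemma likE n y : lik n y = \int[mu]_x (eindicator x * \prod_(k < n) ekernel k x (y k)).
Proof.
rewrite /lik (eq_integral (fun x => \prod_(k < n) ekernel k x (y k))); last first.
  move=> x /set_mem Xx; rewrite -prodEFin; apply: eq_bigr => k _.
  by rewrite /ekernel emissionE //; exact: SFT_iter.
rewrite integral_mkcond; apply: eq_integral => x _; rewrite restrict_indic_mule //.
by move=> x'; apply: prode_ge0 => k _; exact: ekernel_ge0.
Qed.

Lemma measurable_indicE_SFT : measurable_fun [set: seqX A] eindicator.
Proof. by apply/measurable_EFinP; apply: measurable_indic; exact: measurable_SFT. Qed.

Lemma measurable_lik n : measurable_fun [set: seqs] (lik n).
Proof.
rewrite (_ : lik n = fun y : seqs => \int[mu]_x (eindicator x * \prod_(k < n) ekernel k x (y k))); last first.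
  by apply/funext => y; exact: likE.
apply: (@measurable_fun_fubini_tonelli_F _ _ seqs (seqX A) R mu
  (fun p : seqs * seqX A => eindicator p.2 * \prod_(k < n) ekernel k p.2 (p.1 k))).
  apply: emeasurable_funM; first exact: (measurableT_comp measurable_indicE_SFT measurable_snd).
  apply: (@measurable_prode _ _ R n (fun k (p : seqs * seqX A) => ekernel k p.2 (p.1 k))) => k.
  apply: (measurableT_comp (measurable_ekernel k)
    (g := fun p : seqs * seqX A => (p.2, p.1 k : borel U))).
  apply: measurable_fun_pair => //.
  exact: (measurableT_comp (measurable_eval k) measurable_fst).
move=> [y x] /=; rewrite mule_ge0 ?lee_fin //.
by apply: prode_ge0 => k _; exact: ekernel_ge0.
Qed.

Lemma lik_ge0 n y : 0 <= lik n y.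
Proof.
apply: integral_ge0 => x Xx; rewrite lee_fin; apply: prodr_ge0 => k _.
by rewrite ltW // phi_gt0 //; exact: SFT_iter.
Qed.

End EmissionDensity.

Definition is_law {R : realType} {A : pfinType} (F : seq (seq A)) {U : pmetricType R}
    (m : {sigma_finite_measure set (borel U) -> \bar R}) (phi : (int -> A) -> U -> R)
    (mu : probability (seqX A) R) (P : probability (seqU U) R) :=
  forall (n : nat) (B : nat -> set U), (forall k, measurable (B k : set (borel U))) ->
  P [set y | forall k : nat, (k < n)%N -> B k (y k)] =
  (\int[mu]_(x in SFT F) \prod_(k < n) \int[m]_(u in (B k : set (borel U)))
     (phi (iter k Sshift x) u)%:E)%E.

Section ObservationLaw.
Context {R : realType} {A : pfinType} (F : seq (seq A)) (U : pmetricType R).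
Local Notation X := (SFT F).
Local Notation seqs := (seqU U).
Variable m : {sigma_finite_measure set (borel U) -> \bar R}.
Variable phi : (int -> A) -> U -> R.
Hypothesis phi_gt0 : forall x u, X x -> 0 < phi x u.
Hypothesis phi_cont : continuous_emission F phi.
Hypothesis phi_int : forall x, X x -> (\int[m]_u (phi x u)%:E = 1)%E.
Variable phi_max : U -> R.
Hypothesis phi_le : forall x u, X x -> phi x u <= phi_max u.
Variable mu : probability (seqX A) R.
Hypothesis mu_X : mu X = 1%E.
Hypothesis mu_inv : forall B : set (seqX A), measurable B -> mu (Sshift @^-1` B) = mu B.
Variable P : probability seqs R.
Hypothesis P_rect : is_law F m phi mu P.
Local Open Scope ereal_scope.
Local Notation lik := (lik F phi mu).
Local Notation ekernel := (ekernel F phi).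
Local Notation eindicator := (eindicator F).
Local Notation J := (iter_integral m).

Lemma lik_lty n y : lik n y < +oo.
Proof.
apply: (@le_lt_trans _ _ (\int[mu]_(x in X) cst (\prod_(k < n) phi_max (y k))%:E x)).
  apply: le_integral_nonneg => x Xx; rewrite lee_fin.
    by apply: prodr_ge0 => k _; rewrite ltW // phi_gt0 //; exact: SFT_iter.
  apply: ler_prod => k _; have Xk := SFT_iter k Xx.
  by rewrite ltW ?phi_gt0 // phi_le.
rewrite integral_cst; last exact: measurable_SFT.
by rewrite [X in _ * X]mu_X mule1 ltry.
Qed.

Lemma lik_fin n y : lik n y \is a fin_num.
Proof. by rewrite ge0_fin_numE ?lik_lty // lik_ge0. Qed.

Lemma prod_ekernelE n x (y : nat -> U) : X x ->
  \prod_(k < n) ekernel k x (y k) = (\prod_(k < n) phi (iter k Sshift x) (y k))%:E.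
Proof.
move=> Xx; rewrite -prodEFin; apply: eq_bigr => k _.
by rewrite /ekernel emissionE //; exact: SFT_iter.
Qed.

Lemma lik_gt0 n y : 0 < lik n y.
Proof.
rewrite lt_def lik_ge0 // andbT; apply/eqP => l0.
have mg : measurable_fun (X : set (seqX A)) (fun x : seqX A => (\prod_(k < n) ekernel k x (y k))).
  apply: measurable_funTS; apply: (@measurable_prode _ _ _ n (fun k x => ekernel k x (y k))) => k.
  exact: (measurableT_comp (measurable_ekernel phi_cont k)
    (@pair2_measurable _ _ (seqX A) (borel U) (y k))).
have l0' : \int[mu]_(x in X) (\prod_(k < n) ekernel k x (y k)) = 0.
  by rewrite -l0 /lik; apply: eq_integral => x /set_mem Xx; rewrite prod_ekernelE.
have g0 (x : seqX A) : 0 <= \prod_(k < n) ekernel k x (y k).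
  by apply: prode_ge0 => k _; exact: ekernel_ge0.
have mX := measurable_SFT F.
have /(ae_eq_integral_abs _ mX mg)/=  : \int[mu]_(x in X) `|\prod_(k < n) ekernel k x (y k)| = 0.
  by rewrite -l0'; apply: eq_integral => x _; rewrite gee0_abs.
move=> [N [mN N0 hN]].
have XN : X `<=` N.
  move=> x Xx; apply: hN => /= /(_ Xx) /eqP; apply/negP.
  rewrite prod_ekernelE // gt_eqF // lte_fin; apply: prodr_gt0 => k _.
  by apply: phi_gt0; exact: SFT_iter.
have h : mu X <= mu N by apply: le_measure; rewrite ?inE.
by move: h; rewrite mu_X N0 leNgt lte01.
Qed.

Definition ecell (k : nat) (B : set U) (x : seqX A) : \bar R :=
  \int[m]_u (ekernel k x u * (\1_B u)%:E).

Lemma ecell_ge0 k B x : 0 <= ecell k B x.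
Proof.
by apply: integral_ge0 => u _; rewrite mule_ge0 ?lee_fin // emission_ge0.
Qed.

Lemma measurable_ekernel_cell k (B : set U) : measurable (B : set (borel U)) ->
  measurable_fun [set: seqX A * borel U]
    (fun p : seqX A * borel U => ekernel k p.1 p.2 * (\1_B p.2)%:E).
Proof.
move=> mB; apply: emeasurable_funM; first exact: measurable_ekernel.
apply/measurable_EFinP; apply: (measurableT_comp _ measurable_snd).
exact: measurable_indic.
Qed.

Lemma measurable_ecell k (B : set U) : measurable (B : set (borel U)) ->
  measurable_fun [set: seqX A] (ecell k B).
Proof.
move=> mB; apply: (@measurable_fun_fubini_tonelli_F _ _ (seqX A) (borel U) R m
  (fun p => ekernel k p.1 p.2 * (\1_B p.2)%:E)).
  exact: measurable_ekernel_cell.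
by move=> [x u] /=; rewrite mule_ge0 ?lee_fin // emission_ge0.
Qed.

Lemma ecellE k (B : set U) x : X x ->
  ecell k B x = \int[m]_(u in (B : set (borel U))) (phi (iter k Sshift x) u)%:E.
Proof.
move=> Xx; rewrite [RHS]integral_mkcond; apply: eq_integral => u _.
rewrite /ekernel emissionE; last exact: SFT_iter.
by rewrite patchE indicE; case: ifPn => _; rewrite ?mule1 ?mule0.
Qed.

Lemma ecellT k x : X x -> ecell k setT x = 1.
Proof. by move=> Xx; rewrite ecellE // phi_int //; exact: SFT_iter. Qed.

Lemma law_rectangle n B : (forall k, measurable (B k : set (borel U))) ->
  P (rectangle n B) = \int[mu]_x (eindicator x * \prod_(k < n) ecell k (B k) x).
Proof.
move=> mB; rewrite /rectangle P_rect // integral_mkcond; apply: eq_integral => x _.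
rewrite /eindicator patchE indicE; case: ifPn => [/set_mem Xx|_]; last by rewrite mul0e.
by rewrite mul1e; apply: eq_bigr => k _; rewrite ecellE.
Qed.

Definition freeze (n : nat) (y0 y : nat -> U) : nat -> U :=
  fun i => if (i < n)%N then y i else y0 i.

Lemma measurable_freeze n y0 : measurable_fun [set: seqs] (freeze n y0 : seqs -> seqs).
Proof.
apply: measurable_fun_generated => _ [i [B [mB ->]]].
rewrite /freeze /preimage /=; have [_|_] := boolP (i < n)%N.
  by rewrite -[X in measurable X]setTI; exact: (measurable_eval i).
have [By|nBy] := pselect (B (y0 i)).
  by rewrite (_ : [set _ | _] = setT) //; apply/seteqP; split.
by rewrite (_ : [set _ | _] = set0) //; apply/seteqP; split.
Qed.

(** The first [n] coordinates have density [lik n] and the tail is frozen at [y0]. This is a measure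
    on full sequences, so uniqueness on rectangles applies to it. *)
Definition path_measure (n : nat) (y0 : nat -> U) (D : set seqs) : \bar R :=
  J n (fun y => \d_(freeze n y0 y : seqs) D * lik n y) y0.

Lemma path_integrand_ge0 n y0 D y : 0 <= \d_(freeze n y0 y : seqs) D * lik n y.
Proof. by rewrite mule_ge0 // lik_ge0. Qed.

Lemma measurable_path_integrand n y0 (D : set seqs) : measurable D ->
  measurable_fun [set: seqs] (fun y : seqs => \d_(freeze n y0 y : seqs) D * lik n y).
Proof.
move=> mD; apply: emeasurable_funM; last exact: measurable_lik.
have -> : (fun y : seqs => \d_(freeze n y0 y : seqs) D : \bar R) =
    (fun y : seqs => (\1_(freeze n y0 @^-1` D) y)%:E).
  apply: funext => y; rewrite diracE indicE.
  reflexivity.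
apply/measurable_EFinP; apply: measurable_indic.
by rewrite -[X in measurable X]setTI; exact: measurable_freeze.
Qed.

Section PathMeasure.
Variables (n : nat) (y0 : nat -> U).

Let path_measure0 : path_measure n y0 set0 = 0.
Proof.
rewrite /path_measure -[RHS](iter_integral0 m n y0); congr (J n _ y0).
by apply/funext => y; rewrite measure0 mul0e.
Qed.

Let path_measure_ge0 D : 0 <= path_measure n y0 D.
Proof. by apply: iter_integral_ge0 => y; exact: path_integrand_ge0. Qed.

Let path_measure_sigma_additive : semi_sigma_additive (path_measure n y0).
Proof.
move=> D mD tD mUD; rewrite /path_measure.
have -> : (fun y => \d_(freeze n y0 y : seqs) (\bigcup_i D i) * lik n y) =
    (fun y => \sum_(i <oo) (\d_(freeze n y0 y : seqs) (D i) * lik n y)).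
  apply/funext => y; rewrite measure_semi_bigcup // -(fineK (lik_fin n y)) muleC.
  rewrite -nneseriesZl => [|i _]; last exact: measure_ge0.
  by apply: eq_eseriesr => i _; rewrite muleC.
rewrite iter_integral_cvg_sum.
- apply: is_cvg_nneseries => i _ _; exact: path_measure_ge0.
- by move=> i y; exact: path_integrand_ge0.
- by move=> i; exact: measurable_path_integrand.
Qed.

HB.instance Definition _ := isMeasure.Build _ _ _ (path_measure n y0)
  path_measure0 path_measure_ge0 path_measure_sigma_additive.

Lemma path_measure_rectangle N B : (forall k, measurable (B k : set (borel U))) ->
  path_measure n y0 (rectangle N B) = P (freeze n y0 @^-1` rectangle N B).
Proof.
move=> mB; pose B' k := if (k < N)%N then B k else setT.
have mB' k : measurable (B' k : set (borel U)) by rewrite /B'; case: ifP.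
have [c|nc] := pselect (forall k, (n <= k)%N -> (k < N)%N -> B k (y0 k)); last first.
  have e0 : freeze n y0 @^-1` rectangle N B = set0.
    apply/seteqP; split => // y h; apply: nc => k nk kN; have := h k kN.
    by rewrite /freeze ltnNge nk.
  rewrite e0 measure0 /path_measure -[RHS](iter_integral0 m n y0); congr (J n _ y0).
  apply/funext => y; rewrite diracE memNset ?mul0e // => h.
  by have : (freeze n y0 @^-1` rectangle N B) y by []; rewrite e0.
have e1 : freeze n y0 @^-1` rectangle N B = rectangle n B'.
  apply/seteqP; split => y h k kn.
    rewrite /B'; case: ifP => // kN; have := h k kN; by rewrite /freeze kn.
  rewrite /freeze; case: ltnP => [kn'|nk]; last exact: c.
  by have := h k kn'; rewrite /B' kn.
rewrite e1 law_rectangle //.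
have := iter_integral_prod m mu n (w := eindicator)
  (K := fun k x u => ekernel k x u * (\1_(B' k) u)%:E) y0.
move=> <-.
- congr (J n _ y0); apply/funext => y.
  have -> : \d_(freeze n y0 y : seqs) (rectangle N B) = (\prod_(k < n) \1_(B' k) (y k) : R)%:E.
    rewrite diracE; have -> : (freeze n y0 y \in rectangle N B) = (y \in rectangle n B').
      by apply/idP/idP => /set_mem h; apply/mem_set; move: h; rewrite -e1.
    have [/set_mem h|h] := boolP (y \in rectangle n B').
      by rewrite big1 // => k _; rewrite indicE mem_set //; exact: h.
    apply/esym/eqP; rewrite eqe; apply/eqP.
    have [k kn nB] : exists2 k, (k < n)%N & ~ B' k (y k).
      apply: contrapT => h'; case/negP: h; apply/mem_set => k kn.
      by apply: contrapT => nB; apply: h'; exists k.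
    by rewrite (bigD1 (Ordinal kn)) //= indicE memNset // mul0r.
  rewrite (likE phi_gt0) -ge0_integralZl //.
  + apply: eq_integral => x _; rewrite muleCA; congr (_ * _).
    by rewrite muleC -prodEFin -big_split.
  + apply: emeasurable_funM; first exact: measurable_indicE_SFT.
    apply: (@measurable_prode _ _ _ n (fun k x => ekernel k x (y k))) => k.
    exact: (measurableT_comp (measurable_ekernel phi_cont k)
      (@pair2_measurable _ _ (seqX A) (borel U) (y k))).
  + by move=> x _; rewrite mule_ge0 ?lee_fin // prode_ge0 // => k _; exact: ekernel_ge0.
  + by rewrite lee_fin; apply: prodr_ge0.
- by move=> x; rewrite lee_fin.
- exact: measurable_indicE_SFT.
- by move=> k x u; rewrite mule_ge0 ?lee_fin // emission_ge0.
- by move=> k; exact: measurable_ekernel_cell.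
Qed.

(** The image of [P] under freezing the tail and [path_measure] agree on rectangles, hence on all
    measurable sets; a set that depends on [n] coordinates does not notice the freezing. *)
Lemma law_density (D : set seqs) : measurable D -> depends n (D : (nat -> U) -> Prop) ->
  P D = J n (fun y => \d_(y : seqs) D * lik n y) y0.
Proof.
move=> mD dD.
have eD y : D (freeze n y0 y) = D y by apply: dD => i ltin; rewrite /freeze ltin.
have e1 : freeze n y0 @^-1` D = D by apply/funext => y; exact: eD.
rewrite -[in LHS]e1.
have -> : J n (fun y => \d_(y : seqs) D * lik n y) y0 = path_measure n y0 D.
  congr (J n _ y0); apply/funext => y; rewrite !diracE.
  suff -> : (freeze n y0 y \in D) = (y \in D) by [].
  by rewrite -[LHS]/(`[< D (freeze n y0 y) >]) eD.
have mf := measurable_freeze n y0.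
have := @measure_eq_rectangles R U
  (pushforward P (freeze n y0 : seqs -> seqs)) (path_measure n y0).
rewrite /pushforward; apply => //.
- have h : P (freeze n y0 @^-1` setT) < +oo by rewrite preimage_setT probability_setT ltry.
  exact: h.
- by move=> p B mB; exact: (esym (path_measure_rectangle p mB)).
Qed.

End PathMeasure.

(** On a rectangle the preimage has a free first coordinate, of conditional probability 1; the other
    factors are those of the rectangle at the shifted hidden point, and [mu] is invariant. *)
Lemma law_shift (D : set seqs) : measurable D -> P (nshift 1 @^-1` D) = P D.
Proof.
move=> mD; have ms := @measurable_nshift U 1.
have := @measure_eq_rectangles R U (pushforward P (nshift 1 : seqs -> seqs)) P.
rewrite /pushforward; apply => //.
  have h : P (nshift 1 @^-1` setT) < +oo by rewrite preimage_setT probability_setT ltry.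
  exact: h.
move=> n B mB.
pose B' k := if k is k'.+1 then B k' else setT.
have mB' k : measurable (B' k : set (borel U)).
  by case: k => [|k]; [exact: measurableT|exact: mB].
change (P ((nshift 1 : seqs -> seqs) @^-1` rectangle n B) = P (rectangle n B)).
have -> : (nshift 1 : seqs -> seqs) @^-1` rectangle n B = rectangle n.+1 B'.
  apply/seteqP; split => [y h [|k] //= kn|y h k kn]; first exact: h.
  by have := h k.+1 kn.
rewrite !law_rectangle //.
pose G (x : seqX A) := eindicator x * \prod_(k < n) ecell k (B k) x.
have mG : measurable_fun [set: seqX A] G.
  apply: emeasurable_funM; first exact: measurable_indicE_SFT.
  by apply: (@measurable_prode _ _ _ n (fun k x => ecell k (B k) x)) => k; exact: measurable_ecell.
have G0 x : 0 <= G x.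
  by rewrite mule_ge0 ?lee_fin // prode_ge0 // => k _; exact: ecell_ge0.
have mS := @measurable_Sshift A.
transitivity (\int[mu]_x G (Sshift x)).
  apply: eq_integral => x _; rewrite /G /eindicator.
  have -> : \1_X (Sshift x) = \1_X x :> R.
    rewrite !indicE; have [Xx|nXx] := pselect (X x).
      by rewrite !mem_set //; exact: (SFT_iter 1 Xx).
    rewrite !memNset // => XS; apply: nXx.
    have := SFT_zshift (-1) XS; rewrite (_ : zshift _ _ = x) //.
    by apply/funext => i; rewrite /zshift /Sshift subrK.
  rewrite indicE; have [/set_mem Xx|_] := boolP (x \in X); last by rewrite !mul0e.
  rewrite !mul1e big_ord_recl /= ecellT // mul1e; apply: eq_bigr => k _.
  by rewrite /ecell /ekernel; apply: eq_integral => u _; rewrite -iterSr.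
have <- := @ge0_integral_pushforward _ _ (seqX A) (seqX A) R Sshift mS mu setT G measurableT mG (fun x _ => G0 x).
by apply: eq_measure_integral => D' mD' _; exact: mu_inv.
Qed.

End ObservationLaw.

(** * Maximal inequality for stationary averages *)

Section MaximalInequality.
Context {R : realType} {U : ptopologicalType}.
Local Notation seqs := (seqU U).
Variable P : probability seqs R.
Hypothesis P_shift : forall D : set seqs, measurable D -> P (nshift 1 @^-1` D) = P D.
Variable r : U -> R.
Hypothesis r_meas : measurable_fun [set: borel U] r.
Hypothesis r_ge0 : forall u, 0 <= r u.
Hypothesis r_int : (\int[P]_y (r (y 0%N))%:E < +oo)%E.
Variable lam : R.
Hypothesis lam_gt0 : 0 < lam.

(* the maximum of [r (y 0) + .. + r (y (l - 1)) - l * lam] over [l <= n] *)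
Fixpoint excess (n : nat) (y : nat -> U) : R :=
  if n is n'.+1 then Num.max 0 (r (y 0%N) - lam + excess n' (nshift 1 y)) else 0.

Lemma excess_ge0 n y : 0 <= excess n y.
Proof. by case: n => //= n; rewrite le_max lexx. Qed.

Lemma excessS n y : excess n y <= excess n.+1 y.
Proof.
elim: n y => [|n IH] y; first exact: excess_ge0.
rewrite [leLHS]/= [leRHS]/= ge_max !le_max lexx /= lerD2l; apply/orP; right; exact: IH.
Qed.

Lemma excess_sum n (y : nat -> U) : \sum_(i < n) r (y i) - n%:R * lam <= excess n y.
Proof.
elim: n y => [|n IH] y; first by rewrite big_ord0 mul0r subr0.
have h : \sum_(i < n) r (y i.+1) - n%:R * lam <= excess n (nshift 1 y) := IH (nshift 1 y).
rewrite [leRHS]/= le_max big_ord_recl; apply/orP; right.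
under eq_bigr do rewrite lift0.
rewrite -natr1; lra.
Qed.

(* Garsia's argument, arranged as an inequality between nonnegative functions so that
   integrating it involves no cancellation. *)
Lemma excess_step n y :
  excess n.+1 y + lam * \1_[set y | 0 < excess n.+1 y] y <= r (y 0%N) + excess n (nshift 1 y).
Proof.
rewrite indicE; have [p|p] := boolP (0 < excess n.+1 y).
  rewrite mem_set // mulr1; move: p; rewrite /= lt_max ltxx /= => p.
  by rewrite max_r ?(ltW p) //; lra.
rewrite memNset ?mulr0 ?addr0; last by move=> /= q; rewrite q in p.
by rewrite -leNgt in p; rewrite (le_trans p) // addr_ge0 // excess_ge0.
Qed.

Lemma measurable_excess n : measurable_fun [set: seqs] (excess n : seqs -> R).
Proof.
elim: n => [|n IH]; first exact: measurable_cst.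
apply: measurable_maxr; first exact: measurable_cst.
apply: measurable_funD; last exact: (measurableT_comp IH (@measurable_nshift U 1)).
apply: measurable_funB; last exact: measurable_cst.
exact: (measurableT_comp r_meas (measurable_eval 0)).
Qed.

Local Open Scope ereal_scope.

Lemma integral_shift (g : seqs -> \bar R) : measurable_fun [set: seqs] g ->
  (forall y, 0 <= g y) -> \int[P]_y g (nshift 1 y) = \int[P]_y g y.
Proof.
move=> mg g0.
have <- := @ge0_integral_pushforward _ _ seqs seqs R (nshift 1) (@measurable_nshift U 1) P setT g
  measurableT mg (fun x _ => g0 x).
apply: eq_measure_integral => [|? D mD _]; first exact: measurable_nshift.
exact: P_shift.
Qed.

Lemma measurable_excess_event n : measurable [set y : seqs | (0 < excess n y)%R].
Proof.
have := measurable_excess n measurableT (measurable_itv `]0%R, +oo[).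
congr (measurable _); apply/seteqP; split => y /=; rewrite in_itv /= andbT; first by case.
by split.
Qed.

(** Integrate [excess_step]. By stationarity the shifted excess has the same integral as the excess
    of order [n], which is at most that of order [n.+1]; this finite integral then cancels. *)
Lemma excess_event_le n :
  lam%:E * P [set y : seqs | (0 < excess n y)%R] <= \int[P]_y (r (y 0%N))%:E.
Proof.
have mr : measurable_fun [set: seqs] (fun y : seqs => (r (y 0%N))%:E).
  by apply/measurable_EFinP; exact: (measurableT_comp r_meas (measurable_eval 0)).
have me k : measurable_fun [set: seqs] (fun y : seqs => (excess k y)%:E).
  by apply/measurable_EFinP; exact: measurable_excess.
have e0 k y : 0 <= (excess k y)%:E by rewrite lee_fin excess_ge0.
have r0 (y : seqs) : 0 <= (r (y 0%N))%:E by rewrite lee_fin.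
have key k : \int[P]_y (excess k.+1 y)%:E + lam%:E * P [set y : seqs | (0 < excess k.+1 y)%R] <=
    \int[P]_y (r (y 0%N))%:E + \int[P]_y (excess k y)%:E.
  have mi := measurable_excess_event k.+1.
  have mI : measurable_fun [set: seqs]
      (fun y : seqs => (lam * \1_[set y : seqs | (0 < excess k.+1 y)%R] y)%:E).
    by apply/measurable_EFinP; apply: measurable_funM; [exact: measurable_cst|exact: measurable_indic].
  have -> : lam%:E * P [set y : seqs | (0 < excess k.+1 y)%R] =
      \int[P]_y (lam * \1_[set y : seqs | (0 < excess k.+1 y)%R] y)%:E.
    under eq_integral do rewrite EFinM.
    rewrite ge0_integralZl ?lee_fin ?(ltW lam_gt0) //.
    - by rewrite integral_indic // setIT.
    - by apply/measurable_EFinP; exact: measurable_indic.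
  rewrite -(integral_shift (me k)) // -!ge0_integralD //.
  - apply: le_integral_nonneg => y _; first by rewrite adde_ge0 // lee_fin mulr_ge0 // ltW.
    by rewrite -!EFinD lee_fin; exact: excess_step.
  - exact: (measurableT_comp (me k) (@measurable_nshift U 1)).
  - by move=> y _; rewrite lee_fin mulr_ge0 // ltW.
have fin k : \int[P]_y (excess k y)%:E < +oo.
  elim: k => [|k IH]; first by rewrite integral0 ltry.
  apply: le_lt_trans (lte_add_pinfty r_int IH); apply: le_trans (key k).
  by rewrite leeDl // mule_ge0 // lee_fin ltW.
case: n => [|n].
  rewrite (_ : [set y : seqs | _] = set0) ?measure0 ?mule0; last first.
    by apply/seteqP; split => y //=; rewrite ltxx.
  exact: integral_ge0.
have Efin : \int[P]_y (excess n.+1 y)%:E \is a fin_num.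
  by rewrite ge0_fin_numE ?fin //; exact: integral_ge0.
rewrite -(leeD2lE _ _ Efin) (le_trans (key n)) // [leRHS]addeC leeD2l //.
by apply: le_integral_nonneg => y _ //; rewrite lee_fin excessS.
Qed.

Lemma maximal_inequality : exists D : set seqs, [/\ measurable D,
  lam%:E * P D <= \int[P]_y (r (y 0%N))%:E &
  forall y : nat -> U, ~ D y -> forall n, (\sum_(i < n) r (y i) <= n%:R * lam)%R].
Proof.
pose D n := [set y : seqs | (0 < excess n y)%R].
have mD n : measurable (D n) by exact: measurable_excess_event.
exists (\bigcup_n D n); split.
- exact: bigcupT_measurable.
- have nD : nondecreasing_seq D.
    apply/nondecreasing_seqP => n; apply/subsetPset => y /= h.
    exact: lt_le_trans (excessS _ _).
  have := nondecreasing_cvg_mu (mu := P) mD (bigcupT_measurable _ mD) nD.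
  move=> /(cvgeZl (y := lam%:E) isT) /cvg_lim <- //.
  apply: lime_le; last by apply: nearW => n; exact: excess_event_le.
  apply: is_cvgeZl => //; apply: ereal_nondecreasing_is_cvgn.
  by move=> a b ab; apply: le_measure; rewrite ?inE //; exact/subsetPset/nD.
- move=> y nD n; rewrite leNgt; apply/negP => h; apply: nD; exists n => //.
  by rewrite /D /=; apply: lt_le_trans (excess_sum n y); rewrite subr_gt0.
Qed.

End MaximalInequality.

(** * Probabilities of rectangles given the hidden path *)

Section CellProbabilities.
Context {R : realType} {A : pfinType} (F : seq (seq A)) (U : pmetricType R).
Local Notation X := (SFT F).
Local Notation seqs := (seqU U).
Variable m : {sigma_finite_measure set (borel U) -> \bar R}.
Variable phi : (int -> A) -> U -> R.
Hypothesis phi_gt0 : forall x u, X x -> 0 < phi x u.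
Hypothesis phi_cont : continuous_emission F phi.
Hypothesis phi_int : forall x, X x -> (\int[m]_u (phi x u)%:E = 1)%E.
Variables (alpha H : R) (C : U -> R).
Hypothesis alpha_gt0 : 0 < alpha.
Hypothesis C_ge0 : forall u, 0 <= C u.
Hypothesis C_meas : measurable_fun [set: borel U] C.
Hypothesis phi_holder : forall u x y, X x -> X y ->
  `|ln (phi x u) - ln (phi y u)| <= C u * dX x y `^ alpha.
Hypothesis phi_expC : forall x, X x ->
  (\int[m]_u (expR (2 * C u) * phi x u)%:E <= H%:E)%E.

Definition cellprob (B : set U) (x : int -> A) : R :=
  fine (\int[m]_(u in (B : set (borel U))) (phi x u)%:E).

Section OneCell.
Variable B : set U.
Hypothesis mB : measurable (B : set (borel U)).

Lemma cell_integral_ge0 x : X x -> (0 <= \int[m]_(u in (B : set (borel U))) (phi x u)%:E)%E.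
Proof. by move=> Xx; apply: integral_ge0 => u _; rewrite lee_fin ltW // phi_gt0. Qed.

Lemma cell_integral_le1 x : X x -> (\int[m]_(u in (B : set (borel U))) (phi x u)%:E <= 1)%E.
Proof.
move=> Xx; rewrite -(phi_int Xx); apply: ge0_subset_integral => //.
- by apply/measurable_EFinP; exact: (measurable_emission phi_cont Xx).
- by move=> u _; rewrite lee_fin ltW // phi_gt0.
Qed.

Lemma cell_integralE x : X x ->
  (\int[m]_(u in (B : set (borel U))) (phi x u)%:E = (cellprob B x)%:E)%E.
Proof.
move=> Xx; rewrite /cellprob fineK // ge0_fin_numE ?cell_integral_ge0 //.
by rewrite (le_lt_trans (cell_integral_le1 Xx)) // ltry.
Qed.

Lemma cellprob_01 x : X x -> 0 <= cellprob B x <= 1.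
Proof.
by move=> Xx; rewrite -!lee_fin -cell_integralE // cell_integral_ge0 // cell_integral_le1.
Qed.

(* [expR (s * t) <= 1 + t * expR (2 * s)] for [0 <= t <= 1], so the exponential
   moment of the Hoelder constant bounds the modulus of continuity of [cellprob]. *)
Lemma cellprob_near x y t : X x -> X y -> dX x y `^ alpha <= t -> t <= 1 ->
  cellprob B y <= cellprob B x + t * H.
Proof.
move=> Xx Xy dt t1; have t0 : 0 <= t by rewrite (le_trans _ dt) // powR_ge0.
have pw u : phi y u <= phi x u + t * (expR (2 * C u) * phi x u).
  have px := phi_gt0 u Xx; have py := phi_gt0 u Xy.
  set s := C u; have s0 : 0 <= s := C_ge0 u.
  have l1 : ln (phi y u) <= ln (phi x u) + s * t.
    have := phi_holder u Xx Xy; rewrite ler_norml => /andP[h _].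
    have : s * dX x y `^ alpha <= s * t by rewrite ler_wpM2l.
    rewrite -/s in h; lra.
  have l2 : phi y u <= phi x u * expR (s * t).
    have ex : expR (ln (phi x u)) = phi x u by rewrite lnK ?posrE.
    have ey : expR (ln (phi y u)) = phi y u by rewrite lnK ?posrE.
    by move: l1; rewrite -ler_expR expRD ex ey.
  apply: (le_trans l2).
  have l3 : expR (s * t) <= 1 + t * expR (2 * s).
    have h1 : 1 + - (s * t) <= expR (- (s * t)) by exact: expR_ge1Dx.
    have h2 : 1 + s <= expR s by exact: expR_ge1Dx.
    have e1 : expR (s * t) * expR (- (s * t)) = 1 by rewrite -expRD subrr expR0.
    have h3 : expR (s * t) <= expR s by rewrite ler_expR ler_piMr.
    have e2 : expR (2 * s) = expR s * expR s by rewrite -expRD; congr expR; ring.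
    have p1 := expR_gt0 (s * t).
    have h4 : expR (s * t) * (1 + - (s * t)) <= 1 by rewrite -[leRHS]e1 ler_pM2l.
    have st0 : 0 <= s * t by rewrite mulr_ge0.
    have h5 : expR (s * t) * (s * t) <= expR s * (s * t) by rewrite ler_wpM2r.
    have h6 : expR s * (s * t) <= expR s * (expR s * t).
      rewrite ler_wpM2l ?expR_ge0 // ler_wpM2r //; lra.
    rewrite e2; lra.
  have -> : phi x u + t * (expR (2 * s) * phi x u) = phi x u * (1 + t * expR (2 * s)) by ring.
  by rewrite ler_wpM2l // ltW.
have mx := measurable_emission phi_cont Xx.
have me : measurable_fun [set: borel U] (fun u => expR (2 * C u) * phi x u).
  have mc : measurable_fun [set: borel U] (fun u => 2 * C u).
    by apply: measurable_funM => //; exact: measurable_cst.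
  have me : measurable_fun [set: borel U] (fun u => expR (2 * C u)).
    by have q := @measurable_expR R; apply: (measurableT_comp q mc).
  exact: (measurable_funM me mx).
have e0 u : 0 <= expR (2 * C u) * phi x u by rewrite mulr_ge0 ?expR_ge0 // ltW // phi_gt0.
rewrite -lee_fin EFinD -!cell_integralE //.
apply: (@le_trans _ _ (\int[m]_(u in (B : set (borel U)))
    ((phi x u)%:E + t%:E * (expR (2 * C u) * phi x u)%:E))%E).
  apply: le_integral_nonneg => u _; first by rewrite lee_fin ltW // phi_gt0.
  by rewrite -EFinM -EFinD lee_fin.
rewrite ge0_integralD //; last 4 first.
- by move=> u _; rewrite lee_fin ltW // phi_gt0.
- by apply/measurable_EFinP; exact: measurable_funTS.
- by move=> u _; rewrite -EFinM lee_fin mulr_ge0.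
- apply: measurable_funeM; apply/measurable_EFinP; exact: measurable_funTS.
apply: leeD => //; rewrite ge0_integralZl //; last 2 first.
- by apply/measurable_EFinP; exact: measurable_funTS.
- by move=> u _; rewrite lee_fin.
rewrite EFinM lee_wpmul2l ?lee_fin //; apply: le_trans (phi_expC Xx).
apply: ge0_subset_integral => //.
- by apply/measurable_EFinP.
- by move=> u _; rewrite lee_fin.
Qed.

End OneCell.

Lemma prod_near n (a b : 'I_n -> R) e : 0 <= e ->
  (forall i, 0 <= a i <= 1) -> (forall i, 0 <= b i <= 1) -> (forall i, b i <= a i + e) ->
  \prod_i b i <= \prod_i a i + n%:R * e.
Proof.
move=> e0; elim: n a b => [|n IH] a b a01 b01 ab; first by rewrite !big_ord0 mul0r addr0.
rewrite !big_ord_recl -natr1.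
have := IH (fun i => a (lift ord0 i)) (fun i => b (lift ord0 i)) (fun i => a01 _) (fun i => b01 _) (fun i => ab _).
set pa := \prod_(i < n) a _; set pb := \prod_(i < n) b _ => h.
have /andP[a0 a1] := a01 ord0; have /andP[b0 b1] := b01 ord0; have ab0 := ab ord0.
have pa0 : 0 <= pa by apply: prodr_ge0 => i _; case/andP: (a01 (lift ord0 i)).
have pb0 : 0 <= pb by apply: prodr_ge0 => i _; case/andP: (b01 (lift ord0 i)).
have pb1 : pb <= 1.
  by apply: prodr_ile1 => i _; exact: b01.
have : b ord0 * pb <= (a ord0 + e) * pb by rewrite ler_wpM2r.
have : a ord0 * pb <= a ord0 * (pa + n%:R * e) by rewrite ler_wpM2l.
have : e * pb <= e by rewrite ler_piMr.
have : a ord0 * (n%:R * e) <= n%:R * e by rewrite ler_piMl // mulr_ge0.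
lra.
Qed.

Section Rectangle.
Variables (k : nat) (B : nat -> set U).
Hypothesis mB : forall i, measurable (B i : set (borel U)).

Definition rectprob (x : int -> A) : R := \prod_(i < k) cellprob (B i) (iter i Sshift x).

Lemma rectprob_01 x : X x -> 0 <= rectprob x <= 1.
Proof.
move=> Xx; have c i : 0 <= cellprob (B i) (iter i Sshift x) <= 1.
  by apply: cellprob_01 => //; exact: SFT_iter.
apply/andP; split; first by apply: prodr_ge0 => i _; case/andP: (c i).
by apply: prodr_ile1 => i _; exact: c.
Qed.

Lemma H_ge0 x : X x -> 0 <= H.
Proof.
move=> Xx; rewrite -lee_fin (le_trans _ (phi_expC Xx)) // integral_ge0 // => u _.
by rewrite lee_fin mulr_ge0 ?expR_ge0 // ltW // phi_gt0.
Qed.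

Lemma rectprob_near M x y : X x -> X y ->
  (forall i : int, - M%:Z <= i -> i < M%:Z + k%:Z -> x i = y i) ->
  rectprob y <= rectprob x + k%:R * ((2^-1 ^+ M) `^ alpha * H).
Proof.
move=> Xx Xy xy; have H0 := H_ge0 Xx.
have t0 : 0 <= (2^-1 ^+ M : R) `^ alpha by exact: powR_ge0.
have t1 : (2^-1 ^+ M : R) `^ alpha <= 1.
  have h : (2^-1 ^+ M : R) `^ alpha <= 1 `^ alpha.
    rewrite ge0_ler_powR ?nnegrE ?exprn_ge0 ?(ltW alpha_gt0) //.
    by rewrite exprn_ile1 // invf_le1 // ler1n.
  by rewrite powR1 in h.
apply: prod_near => [|i|i|i].
- exact: mulr_ge0.
- by apply: cellprob_01 => //; exact: SFT_iter.
- by apply: cellprob_01 => //; exact: SFT_iter.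
apply: cellprob_near => //; try exact: SFT_iter.
rewrite ge0_ler_powR ?nnegrE ?dX_ge0 ?exprn_ge0 ?(ltW alpha_gt0) //.
apply: dX_agree => j jM; rewrite !iter_SshiftE; have ik := ltn_ord i.
by apply: xy; lia.
Qed.

(** Finite-range version of [rectprob], to be read at [half M x]: the window holds the [k] positions
    of the rectangle and [M] letters on each side. The value 0 on words that do not occur keeps it
    between 0 and 1. *)
Definition window_rectprob (M : nat) (z : nat -> A) : R :=
  let w := mkseq z (M + M + k) in
  if pselect (occurs F w) then rectprob (approximant F M w) else 0.

Lemma depends_window_rectprob M : depends (M + M + k) (window_rectprob M).
Proof.
move=> z z' zz'; rewrite /window_rectprob (_ : mkseq z _ = mkseq z' (M + M + k)) //.
by apply/eq_in_map => i; rewrite mem_iota => /andP[_]; exact: zz'.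
Qed.

Lemma window_rectprob_01 M z : 0 <= window_rectprob M z <= 1.
Proof.
rewrite /window_rectprob; case: pselect => [wo|?]; last by rewrite lexx ler01.
by have [Xr _] := word_repP wo; apply: rectprob_01; exact: SFT_zshift.
Qed.

Lemma window_rectprob_near M x : X x ->
  rectprob x <= window_rectprob M (half M x) + k%:R * ((2^-1 ^+ M) `^ alpha * H) /\
  window_rectprob M (half M x) <= rectprob x + k%:R * ((2^-1 ^+ M) `^ alpha * H).
Proof.
move=> Xx; rewrite /window_rectprob.
have -> : mkseq (half M x) (M + M + k) = window x (- M%:Z) (M + M + k).
  by apply: eq_map => i; rewrite /half addrC.
case: pselect => [?|nw]; last by case: nw; exact: occurs_window.
have [Xz agree] := approximantP M (M + M + k) Xx.
by split; apply: rectprob_near => // i li ri; rewrite agree //; lia.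
Qed.

End Rectangle.

End CellProbabilities.

(** Stated for a general [g] to serve twice: for indicators of the observations and for conditional
    probabilities given the hidden path. *)
Lemma prod_block {R : realType} {T : Type} (g : nat -> set T -> R) (n k r : nat)
    (B B' : nat -> set T) : (forall i, g i setT = 1) ->
  (forall i, (i < n + k)%N -> B' i = setT) ->
  (\prod_(i < k) g (n + i)%N (B i)) * \prod_(i < n + (k + r)) g i (B' i) =
  \prod_(i < n + (k + r)) g i (if (n <= i < n + k)%N then B (i - n)%N else B' i).
Proof.
move=> gT B'T; rewrite !big_split_ord /=.
have -> : \prod_(i < n) g i (B' i) = 1.
  by apply: big1 => i _; rewrite B'T // ltn_addr.
have -> : \prod_(i < k) g (n + i)%N (B' (n + i)%N) = 1.
  by apply: big1 => i _; rewrite B'T // ltn_add2l.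
have -> : \prod_(i < n) g i (if (n <= i < n + k)%N then B (i - n)%N else B' i) = 1.
  by apply: big1 => i _; rewrite leqNgt ltn_ord /= B'T // ltn_addr.
rewrite !mul1r; congr (_ * _); apply: eq_bigr => i _.
  by rewrite leq_addr ltn_add2l ltn_ord addKn.
by rewrite addnA ltnNge leq_addr andbF.
Qed.

Definition exp_moments {R : realType} {A : pfinType} (mu : probability (seqX A) R) :=
  forall n k (h : (nat -> A) -> R), (0 < k)%N -> depends n h ->
  (forall x, 0 <= h x <= 1) -> forall eta b0 : R, 0 < eta -> 0 < b0 ->
  exists b C, [/\ 0 < b, b <= b0 & forall m,
    wmean point (word_weight mu) (m * k + n) (fun x => expR (b * stride_sum k h m x)) <=
    C * expR (b * m%:R * (wmean point (word_weight mu) n h + eta))].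

(** * Exponential upper deviations of rectangle counts *)

Section RectangleFrequencies.
Context {R : realType} {A : pfinType} (F : seq (seq A)) (U : pmetricType R).
Local Notation X := (SFT F).
Local Notation seqs := (seqU U).
Variable m : {sigma_finite_measure set (borel U) -> \bar R}.
Variable phi : (int -> A) -> U -> R.
Hypothesis phi_gt0 : forall x u, X x -> 0 < phi x u.
Hypothesis phi_cont : continuous_emission F phi.
Hypothesis phi_int : forall x, X x -> (\int[m]_u (phi x u)%:E = 1)%E.
Variables (alpha H : R) (C : U -> R).
Hypothesis alpha_gt0 : 0 < alpha.
Hypothesis C_ge0 : forall u, 0 <= C u.
Hypothesis C_meas : measurable_fun [set: borel U] C.
Hypothesis phi_holder : forall u x y, X x -> X y ->
  `|ln (phi x u) - ln (phi y u)| <= C u * dX x y `^ alpha.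
Hypothesis phi_expC : forall x, X x ->
  (\int[m]_u (expR (2 * C u) * phi x u)%:E <= H%:E)%E.
Variable mu : probability (seqX A) R.
Hypothesis mu_X : mu X = 1%E.
Hypothesis mu_inv : forall B : set (seqX A), measurable B -> mu (Sshift @^-1` B) = mu B.
Hypothesis mu_exp : exp_moments mu.
Variable P : probability seqs R.
Hypothesis P_rect : is_law F m phi mu P.

Definition cell (i : nat) (B : set U) (x : seqX A) : R := fine (ecell F m phi i B x).

Lemma cellE i (B : set U) x : X x -> cell i B x = cellprob m phi B (iter i Sshift x).
Proof. by move=> Xx; rewrite /cell ecellE. Qed.

Lemma cell_01 i (B : set U) x : measurable (B : set (borel U)) -> X x -> 0 <= cell i B x <= 1.
Proof.
by move=> mB Xx; rewrite cellE //; apply: (cellprob_01 phi_gt0 phi_cont phi_int) => //; exact: SFT_iter.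
Qed.

Lemma cellT i x : X x -> cell i setT x = 1.
Proof. by move=> Xx; rewrite /cell (ecellT phi_int). Qed.

Lemma measurable_cell i (B : set U) : measurable (B : set (borel U)) ->
  measurable_fun [set: seqX A] (cell i B).
Proof.
move=> mB; have q := @fine_measurable R _ measurableT.
have q' := measurable_ecell m phi_gt0 phi_cont i mB.
by apply: (measurableT_comp q q').
Qed.

Definition rectind (k : nat) (B : nat -> set U) (y : nat -> U) : R :=
  \prod_(i < k) \1_(B i) (y i).

Lemma rectind_01 k B y : 0 <= rectind k B y <= 1.
Proof.
apply/andP; split; first by apply: prodr_ge0.
by apply: prodr_ile1 => i _; rewrite indicE; case: (_ \in _); rewrite /= lexx ler01.
Qed.

Lemma rectindE k B (y : seqs) : rectind k B y = \1_(rectangle k B) y.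
Proof.
rewrite indicE; have [/set_mem h|h] := boolP (y \in rectangle k B).
  by rewrite /rectind big1 // => i _; rewrite indicE mem_set //; exact: h.
have [i ik nB] : exists2 i, (i < k)%N & ~ B i (y i).
  apply: contrapT => h'; case/negP: h; apply/mem_set => i ik.
  by apply: contrapT => nB; apply: h'; exists i.
by rewrite /rectind (bigD1 (Ordinal ik)) //= indicE memNset // mul0r.
Qed.

Lemma measurable_rectind k B : (forall i, measurable (B i : set (borel U))) ->
  measurable_fun [set: seqs] (rectind k B : seqs -> R).
Proof.
move=> mB; rewrite (_ : rectind k B = \1_(rectangle k B)); last first.
  by apply/funext => y; exact: rectindE.
by apply: measurable_indic; exact: measurable_rectangle.
Qed.

Lemma measurable_prodr {d} {T : measurableType d} n (h : nat -> T -> R) :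
  (forall i, measurable_fun [set: T] (h i)) ->
  measurable_fun [set: T] (fun x => \prod_(i < n) h i x).
Proof.
move=> mh; elim: n => [|n IH].
  by under eq_fun do rewrite big_ord0; exact: measurable_cst.
by under eq_fun do rewrite big_ord_recr; exact: measurable_funM.
Qed.

Lemma law_rectind n B : (forall k, measurable (B k : set (borel U))) ->
  P (rectangle n B) = (\int[mu]_(x in X) (\prod_(i < n) cell i (B i) x)%:E)%E.
Proof.
move=> mB; rewrite /rectangle P_rect //; apply: eq_integral => x /set_mem Xx.
rewrite -prodEFin; apply: eq_bigr => i _; rewrite cellE //.
by apply: (cell_integralE phi_gt0 phi_cont phi_int) => //; exact: SFT_iter.
Qed.

Section OneRectangle.
Variables (k : nat) (B : nat -> set U).
Hypothesis k_gt0 : (0 < k)%N.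
Hypothesis mB : forall i, measurable (B i : set (borel U)).

(** Substitute for the exponential of [b] times the block count. It is affine in each block
    indicator, so conditioning on the hidden path simply replaces indicators by probabilities. *)
Definition block_tilt (b : R) (n : nat) (y : nat -> U) : R :=
  \prod_(j < n) (1 + b * rectind k B (nshift (j * k) y)).

Definition hidden_tilt (b : R) (n : nat) (x : seqX A) : R :=
  \prod_(j < n) (1 + b * \prod_(i < k) cell (j * k + i) (B i) x).

Lemma block_tilt_ge0 b n y : 0 <= b -> 0 <= block_tilt b n y.
Proof.
move=> b0; apply: prodr_ge0 => j _; rewrite addr_ge0 // mulr_ge0 //.
by case/andP: (rectind_01 k B (nshift (j * k) y)).
Qed.

Lemma hidden_tilt_ge0 b n x : 0 <= b -> X x -> 0 <= hidden_tilt b n x.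
Proof.
move=> b0 Xx; apply: prodr_ge0 => j _; rewrite addr_ge0 // mulr_ge0 //.
by apply: prodr_ge0 => i _; have /andP[] := cell_01 (j * k + i) (mB i) Xx.
Qed.

Lemma measurable_block_tilt b n : measurable_fun [set: seqs] (block_tilt b n : seqs -> R).
Proof.
apply: (@measurable_prodr _ seqs n (fun j y => 1 + b * rectind k B (nshift (j * k) y))) => j.
apply: measurable_funD; first exact: measurable_cst.
apply: measurable_funM; first exact: measurable_cst.
exact: (measurableT_comp (measurable_rectind k mB) (measurable_nshift (j * k))).
Qed.

Lemma measurable_hidden_tilt b n : measurable_fun [set: seqX A] (hidden_tilt b n).
Proof.
apply: (@measurable_prodr _ (seqX A) n (fun j x => 1 + b * \prod_(i < k) cell (j * k + i) (B i) x)) => j.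
apply: measurable_funD; first exact: measurable_cst.
apply: measurable_funM; first exact: measurable_cst.
apply: (@measurable_prodr _ (seqX A) k (fun i x => cell (j * k + i) (B i) x)) => i.
exact: measurable_cell.
Qed.

(* Given the hidden path the observations are independent, so disjoint blocks factor.
   The extra rectangle [B'] carries the induction. *)
Lemma block_tilt_expectation_gen b n r (B' : nat -> set U) : 0 <= b ->
  (forall i, measurable (B' i : set (borel U))) ->
  (forall i, (i < n * k)%N -> B' i = setT) ->
  (\int[P]_y (block_tilt b n y * rectind (n * k + r) B' y)%:E =
   \int[mu]_(x in X) (hidden_tilt b n x * \prod_(i < n * k + r) cell i (B' i) x)%:E)%E.
Proof.
move=> b0; elim: n r B' => [|n IH] r B' mB' B'T.
  have -> : (\int[P]_y (block_tilt b 0 y * rectind (0 * k + r) B' y)%:E)%E =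
      P (rectangle r B').
    rewrite -[RHS]mul1e -integral_cst; last exact: measurable_rectangle.
    rewrite [RHS]integral_mkcond; apply: eq_integral => y _.
    rewrite /block_tilt big_ord0 mul1r add0n rectindE patchE indicE.
    by case: ifP.
  rewrite law_rectind //; apply: eq_integral => x _.
  by rewrite /hidden_tilt big_ord0 mul1r add0n.
pose B'' i := if (n * k <= i < n * k + k)%N then B (i - n * k)%N else B' i.
have E : (n.+1 * k + r = n * k + (k + r))%N by rewrite mulSn; lia.
have B'T' i : (i < n * k + k)%N -> B' i = setT by move=> ?; apply: B'T; rewrite mulSn; lia.
have mB'' i : measurable (B'' i : set (borel U)) by rewrite /B''; case: ifP.
have B'T1 i : (i < n * k)%N -> B' i = setT by move=> ?; apply: B'T'; rewrite ltn_addr.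
have B''T i : (i < n * k)%N -> B'' i = setT.
  by move=> ltin; rewrite /B'' leqNgt ltin /= B'T1.
rewrite E.
transitivity (\int[P]_y ((block_tilt b n y * rectind (n * k + (k + r)) B' y)%:E +
    b%:E * (block_tilt b n y * rectind (n * k + (k + r)) B'' y)%:E))%E.
  apply: eq_integral => y _; rewrite -EFinM -EFinD; congr (_%:E).
  rewrite /block_tilt big_ord_recr /= -/(block_tilt b n y).
  have <- : rectind k B (nshift (n * k) y) * rectind (n * k + (k + r)) B' y =
      rectind (n * k + (k + r)) B'' y.
    apply: (@prod_block _ _ (fun i D => \1_D (y i))) => // i.
    by rewrite indicE mem_set.
  ring.
have mprod (D : nat -> set U) : (forall i, measurable (D i : set (borel U))) -> measurable_fun [set: seqs]
    (fun y : seqs => (block_tilt b n y * rectind (n * k + (k + r)) D y)%:E).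
  move=> mD; apply/measurable_EFinP; apply: measurable_funM; first exact: measurable_block_tilt.
  exact: measurable_rectind.
have pprod (D : nat -> set U) y : (0 <= (block_tilt b n y * rectind (n * k + (k + r)) D y)%:E)%E.
  rewrite lee_fin mulr_ge0 ?block_tilt_ge0 //.
  by case/andP: (rectind_01 (n * k + (k + r)) D y).
rewrite ge0_integralD //; last 3 first.
- exact: mprod.
- by move=> y _; rewrite mule_ge0.
- by apply: measurable_funeM; exact: mprod.
rewrite ge0_integralZl //; last exact: mprod.
rewrite !IH //.
have mX := measurable_SFT F.
have mh (D : nat -> set U) : (forall i, measurable (D i : set (borel U))) -> measurable_fun (X : set (seqX A))
    (fun x => (hidden_tilt b n x * \prod_(i < n * k + (k + r)) cell i (D i) x)%:E).
  move=> mD; apply: measurable_funTS; apply/measurable_EFinP; apply: measurable_funM.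
    exact: measurable_hidden_tilt.
  apply: (@measurable_prodr _ (seqX A) (n * k + (k + r))%N (fun i x => cell i (D i) x)) => i.
  exact: measurable_cell.
have ph (D : nat -> set U) x : (forall i, measurable (D i : set (borel U))) -> X x ->
    (0 <= (hidden_tilt b n x * \prod_(i < n * k + (k + r)) cell i (D i) x)%:E)%E.
  move=> mD Xx; rewrite lee_fin mulr_ge0 ?hidden_tilt_ge0 //.
  by apply: prodr_ge0 => i _; have /andP[] := cell_01 i (mD i) Xx.
rewrite -ge0_integralZl //; last 2 first.
- exact: mh.
- by move=> x Xx; exact: ph.
rewrite -ge0_integralD //; last 4 first.
- by move=> x Xx; exact: ph.
- exact: mh.
- by move=> x Xx; rewrite mule_ge0 // ph.
- by apply: measurable_funeM; exact: mh.
apply: eq_integral => x /set_mem Xx; rewrite -EFinM -EFinD; congr (_%:E).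
rewrite /hidden_tilt big_ord_recr /= -/(hidden_tilt b n x).
have <- : (\prod_(i < k) cell (n * k + i) (B i) x) *
    \prod_(i < n * k + (k + r)) cell i (B' i) x =
    \prod_(i < n * k + (k + r)) cell i (B'' i) x.
  apply: (@prod_block _ _ (fun i D => cell i D x)) => // i.
  exact: cellT.
ring.
Qed.

Lemma block_tilt_expectation b n : 0 <= b ->
  (\int[P]_y (block_tilt b n y)%:E = \int[mu]_(x in X) (hidden_tilt b n x)%:E)%E.
Proof.
move=> b0; have := @block_tilt_expectation_gen b n 0 (fun=> setT) b0 (fun=> measurableT) (fun _ _ => erefl).
rewrite addn0 => h.
transitivity (\int[P]_y (block_tilt b n y * rectind (n * k) (fun=> setT) y)%:E)%E.
  apply: eq_integral => y _; rewrite /rectind big1 ?mulr1 // => i _.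
  by rewrite indicE mem_set.
rewrite h; apply: eq_integral => x /set_mem Xx; rewrite big1 ?mulr1 // => i _.
exact: cellT.
Qed.

Local Notation Q := (rectprob m phi k B).
Local Notation W := (window_rectprob F m phi k B).
Local Notation E := (wmean (point : A) (word_weight mu)).

Definition block_count (n : nat) (y : nat -> U) : R :=
  \sum_(j < n) rectind k B (nshift (j * k) y).

Lemma measurable_block_count n : measurable_fun [set: seqs] (block_count n : seqs -> R).
Proof.
rewrite /block_count; apply: (@measurable_sum _ seqs R setT 'I_n _
  (fun j y => rectind k B (nshift (j * k) y))) => j.
exact: (measurableT_comp (measurable_rectind k mB) (measurable_nshift (j * k))).
Qed.

Lemma half_iter M (i : nat) (x : int -> A) : half M (iter i Sshift x) = nshift i (half M x).
Proof. by apply/funext => l; rewrite /half /nshift iter_SshiftE; congr x; lia. Qed.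

Lemma law_rectprob : P (rectangle k B) = (\int[mu]_(x in X) (Q x)%:E)%E.
Proof.
rewrite law_rectind //; apply: eq_integral => x /set_mem Xx; congr (_%:E).
by apply: eq_bigr => i _; rewrite cellE.
Qed.

Lemma law_rectangle_fin : P (rectangle k B) = (fine (P (rectangle k B)))%:E.
Proof. by rewrite fineK // fin_num_measure //; exact: measurable_rectangle. Qed.

Lemma half_pow_small (e : R) : 0 < e -> exists M, k%:R * ((2^-1 ^+ M) `^ alpha * H) <= e.
Proof.
move=> e0; pose q := (2^-1 : R) `^ alpha.
have q0 : 0 < q by rewrite powR_gt0.
have q1 : q < 1.
  have := @gt0_ltr_powR R alpha alpha_gt0 2^-1 1; rewrite powR1; apply; rewrite ?nnegrE //.
  by rewrite invf_lt1 // ltr1n.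
have qn : `|q| < 1 by rewrite gtr0_norm.
have K0 : 0 < k%:R * `|H| + 1 :> R by rewrite ltr_wpDl // mulr_ge0.
have /cvgrPdist_le := cvg_expr qn.
move=> /(_ (e / (k%:R * `|H| + 1))); rewrite divr_gt0 // => /(_ isT) [M _ /(_ M (leqnn M))].
rewrite /= sub0r normrN gtr0_norm ?exprn_gt0 // => qM; exists M.
have -> : (2^-1 ^+ M : R) `^ alpha = q ^+ M.
  by rewrite -[RHS]powR_mulrn ?powR_ge0 // -powRrM mulrC powRrM powR_mulrn ?invr_ge0.
rewrite ler_pdivlMr // in qM; apply: le_trans qM; rewrite mulrCA ler_wpM2l ?exprn_ge0 ?(ltW q0) //.
have : k%:R * H <= k%:R * `|H| by rewrite ler_wpM2l // ler_norm.
lra.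
Qed.

(** Recovers the exponential of the count from the tilt with a second-order loss: [expR (- s)] is at
    least [1 - s], and [(1 + b) * (1 - b + b ^+ 2)] equals [1 + b ^+ 3]. *)
Lemma tilt_ge (b : R) : 0 <= b -> b <= 1 -> expR (b - b ^+ 2) <= 1 + b.
Proof.
move=> b0 b1; set s := b - b ^+ 2.
have h : 1 + - s <= expR (- s) by exact: expR_ge1Dx.
have e1 : expR s * expR (- s) = 1 by rewrite -expRD subrr expR0.
have p := expR_gt0 s.
have h2 : expR s * (1 + - s) <= 1 by rewrite -[leRHS]e1 ler_pM2l.
have s1 : 0 < 1 + - s by rewrite /s; nra.
rewrite -(ler_pM2r s1) (le_trans h2) // /s.
have -> : (1 + b) * (1 + - (b - b ^+ 2)) = 1 + b ^+ 3 by ring.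
by rewrite lerDl exprn_ge0.
Qed.

Lemma upper_deviation (dl : R) : 0 < dl -> exists g C0, [/\ 0 < g, 0 <= C0 & forall n,
  (P [set y : seqs | (n%:R * (fine (P (rectangle k B)) + dl) <= block_count n y)%R] <=
   (C0 * expR (- g * n%:R))%:E)%E].
Proof.
(* The error [e] is paid three times: in the mean of the window version, in the slack of the
   exponential moment bound, and in replacing [rectprob] block by block. *)
move=> dl0; set p := fine _; pose e := dl / 8.
have e0 : 0 < e by rewrite divr_gt0.
have [M hM] := half_pow_small e0; set t := k%:R * _ in hM.
pose n0 := (M + M + k)%N.
have Wdep : depends n0 (W M) by exact: depends_window_rectprob.
have W01 z : 0 <= W M z <= 1 by exact: (window_rectprob_01 phi_gt0 phi_cont phi_int).
have near_rect x (Xx : X x) := window_rectprob_near phi_gt0 phi_cont phi_int alpha_gt0 C_ge0 C_meas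
  phi_holder phi_expC k mB M Xx.
have p0 : 0 <= p by rewrite /p fine_ge0.
have p1 : p <= 1.
  by rewrite -lee_fin -law_rectangle_fin probability_le1 //; exact: measurable_rectangle.
have EW : E n0 (W M) <= p + e.
  rewrite -lee_fin -(integral_windows mu_inv mu_X M (fun z => proj1 (andP (W01 z))) Wdep).
  rewrite EFinD -law_rectangle_fin law_rectprob.
  apply: (@le_trans _ _ (\int[mu]_(x in X) ((Q x)%:E + e%:E))%E).
    apply: le_integral_nonneg => x Xx; first by rewrite lee_fin; case/andP: (W01 (half M x)).
    have [_ h] := near_rect x Xx; rewrite -EFinD lee_fin (le_trans h) // lerD2l; exact: hM.
  have mX := measurable_SFT F.
  have mQ : measurable_fun (X : set (seqX A)) (fun x => (Q x)%:E).
    apply: (@eq_measurable_fun _ _ _ _ _ (fun x => (\prod_(i < k) cell i (B i) x)%:E)).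
      by move=> x /set_mem Xx; congr (_%:E); apply: eq_bigr => i _; rewrite cellE.
    apply: measurable_funTS; apply/measurable_EFinP.
    apply: (@measurable_prodr _ (seqX A) k (fun i x => cell i (B i) x)) => i.
    exact: measurable_cell.
  rewrite ge0_integralD //.
  - rewrite leeD2l // integral_cst //.
    by rewrite [X in (_ * X)%E]mu_X mule1.
  - by move=> x Xx; rewrite lee_fin; have /andP[] := rectprob_01 phi_gt0 phi_cont phi_int k mB Xx.
  - by move=> x _; rewrite lee_fin ltW.
(* This makes the second-order loss [b ^+ 2 * (p + dl)] at most [b * dl / 4], as [p <= 1]. *)
pose b0 := Num.min 1 (dl / (4 * (1 + dl))).
have b00 : 0 < b0 by rewrite lt_min ltr01 divr_gt0 // mulr_gt0 // addr_gt0.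
have [b [C0 [b_gt0 bb0 hb]]] := mu_exp k_gt0 Wdep W01 e0 b00.
have b1 : b <= 1 by rewrite (le_trans bb0) // ge_min lexx.
have bd : b * (1 + dl) <= dl / 4.
  have : b <= dl / (4 * (1 + dl)) by rewrite (le_trans bb0) // ge_min lexx orbT.
  rewrite ler_pdivlMr ?mulr_gt0 ?addr_gt0 //; lra.
have C00 : 0 <= C0.
  have := hb 0%N; rewrite mulr0 mul0r expR0 mulr1; apply: le_trans.
  by apply: wmean_ge0 => [w|z]; [exact: word_weight_ge0|exact: expR_ge0].
exists (b * dl / 4), C0; split => //; first by rewrite divr_gt0 // mulr_gt0.
move=> n; set T := [set y | _].
have mT : measurable T.
  have := measurable_block_count n measurableT (measurable_itv `[(n%:R * (p + dl))%R, +oo[).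
  congr (measurable _); apply/seteqP; split => y /=; rewrite in_itv /= andbT; first by case.
  by split.
have sb : 0 <= b - b ^+ 2 by rewrite subr_ge0 expr2 ler_piMr // ltW.
pose c := expR ((b - b ^+ 2) * (n%:R * (p + dl))).
have c0 : 0 < c by exact: expR_gt0.
have Mk : (c%:E * P T <= \int[P]_y (block_tilt b n y)%:E)%E.
  rewrite -integral_cst //.
  apply: (@le_trans _ _ (\int[P]_(y in T) (block_tilt b n y)%:E)%E).
    apply: le_integral_nonneg => y Ty; rewrite lee_fin; first exact: ltW.
    apply: (@le_trans _ _ (expR ((b - b ^+ 2) * block_count n y))).
      by rewrite ler_expR ler_wpM2l.
    rewrite /block_count mulr_sumr expR_sum; apply: ler_prod => j _.
    rewrite expR_ge0 /= rectindE indicE; case: (_ \in _) => /=.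
      by rewrite !mulr1 tilt_ge // ltW.
    by rewrite !mulr0 expR0 addr0.
  apply: ge0_subset_integral => //.
  - by apply/measurable_EFinP; exact: measurable_block_tilt.
  - by move=> y _; rewrite lee_fin block_tilt_ge0 // ltW.
have up : (\int[P]_y (block_tilt b n y)%:E <= (C0 * expR (b * n%:R * (p + 3 * e)))%:E)%E.
  rewrite block_tilt_expectation ?(ltW b_gt0) //.
  pose g z := expR (b * (n%:R * e)) * expR (b * stride_sum k (W M) n z).
  have gdep : depends (n * k + n0) g.
    by move=> z z' zz'; rewrite /g (depends_stride_sum Wdep zz').
  have g0 z : 0 <= g z by rewrite mulr_ge0 ?expR_ge0.
  apply: (@le_trans _ _ (\int[mu]_(x in X) (g (half M x))%:E)%E).
    apply: le_integral_nonneg => x Xx; rewrite lee_fin.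
      by rewrite hidden_tilt_ge0 // ltW.
    rewrite /g -expRD -mulrDr.
    apply: (@le_trans _ _ (expR (b * \sum_(j < n) Q (iter (j * k) Sshift x)))).
      rewrite mulr_sumr expR_sum; apply: ler_prod => j _.
      have -> : \prod_(i < k) cell (j * k + i) (B i) x = Q (iter (j * k) Sshift x).
        by apply: eq_bigr => i _; rewrite cellE // addnC iterD.
      have /andP[q0 _] := rectprob_01 phi_gt0 phi_cont phi_int k mB (SFT_iter (j * k) Xx).
      rewrite expR_ge1Dx andbT addr_ge0 // mulr_ge0 // ltW //.
    rewrite ler_expR ler_wpM2l ?(ltW b_gt0) //.
    have -> : n%:R * e = \sum_(j < n) e by rewrite sumr_const card_ord mulr_natl.
    rewrite addrC /stride_sum -big_split /=; apply: ler_sum => j _.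
    rewrite -half_iter; have [h _] := near_rect _ (SFT_iter (j * k) Xx).
    by rewrite (le_trans h) // lerD2l; exact: hM.
  rewrite (integral_windows mu_inv mu_X M g0 gdep) lee_fin wmeanZ.
  apply: le_trans (ler_wpM2l (expR_ge0 _) (hb n)) _.
  rewrite mulrCA -expRD; apply: ler_wpM2l => //; rewrite ler_expR.
  have bn0 : 0 <= b * n%:R by rewrite mulr_ge0 // ltW.
  have := ler_wpM2l bn0 EW; lra.
rewrite -(lee_pmul2l (x := c%:E)) //.
apply: (le_trans Mk); apply: (le_trans up).
rewrite -EFinM lee_fin [leRHS]mulrCA; apply: ler_wpM2l => //.
rewrite /c -expRD ler_expR.
have n0' : 0 <= n%:R :> R by [].
have key : b * (p + 3 * e) <= (b - b ^+ 2) * (p + dl) - b * dl / 4.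
  have : b * (b * (p + dl)) <= b * (dl / 4).
    rewrite ler_pM2l // (le_trans _ bd) // ler_pM2l //; lra.
  rewrite /e; have : 0 <= b * dl by rewrite mulr_ge0 // ltW.
  by rewrite expr2 => ? ?; lra.
have := ler_wpM2l n0' key; lra.
Qed.

End OneRectangle.

End RectangleFrequencies.

(** * Lower deviations through complements of rectangles *)

Section RectangleComplement.
Context {R : realType} {U : ptopologicalType}.
Local Notation seqs := (seqU U).
Variable B : nat -> set U.

(* the complement of a rectangle is the disjoint union over [i] of these rectangles,
   according to the first coordinate [i] that leaves [B i] *)
Definition exit_cell (i l : nat) : set U :=
  if (l < i)%N then B l else if l == i then ~` B l else setT.

Lemma measurable_exit_cell i l : (forall i, measurable (B i : set (borel U))) ->
  measurable (exit_cell i l : set (borel U)).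
Proof.
move=> mB; rewrite /exit_cell; case: ifP => _; first exact: mB.
by case: ifP => _; [apply: measurableC; exact: mB|exact: measurableT].
Qed.
End RectangleComplement.

Section RectangleCounts.
Context {R : realType} {U : pmetricType R}.
Local Notation seqs := (seqU U).
Implicit Types B : nat -> set U.

Lemma rectind_partition B k (y : nat -> U) :
  rectind k B y + \sum_(i < k) rectind k (exit_cell B i) y = 1 :> R.
Proof.
elim: k => [|k IH]; first by rewrite /rectind !big_ord0 addr0.
rewrite -[RHS]IH big_ord_recr /=.
have S D : rectind k.+1 D y = rectind k D y * \1_(D k) (y k) :> R.
  by rewrite /rectind big_ord_recr.
have -> : rectind k.+1 (exit_cell B k) y = rectind k B y * (1 - \1_(B k) (y k)).
  rewrite S /exit_cell ltnn eqxx; congr (_ * _).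
    by apply: eq_bigr => i _; rewrite ltn_ord.
  rewrite !indicE; have [h|h] := pselect (B k (y k)).
    by rewrite memNset ?mem_set ?subrr // => /(_ h).
  by rewrite mem_set // memNset // subr0.
have -> : \sum_(i < k) rectind k.+1 (exit_cell B i) y = \sum_(i < k) rectind k (exit_cell B i) y.
  apply: eq_bigr => i _; rewrite S /exit_cell ltnNge ltnW ?ltn_ord //=.
  by rewrite gtn_eqF ?ltn_ord // indicE mem_set // mulr1.
rewrite S; ring.
Qed.

Lemma block_count_partition B k n (y : nat -> U) :
  block_count k B n y + \sum_(i < k) block_count k (exit_cell B i) n y = n%:R :> R.
Proof.
rewrite /block_count exchange_big /= -big_split /=.
rewrite (eq_bigr (fun=> 1)) ?sumr_const ?card_ord // => j _.
exact: rectind_partition.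
Qed.

Lemma depends_block_count B k n : depends (n * k) (block_count k B n : (nat -> U) -> R).
Proof.
move=> y y' yy'; apply: eq_bigr => j _; apply: eq_bigr => i _; congr (\1_(B i) _).
rewrite /nshift; apply: yy'; have := ltn_ord i; have := ltn_ord j; move=> jn ik.
by rewrite (leq_trans _ (_ : j.+1 * k <= n * k)%N) ?leq_mul2r ?jn ?orbT // mulSn addnC ltn_add2r.
Qed.

Variable P : probability seqs R.
Local Notation pr k B := (fine (P (rectangle k B))).

Lemma rectangle_prE k B : (forall i, measurable (B i : set (borel U))) ->
  P (rectangle k B) = (pr k B)%:E.
Proof. by move=> mB; rewrite fineK // fin_num_measure //; exact: measurable_rectangle. Qed.

Lemma rectangle_pr_partition k B : (forall i, measurable (B i : set (borel U))) ->
  pr k B + \sum_(i < k) pr k (exit_cell B i) = 1.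
Proof.
move=> mB; have mE i l := measurable_exit_cell i l mB.
have I D : (forall i, measurable (D i : set (borel U))) ->
    (\int[P]_y (rectind k D y)%:E = (pr k D)%:E)%E.
  move=> mD; rewrite -rectangle_prE // -[X in _ = P X]setIT -integral_indic //.
    by apply: eq_integral => y _; rewrite rectindE.
  exact: measurable_rectangle.
apply: EFin_inj; rewrite EFinD -sumEFin -I //.
under eq_bigr => i _ do rewrite -I //.
rewrite -ge0_integral_sum //.
- rewrite -ge0_integralD //.
  + transitivity (\int[P]_y (cst 1%E y))%E; last by rewrite integral_cst // mul1e; exact: probability_setT.
    apply: eq_integral => y _; rewrite sumEFin -EFinD; congr (_%:E).
    exact: rectind_partition.
  + by move=> y _; rewrite lee_fin; case/andP: (@rectind_01 R U k B y).
  + by apply/measurable_EFinP; exact: measurable_rectind.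
  + move=> y _; apply: sume_ge0 => i _; rewrite lee_fin.
    by case/andP: (@rectind_01 R U k (exit_cell B i) y).
  + apply: emeasurable_sum => i; apply/measurable_EFinP; exact: measurable_rectind.
- by move=> i; apply/measurable_EFinP; exact: measurable_rectind.
- by move=> i y _; rewrite lee_fin; case/andP: (@rectind_01 R U k (exit_cell B i) y).
Qed.

Definition upper_deviations := forall k B, (0 < k)%N ->
  (forall i, measurable (B i : set (borel U))) -> forall dl : R, 0 < dl ->
  exists g C0 : R, [/\ 0 < g, 0 <= C0 & forall n,
  (P [set y : seqs | (n%:R * (pr k B + dl) <= block_count k B n y)%R] <=
   (C0 * expR (- g * n%:R))%:E)%E].

Lemma measurable_count_event B k n (a : R) : (forall i, measurable (B i : set (borel U))) ->
  measurable [set y : seqs | a <= block_count k B n y].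
Proof.
move=> mB.
have := measurable_block_count k mB n measurableT (measurable_itv `[a, +oo[).
congr (measurable _); apply/seteqP; split => y /=; rewrite in_itv /= andbT; first by case.
by split.
Qed.

(** The counts of the rectangle and of its [k] exit rectangles sum to [n], and their probabilities
    to 1. A deficit larger than [n * dl] thus forces an excess of at least [n * dl / k] in one exit
    rectangle. *)
Lemma lower_deviation : upper_deviations -> forall k B, (0 < k)%N ->
  (forall i, measurable (B i : set (borel U))) -> forall dl : R, 0 < dl ->
  exists g C0 : R, [/\ 0 < g, 0 <= C0 & forall n,
  (P (~` [set y : seqs | (n%:R * (pr k B - dl) <= block_count k B n y)%R]) <=
   (C0 * expR (- g * n%:R))%:E)%E].
Proof.
move=> up k B k0 mB dl dl0; have mE i l := measurable_exit_cell i l mB.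
have k0' : 0 < k%:R :> R by rewrite ltr0n.
have dk : 0 < dl / k%:R by rewrite divr_gt0.
have [g hg] := choice (fun i : 'I_k => up k (exit_cell B i) k0 (mE i) _ dk).
have [C0 hC] := choice hg.
pose G := \big[Num.min/1]_(i < k) g i.
have G0 : 0 < G by apply: (big_ind (fun x => 0 < x)) => // [x y x0 y0|i _]; [rewrite lt_min x0|have [] := hC i].
have Gle i : G <= g i by rewrite /G (bigD1 i) //= ge_min lexx.
exists G, (\sum_(i < k) C0 i); split => //.
  by apply: sumr_ge0 => i _; have [] := hC i.
move=> n; set D := ~` _.
pose T (i : nat) := [set y : seqs | n%:R * (pr k (exit_cell B i) + dl / k%:R) <= block_count k (exit_cell B i) n y].
have mT i : measurable (T i) by exact: measurable_count_event.
have DT : D `<=` \big[setU/set0]_(i < k) T i.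
  move=> y Dy; apply: contrapT => nT; apply: Dy => /=.
  have lt (i : 'I_k) : block_count k (exit_cell B i) n y < n%:R * (pr k (exit_cell B i) + dl / k%:R).
    rewrite ltNge; apply/negP => h; apply: nT; rewrite -bigcup_seq; exists i => //=.
    by rewrite mem_index_enum.
  have e1 := block_count_partition B k n y.
  have e2 := rectangle_pr_partition k mB.
  have s : \sum_(i < k) block_count k (exit_cell B i) n y <=
      \sum_(i < k) n%:R * (pr k (exit_cell B i) + dl / k%:R).
    by apply: ler_sum => i _; exact: ltW.
  have dkk : (dl / k%:R) *+ k = dl by rewrite -[LHS]mulr_natl mulrC divfK // gt_eqF.
  move: s; rewrite -mulr_sumr big_split /= sumr_const card_ord dkk.
  move=> s; have -> : block_count k B n y = n%:R - \sum_(i < k) block_count k (exit_cell B i) n y by rewrite -e1 addrK.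
  have -> : pr k B = 1 - \sum_(i < k) pr k (exit_cell B i) by rewrite -e2 addrK.
  lra.
apply: (@le_trans _ _ (\sum_(i < k) P (T i))%E).
  apply: (@le_trans _ _ (P (\big[setU/set0]_(i < k) T i))).
    apply: le_measure; rewrite ?inE //.
      by apply: measurableC; exact: measurable_count_event.
    by apply: bigsetU_measurable => i _.
  by apply: (@Boole_inequality _ _ _ P) => i _; exact: mT.
rewrite mulr_suml -sumEFin; apply: lee_sum => i _; have [_ C0i h] := hC i.
apply: (le_trans (h n)); rewrite lee_fin ler_wpM2l // ler_expR ler_wpM2r // lerN2.
exact: Gle.
Qed.

End RectangleCounts.

(** * Powerful tests and exponential separation of likelihoods *)

Section SeparatingRectangle.
Context {R : realType} {U : pmetricType R}.
Local Notation seqs := (seqU U).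
Variables P0 P1 : probability seqs R.

(** The sign of the difference is prescribed. If no rectangle had larger [P1]-probability, the same
    would hold for its exit rectangles, and since all these probabilities sum to 1 the two laws
    would agree on rectangles. *)
Lemma separating_rectangle (D : set seqs) : measurable D -> P0 D <> P1 D ->
  exists k B, [/\ (0 < k)%N, forall i, measurable (B i : set (borel U)) &
    fine (P0 (rectangle k B)) < fine (P1 (rectangle k B))].
Proof.
move=> mD neq; apply: contrapT => no; apply: neq.
have fin : (P0 setT < +oo)%E by rewrite probability_setT ltry.
apply: measure_eq_rectangles => //.
have le k B : (forall i, measurable (B i : set (borel U))) ->
    fine (P1 (rectangle k.+1 B)) <= fine (P0 (rectangle k.+1 B)).
  move=> mB; rewrite leNgt; apply/negP => h; apply: no.
  by exists k.+1, B.
move=> [|k] B mB.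
  have -> : rectangle 0 B = setT by apply/seteqP; split.
  exact: (etrans (probability_setT P0) (esym (probability_setT P1))).
suff: P0 (rectangle k.+1 B) = P1 (rectangle k.+1 B) by [].
rewrite (rectangle_prE P0) // (rectangle_prE P1) //; congr (_%:E).
apply/eqP; rewrite eq_le le // andbT.
have e0 := rectangle_pr_partition P0 k.+1 mB.
have e1 := rectangle_pr_partition P1 k.+1 mB.
have : \sum_(i < k.+1) fine (P1 (rectangle k.+1 (exit_cell B i))) <=
    \sum_(i < k.+1) fine (P0 (rectangle k.+1 (exit_cell B i))).
  by apply: ler_sum => i _; apply: le => l; exact: measurable_exit_cell.
lra.
Qed.

End SeparatingRectangle.

Lemma borel_cantelli_exp {d} {T : measurableType d} {R : realType} (P : probability T R)
    (bad : nat -> set T) (K c : R) : (forall n, measurable (bad n)) -> 0 <= K -> 0 < c ->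
  (forall n, (P (bad n) <= (K * expR (- c * n%:R))%:E)%E) ->
  {ae P, forall y, exists N : nat, forall n, (N <= n)%N -> ~ bad n y}.
Proof.
move=> mb K0 c0 hb; pose q := expR (- c).
have q0 : 0 <= q by exact: expR_ge0.
have q1 : q < 1 by rewrite -expR0 ltr_expR oppr_lt0.
have fin : (\sum_(n <oo) P (bad n) < +oo)%E.
  apply: (@le_lt_trans _ _ (K * (1 - q)^-1)%:E); last exact: ltry.
  apply: lime_le; first by apply: is_cvg_nneseries => n _ _; exact: measure_ge0.
  apply: nearW => n; apply: (@le_trans _ _ (\sum_(0 <= i < n) (K * q ^+ i)%:E)%E).
    apply: lee_sum => i _; rewrite (le_trans (hb i)) // lee_fin ler_wpM2l // /q.
    by rewrite mulrC expRM_natl.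
  rewrite sumEFin lee_fin -mulr_sumr ler_wpM2l // big_mkord.
  exact: geometric_sum_le.
have P0 := lim_sup_set_cvg0 mb fin.
exists (lim_sup_set bad); split => //.
  apply: bigcapT_measurable => n; exact: bigcup_measurable.
move=> y /= hy n _; apply: contrapT => h; apply: hy; exists n => i ni bi.
by apply: h; exists i.
Qed.

Section ExponentialSeparation.
Context {R : realType} {U : pmetricType R}.
Local Notation seqs := (seqU U).
Variables P0 P1 : probability seqs R.
Variables l0 l1 : nat -> (nat -> U) -> \bar R.
Hypothesis l0_meas : forall n, measurable_fun [set: seqs] (l0 n : seqs -> \bar R).
Hypothesis l1_meas : forall n, measurable_fun [set: seqs] (l1 n : seqs -> \bar R).
Hypothesis l0_dep : forall n, depends n (l0 n).
Hypothesis l1_dep : forall n, depends n (l1 n).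
Hypothesis ratio : forall n (D : set seqs) (c : R), measurable D ->
  depends n (D : (nat -> U) -> Prop) -> 0 <= c ->
  (forall y, D y -> (l1 n y <= c%:E * l0 n y)%E) -> (P1 D <= c%:E * P0 D)%E.
Hypothesis up0 : upper_deviations P0.
Hypothesis up1 : upper_deviations P1.
Variable D0 : set seqs.
Hypothesis D0_meas : measurable D0.
Hypothesis D0_neq : P0 D0 <> P1 D0.

(* A rectangle whose frequency is smaller under [P0] yields an exponentially powerful
   test between [P0] and [P1]. *)
Lemma exponential_separation : exists c : R, 0 < c /\
  {ae P1, forall y : seqs, exists N : nat, forall n, (N <= n)%N ->
    (l0 n y <= (expR (- c * n%:R))%:E * l1 n y)%E}.
Proof.
have [k [B [k0 mB p01]]] := separating_rectangle D0_meas D0_neq.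
set p0 := fine (P0 _) in p01; set p1 := fine (P1 _) in p01.
pose dl := (p1 - p0) / 2.
have dl0 : 0 < dl by rewrite divr_gt0 // subr_gt0.
have [g0 [C0 [g0_gt0 C0_ge0 h0]]] := up0 k0 mB dl0.
have [g1 [C1 [g1_gt0 C1_ge0 h1]]] := lower_deviation up1 k0 mB dl0.
have mid : p0 + dl = p1 - dl by rewrite /dl; field.
rewrite -/p0 in h0; rewrite -/p1 -mid in h1.
have k_gt0 : 0 < k%:R :> R by rewrite ltr0n.
(* Deviation rates are per block; division by [k] makes them per observation, and half of the rate
   pays for the change of measure on [bad]. *)
pose c := Num.min g0 g1 / (2 * k%:R).
have c_gt0 : 0 < c by rewrite divr_gt0 ?lt_min ?g0_gt0 // mulr_gt0.
have ck0 : 2 * c * k%:R <= g0.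
  have -> : 2 * c * k%:R = Num.min g0 g1 by rewrite /c; field; exact: lt0r_neq0.
  by rewrite ge_min lexx.
have ck1 : 2 * c * k%:R <= g1.
  have -> : 2 * c * k%:R = Num.min g0 g1 by rewrite /c; field; exact: lt0r_neq0.
  by rewrite ge_min lexx orbT.
pose T n := [set y : seqs | n%:R * (p0 + dl) <= block_count k B n y].
have mT n : measurable (T n) by exact: measurable_count_event.
pose bad n := [set y : seqs | (l1 n y <= (expR (c * n%:R))%:E * l0 n y)%E].
have mbad n : measurable (bad n).
  rewrite -[X in measurable X]setTI; apply: measurable_lee => //.
  exact: measurable_funeM.
(* Inside the test event [T] a change of measure to [P0], at cost [expR (c * n%:R)], makes the count
   atypically high; outside it the count is atypically low under [P1]. The factor [expR (g0 + g1)]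
   pays for the incomplete last block. *)
have key n : (P1 (bad n) <= ((C0 + C1) * expR (g0 + g1) * expR (- c * n%:R))%:E)%E.
  pose q := (n %/ k)%N.
  have qk : (q * k <= n)%N by rewrite /q leq_trunc_div.
  have nq : n%:R <= (q%:R + 1) * k%:R :> R.
    by rewrite natr1 -natrM ler_nat /q ltnW // ltn_ceil.
  have E0 (g : R) : 0 <= g -> 2 * c * k%:R <= g -> - g * q%:R <= g - 2 * c * n%:R.
    move=> gg ck; have : 2 * c * n%:R <= 2 * c * ((q%:R + 1) * k%:R).
      by rewrite ler_wpM2l // mulr_ge0 // ltW.
    have : (2 * c * k%:R) * (q%:R + 1) <= g * (q%:R + 1) by rewrite ler_wpM2r // addr_ge0.
    lra.
  apply: (@le_trans _ _ (P1 (bad n `&` T q) + P1 (~` T q))%E).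
    apply: (@le_trans _ _ (P1 ((bad n `&` T q) `|` ~` T q))).
      apply: le_measure; rewrite ?inE //.
        by apply: measurableU; [exact: measurableI|exact: measurableC].
      by move=> y by_; have [ty|ty] := pselect (T q y); [left|right].
    by apply: measureU2; [exact: measurableI|exact: measurableC].
  have b1 : (P1 (bad n `&` T q) <= (expR (c * n%:R) * (C0 * expR (- g0 * q%:R)))%:E)%E.
    apply: (@le_trans _ _ ((expR (c * n%:R))%:E * P0 (bad n `&` T q))%E).
      apply: (@ratio n) => //; first exact: measurableI.
      - move=> y y' yy'; have e : block_count k B q y = block_count k B q y' :> R.
          by apply: depends_block_count => i ik; apply: yy'; exact: leq_trans ik qk.
        by rewrite /setI /bad /T /= (l0_dep yy') (l1_dep yy') e.
      - by move=> y [].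
    rewrite EFinM lee_wpmul2l ?lee_fin ?expR_ge0 //; apply: le_trans (h0 q).
    apply: le_measure; rewrite ?inE //; [exact: measurableI|exact: mT].
  apply: (le_trans (leeD b1 (h1 q))); rewrite -EFinD lee_fin.
  have cn : 0 <= c * n%:R by rewrite mulr_ge0 // ltW.
  have i0 : expR (c * n%:R) * (C0 * expR (- g0 * q%:R)) <= C0 * (expR (g0 + g1) * expR (- c * n%:R)).
    rewrite mulrCA -!expRD; apply: ler_wpM2l => //; rewrite ler_expR.
    have := E0 _ (ltW g0_gt0) ck0; lra.
  have i1 : C1 * expR (- g1 * q%:R) <= C1 * (expR (g0 + g1) * expR (- c * n%:R)).
    rewrite -!expRD; apply: ler_wpM2l => //; rewrite ler_expR.
    have := E0 _ (ltW g1_gt0) ck1; lra.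
  rewrite -mulrA mulrDl; exact: lerD.
exists c; split => //.
have K0 : 0 <= (C0 + C1) * expR (g0 + g1) by rewrite mulr_ge0 ?expR_ge0 // addr_ge0.
apply: filterS (borel_cantelli_exp mbad K0 c_gt0 key) => y [N hN]; exists N => n Nn.
have /negP := hN n Nn; rewrite -ltNge => /ltW h.
have e0 := expR_gt0 (- c * n%:R).
rewrite -(@lee_pmul2l _ (expR (c * n%:R))%:E) ?lte_fin ?expR_gt0 //.
rewrite muleA -EFinM -expRD (_ : c * n%:R + - c * n%:R = 0) ?expR0 ?mul1e //; lra.
Qed.

End ExponentialSeparation.

(** * Comparison of likelihoods and of posteriors *)

Section LikelihoodRatio.
Context {R : realType} {A : pfinType} (F : seq (seq A)) (U : pmetricType R).
Local Notation X := (SFT F).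
Local Notation seqs := (seqU U).
Variable m : {sigma_finite_measure set (borel U) -> \bar R}.

Lemma depends_lik (phi : (int -> A) -> U -> R) (mu : probability (seqX A) R) n :
  depends n (lik F phi mu n).
Proof.
move=> y y' yy'; apply: eq_integral => x _; congr (_%:E); apply: eq_bigr => k _.
by rewrite yy'.
Qed.

Definition is_emission (phi : (int -> A) -> U -> R) :=
  [/\ forall x u, X x -> 0 < phi x u,
      continuous_emission F phi,
      forall x, X x -> (\int[m]_u (phi x u)%:E = 1)%E &
      exists phi_max : U -> R, forall x u, X x -> phi x u <= phi_max u].

Lemma likelihood_ratio phi0 phi1 (mu0 mu1 : probability (seqX A) R)
    (P0 P1 : probability seqs R) n (D : set seqs) (c : R) :
  is_emission phi0 -> is_emission phi1 -> mu0 X = 1%E -> mu1 X = 1%E ->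
  is_law F m phi0 mu0 P0 -> is_law F m phi1 mu1 P1 ->
  measurable D -> depends n (D : (nat -> U) -> Prop) -> 0 <= c ->
  (forall y, D y -> (lik F phi1 mu1 n y <= c%:E * lik F phi0 mu0 n y)%E) ->
  (P1 D <= c%:E * P0 D)%E.
Proof.
move=> [pos0 cont0 int0 [max0 le0]] [pos1 cont1 int1 [max1 le1]] X0 X1 law0 law1 mD dD c0 h.
rewrite (law_density pos1 cont1 le1 X1 law1 point mD dD).
rewrite (law_density pos0 cont0 le0 X0 law0 point mD dD).
have l00 y := lik_ge0 pos0 mu0 n y; have l10 y := lik_ge0 pos1 mu1 n y.
rewrite -iter_integralZ //.
- apply: le_iter_integral => y; first by rewrite mule_ge0.
  rewrite diracE; have [/set_mem yD|_] := boolP (y \in D).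
    by rewrite !mul1e; exact: h.
  by rewrite !mul0e mule0.
- by move=> y; rewrite mule_ge0.
- apply: emeasurable_funM; last exact: measurable_lik.
  have -> : (fun y : seqs => \d_(y : seqs) D : \bar R) = (fun y => (\1_D y)%:E).
    by apply/funext => y; rewrite diracE indicE.
  by apply/measurable_EFinP; exact: measurable_indic.
Qed.

End LikelihoodRatio.

Lemma word_weight_exp_moment {R : realType} {A : pfinType} (F : seq (seq A)) (Theta : pmetricType R)
    (f : Theta -> (int -> A) -> R) (mu : Theta -> probability (seqX A) R) :
  mixing (SFT F) -> regular_family (SFT F) f ->
  (forall th, invariant_Gibbs (SFT F) (f th) (mu th)) ->
  forall th, exp_moments (mu th).
Proof.
move=> hmix hf hmu th n k h k0 hd h01 eta b0 e0 b00.
have [N gluing] := SFT_specification hmix.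
have [B [D [d [d0 hadm]]]] := regular_family_admissible hf hmu th.
have [fB fD] : admissible F B D (f th) by apply: hadm; rewrite mdistxx.
have [muX [minv _]] := hmu th; have [K [P [K0 hK]]] := word_weight_gibbs hmu th.
have M0 := word_weight_ge0 (mu th); have M1 := word_weight_nil (mu th).
have Ml := word_weight_left minv; have Mr := word_weight_right (mu th).
have Ms := word_weight_supp muX.
have mixing_M u v := gibbs_mixing gluing fB M0 Ms K0 hK u v.
have quasi_M u v := gibbs_quasi M0 Ms K0 hK u v.
exact: (exp_moment_bound point M0 M1 Ml Mr (gibbs_mixing_const_gt0 N B P K0) mixing_M
  (exprn_ge0 3 (ltW K0)) quasi_M k0 hd h01 e0 b00).
Qed.

(** Replacing the hidden point by an approximant turns the product of emissions into a function of a
    word of length [s + s + n]. There the word weights are compared, and the approximant is then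
    undone. Each replacement costs the exponential of the sum of [r], hence the factor 2. *)
Lemma lik_le_discretized {R : realType} {A : pfinType} (F : seq (seq A)) (U : pmetricType R)
    (mu mu' : probability (seqX A) R) (phi phi' : (int -> A) -> U -> R)
    (r : U -> R) (s n : nat) (K : R) (y : nat -> U) :
  mu (SFT F) = 1%E -> mu' (SFT F) = 1%E ->
  (forall B : set (seqX A), measurable B -> mu (Sshift @^-1` B) = mu B) ->
  (forall B : set (seqX A), measurable B -> mu' (Sshift @^-1` B) = mu' B) ->
  (forall x u, SFT F x -> 0 <= phi x u) -> (forall x u, SFT F x -> 0 <= phi' x u) ->
  (forall x x' u, SFT F x -> SFT F x' -> dX x x' <= 2^-1 ^+ s :> R ->
     phi x u <= expR (r u) * phi' x' u) ->
  (forall x x' u, SFT F x -> SFT F x' -> dX x x' <= 2^-1 ^+ s :> R ->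
     phi' x u <= expR (r u) * phi' x' u) ->
  0 <= K ->
  (forall w, size w = (s + s + n)%N -> word_weight mu w <= K * word_weight mu' w) ->
  (lik F phi mu n y <= (K * expR (2 * \sum_(k < n) r (y k)))%:E * lik F phi' mu' n y)%E.
Proof.
move=> muX mu'X inv inv' p0 p0' near near' K0 MM'.
set S := \sum_(k < n) _.
pose g z := let w := mkseq z (s + s + n) in
  if pselect (occurs F w) then
    expR S * \prod_(k < n) phi' (iter k Sshift (approximant F s w)) (y k) else 0.
have g0 z : 0 <= g z.
  rewrite /g; case: pselect => // wo; have [Xr _] := word_repP wo.
  rewrite mulr_ge0 ?expR_ge0 // prodr_ge0 // => k _; apply: p0'.
  by apply: SFT_iter; exact: SFT_zshift.
have gd : depends (s + s + n) g.
  move=> z z' zz'; rewrite /g (_ : mkseq z _ = mkseq z' (s + s + n)) //.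
  by apply/eq_in_map => i; rewrite mem_iota => /andP[_]; exact: zz'.
have hS : \prod_(k < n) expR (r (y k)) = expR S by rewrite expR_sum.
have [pg gp] : (forall x, SFT F x -> \prod_(k < n) phi (iter k Sshift x) (y k) <= g (half s x)) /\
    (forall x, SFT F x -> g (half s x) <=
       expR (2 * S) * \prod_(k < n) phi' (iter k Sshift x) (y k)).
  have rep x : SFT F x -> exists z, [/\ SFT F z,
      forall k : 'I_n, dX (iter k Sshift x) (iter k Sshift z) <= 2^-1 ^+ s :> R,
      forall k : 'I_n, dX (iter k Sshift z) (iter k Sshift x) <= 2^-1 ^+ s :> R &
      g (half s x) = expR S * \prod_(k < n) phi' (iter k Sshift z) (y k)].
    move=> Xx; rewrite /g.
    have -> : mkseq (half s x) (s + s + n) = window x (- s%:Z) (s + s + n).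
      by apply: eq_map => i; rewrite /half addrC.
    case: pselect => [?|nw]; last by case: nw; exact: occurs_window.
    have [Xz agree] := approximantP s (s + s + n) Xx.
    exists (approximant F s (window x (- s%:Z) (s + s + n))).
    split=> // k; apply: dX_agree => i i_s; have kn := ltn_ord k;
      by rewrite !iter_SshiftE agree //; lia.
  split=> x Xx; have [z [Xz xz zx ->]] := rep x Xx.
    rewrite -hS -big_split /=; apply: ler_prod => k _.
    by rewrite p0 ?near //; exact: SFT_iter.
  rewrite (_ : 2 * S = S + S) ?expRD -?mulrA ?ler_wpM2l ?expR_ge0 //; last by rewrite mulr_natl mulr2n.
  rewrite -hS -big_split /=; apply: ler_prod => k _.
  by rewrite p0' ?near' //; exact: SFT_iter.
apply: (@le_trans _ _ (\int[mu]_(x in SFT F) (g (half s x))%:E)%E).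
  apply: le_integral_nonneg => x Xx; rewrite lee_fin ?pg //.
  by rewrite prodr_ge0 // => k _; apply: p0; exact: SFT_iter.
rewrite (integral_windows inv muX s g0 gd).
apply: (@le_trans _ _ (K%:E * \int[mu']_(x in SFT F) (g (half s x))%:E)%E).
  rewrite (integral_windows inv' mu'X s g0 gd) lee_fin /wmean -wsumZ.
  by apply: le_wsum => w sw; rewrite mulrA ler_wpM2r // MM'.
rewrite EFinM -muleA lee_wpmul2l ?lee_fin //.
(* The constant is moved onto [g], whose measurability is known; the passage to the emissions is
   then a pointwise comparison. *)
pose h (x : seqX A) := ((expR (- (2 * S)))%:E * (g (half s x))%:E)%E.
have mg : measurable_fun (SFT F : set (seqX A)) (fun x : seqX A => (g (half s x))%:E).
  by apply/measurable_EFinP; apply: measurable_funTS; exact: (measurable_windows mu' s g0 gd).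
apply: (@le_trans _ _ ((expR (2 * S))%:E * \int[mu']_(x in SFT F) h x)%E).
  rewrite ge0_integralZl //; first by rewrite muleA -EFinM -expRD subrr expR0 mul1e.
  - exact: measurable_SFT.
  - by move=> x _; rewrite lee_fin.
rewrite lee_wpmul2l ?lee_fin ?expR_ge0 //; apply: le_integral_nonneg => x Xx.
  by rewrite mule_ge0 // lee_fin // expR_ge0.
rewrite /h -EFinM lee_fin expRN mulrC ler_pdivrMr ?expR_gt0 // mulrC; exact: gp.
Qed.

(** [t] stands for the likelihood of the true parameter, a common scale that cancels. The
    denominator is bounded below by its part over [V]. *)
Lemma posterior_le {R : realType} {Theta : ptopologicalType} {U : Type}
    (Pi0 : probability (borel Theta) R) (p : Theta -> nat -> (nat -> U) -> \bar R)
    (K V : set Theta) n y (t a b : R) :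
  (forall th, 0 <= p th n y)%E -> closed K -> open V -> (0 < Pi0 V)%E -> 0 < t -> 0 <= a -> 0 < b ->
  (forall th, K th -> p th n y <= (a * t)%:E)%E -> (forall th, V th -> (b * t)%:E <= p th n y)%E ->
  0 <= posterior Pi0 p K n y <= a / (b * fine (Pi0 V)).
Proof.
move=> p0 clK opV PV t0 a0 b0 hK hV; rewrite /posterior.
have mV : measurable (V : set (borel Theta)) by exact: sub_sigma_algebra.
have mK : measurable (K : set (borel Theta)).
  by rewrite -(setCK K); apply: measurableC; apply: sub_sigma_algebra; exact: closed_openC.
have vfin : Pi0 V \is a fin_num by exact: fin_num_measure.
have v0 : 0 < fine (Pi0 V) by rewrite fine_gt0 // PV -ge0_fin_numE ?measure_ge0.
have at0 : 0 <= a * t by rewrite mulr_ge0 // ltW.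
have num : (0 <= \int[Pi0]_(th in K) p th n y <= (a * t)%:E)%E.
  rewrite integral_ge0 //=; apply: (@le_trans _ _ (\int[Pi0]_(th in K) cst (a * t)%:E th)%E).
    exact: le_integral_nonneg.
  rewrite integral_cst // -[leRHS]mule1 lee_wpmul2l ?lee_fin //; exact: probability_le1.
have den : ((b * t * fine (Pi0 V))%:E <= \int[Pi0]_th p th n y)%E.
  have bt0 : 0 <= b * t by rewrite mulr_ge0 // ltW.
  rewrite EFinM fineK // (_ : _ * _ = \int[Pi0]_th ((b * t)%:E * (\1_V th)%:E))%E; last first.
    rewrite ge0_integralZl_EFin //; first by rewrite integral_indic // setIT.
    by apply/measurable_EFinP; exact: measurable_indic.
  apply: le_integral_nonneg => th _; first by rewrite mule_ge0 ?lee_fin.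
  rewrite indicE; have [/set_mem Vth|_] := boolP (th \in V); first by rewrite mule1 hV.
  by rewrite mule0.
have bv0 : 0 < b * fine (Pi0 V) by rewrite mulr_gt0.
case: (\int[Pi0]_(th in K) _)%E num => [N|/andP[]//|/andP[]//] /andP[]; rewrite !lee_fin => N0 Na.
(* An infinite denominator has [fine] equal to 0, and division by 0 gives 0, so the bound still
   holds. *)
case: (\int[Pi0]_th _)%E den => [d| |//]; last first.
  by move=> _; rewrite /= invr0 mulr0 lexx divr_ge0 // ltW.
rewrite lee_fin /= => hd.
have btv : 0 < b * t * fine (Pi0 V) by rewrite !mulr_gt0.
have d0 : 0 < d by exact: lt_le_trans hd.
rewrite divr_ge0 ?(ltW d0) //= ler_pdivrMr // (le_trans Na) //.
rewrite mulrAC ler_pdivlMr // (_ : a * t * _ = a * (b * t * fine (Pi0 V))); first by rewrite ler_wpM2l.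
ring.
Qed.

(** [C] is Borel for the product topology, so its sections are reached through continuity of the
    embedding of a fibre. *)
Lemma measurable_pair_fst {T U : ptopologicalType} (t : T) :
  measurable_fun [set: borel U] ((fun u : U => (t, u)) : borel U -> borel (T * U)%type).
Proof.
apply: measurable_fun_generated => O oO; apply: sub_sigma_algebra.
rewrite /= openE => u tu; have : nbhs (t, u) O by move: oO; rewrite openE; apply.
case=> -[Q1 Q2] /= [n1 n2] sub; apply: filterS n2 => v Q2v; apply: sub; split => //=.
exact: nbhs_singleton.
Qed.

Lemma half_pow_le {R : realType} (e : R) : 0 < e ->
  exists N : nat, forall n, (N <= n)%N -> 2^-1 ^+ n <= e.
Proof.
move=> e0; have : (fun s : nat => (2^-1 : R) ^+ s) @ \oo --> 0.
  by apply: cvg_expr; rewrite ger0_norm ?invr_ge0 // invf_lt1 // ltr1n.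
move=> /cvgrPdist_le /(_ _ e0) [N _ hN]; exists N => n Nn.
by have := hN n Nn; rewrite sub0r normrN ger0_norm // exprn_ge0.
Qed.

(** * Posterior consistency for hidden Gibbs processes *)

Section HiddenGibbs.
Context {R : realType} {A : pfinType} (F : seq (seq A)) (Theta : pmetricType R).
Local Notation X := (SFT F).
Hypothesis hmix : mixing X.
Variable f : Theta -> (int -> A) -> R.
Hypothesis hf : regular_family X f.
Variable mu : Theta -> probability (seqX A) R.
Hypothesis hmu : forall th, invariant_Gibbs X (f th) (mu th).
Variable U : pmetricType R.
Variable m : {sigma_finite_measure set (borel U) -> \bar R}.
Variable phi : Theta -> (int -> A) -> U -> R.
Hypothesis hphi_pos : forall th x u, X x -> 0 < phi th x u.
Hypothesis hphi_cont : joint_continuous X phi.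
Hypothesis hphi_int : forall th x, X x -> (\int[m]_u (phi th x u)%:E = 1)%E.
Variable PU : Theta -> probability (seqU U) R.
Hypothesis hPU : forall th, is_law F m (phi th) (mu th) (PU th).
Variable thstar : Theta.
Variable Lstar : U -> R.
Hypothesis hLstar : forall th x u, X x -> `|negloglik phi th x u| <= Lstar u.
Variable rho : R -> U -> R.
Hypothesis hrho : forall d : R, 0 < d ->
  measurable_fun [set: borel U] (rho d) /\ (forall u, 0 < rho d u) /\
  forall th th' x x' u, X x -> X x' -> Num.max (mdist th th') (dX x x') <= d ->
    `|negloglik phi th x u - negloglik phi th' x' u| <= rho d u.
Hypothesis hrho_lim : (fun d : R => \int[PU thstar]_y (rho d (y 0%N))%:E)%E @ at_right 0 --> 0%E.
Variable alpha : R.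
Hypothesis halpha : 0 < alpha.
Variable C : Theta -> U -> R.
Hypothesis hC_meas : measurable_fun [set: borel (Theta * U)%type] (fun p : Theta * U => C p.1 p.2).
Hypothesis hC_ge0 : forall th u, 0 <= C th u.
Hypothesis hC_hold : forall th u x y, X x -> X y ->
  `|negloglik phi th x u - negloglik phi th y u| <= C th u * dX x y `^ alpha.
Hypothesis hC_int : forall beta : R, 0 < beta ->
  (ereal_sup [set \int[m]_u (expR (beta * C p.1 u) * phi p.1 p.2 u)%:E
             | p in [set p : Theta * (int -> A) | X p.2]] < +oo)%E.
Local Notation l := (fun th => lik F (phi th) (mu th)).
Local Notation P := (PU thstar).

Lemma is_emission_family th : is_emission F m (phi th).
Proof.
split.
- by move=> x u; exact: hphi_pos.
- move=> x u Xx e e0; have [d [d0 hd]] := hphi_cont th u Xx e0; exists d; split => // x' u' Xx'.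
  by apply: hd => //; rewrite mdistxx.
- exact: hphi_int.
- exists (fun u => expR (Lstar u)) => x u Xx.
  rewrite -[leLHS]lnK ?posrE ?hphi_pos // ler_expR.
  by rewrite (le_trans _ (hLstar th u Xx)) // /negloglik normrN ler_norm.
Qed.

Lemma observation_upper_deviations th : upper_deviations (PU th).
Proof.
have [pos cont int _] := is_emission_family th.
have [muX [minv _]] := hmu th.
have mC : measurable_fun [set: borel U] (C th).
  exact: (measurableT_comp hC_meas (measurable_pair_fst th)).
have hold u x y : X x -> X y -> `|ln (phi th x u) - ln (phi th y u)| <= C th u * dX x y `^ alpha.
  by move=> Xx Xy; have := hC_hold th u Xx Xy; rewrite /negloglik -opprD normrN.
have [H hH] : exists H : R, forall x, X x -> (\int[m]_u (expR (2 * C th u) * phi th x u)%:E <= H%:E)%E.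
  have := hC_int (ltr0n R 2); set s := ereal_sup _ => s_fin.
  have h x : X x -> (\int[m]_u (expR (2 * C th u) * phi th x u)%:E <= s)%E.
    by move=> Xx; apply: ereal_sup_ubound; exists (th, x).
  case: s s_fin h => [H _ h| // |_ h]; first by exists H.
  by exists 0 => x /h h'; rewrite (le_trans h') // leNye.
move=> k B k0 mB dl.
apply: (upper_deviation pos cont int halpha (hC_ge0 th) mC hold hH muX minv _ (hPU th) k0 mB).
exact: word_weight_exp_moment hmix hf hmu th.
Qed.

Lemma likelihood_gt0 th n y : (0 < l th n y)%E.
Proof.
have [pos cont int [pm le]] := is_emission_family th; have [muX _] := hmu th.
exact: (lik_gt0 pos cont muX).
Qed.

Lemma likelihood_fin th n y : l th n y \is a fin_num.
Proof.
have [pos cont int [pm le]] := is_emission_family th; have [muX _] := hmu th.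
exact: (lik_fin pos le muX).
Qed.

Lemma observation_separation th (D : set (seqU U)) : measurable D -> PU th D <> P D ->
  exists c : R, 0 < c /\ {ae P, forall y : seqU U, exists N : nat, forall n, (N <= n)%N ->
    (l th n y <= (expR (- c * n%:R))%:E * l thstar n y)%E}.
Proof.
move=> mD neq; have em := is_emission_family.
have [muX _] := hmu th; have [muX' _] := hmu thstar.
apply: (@exponential_separation _ _ (PU th) P (l th) (l thstar) _ _ _ _ _ _ _ D mD neq).
- by move=> n; have [pos cont _ _] := em th; exact: measurable_lik.
- by move=> n; have [pos cont _ _] := em thstar; exact: measurable_lik.
- by move=> n; exact: depends_lik.
- by move=> n; exact: depends_lik.
- by move=> n D' c mD' dD' c0; exact: (likelihood_ratio (em th) (em thstar) muX muX' (hPU th) (hPU thstar)).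
- exact: observation_upper_deviations.
- exact: observation_upper_deviations.
Qed.

Lemma emission_near d th th' x x' u : 0 < d -> X x -> X x' ->
  mdist th th' <= d -> dX x x' <= d -> phi th x u <= expR (rho d u) * phi th' x' u.
Proof.
move=> d0 Xx Xx' ht hx; have [_ [_ h]] := hrho d0.
have := h th th' x x' u Xx Xx'; rewrite ge_max ht hx => /(_ isT).
have p := hphi_pos th u Xx; have p' := hphi_pos th' u Xx'.
rewrite /negloglik -opprD normrN => /(le_trans (ler_norm _)).
by rewrite lerBlDr => h'; rewrite -[leLHS]lnK ?posrE // -[phi th' x' u]lnK ?posrE // -expRD ler_expR.
Qed.

Lemma likelihood_near th0 (e d : R) : 0 < e -> 0 < d -> exists r K : R, [/\ 0 < r, 0 < K &
  forall th n y, mdist th0 th < r ->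
    (l th n y <= (K * expR (e * n%:R + 2 * \sum_(k < n) rho d (y k)))%:E * l th0 n y)%E /\
    (l th0 n y <= (K * expR (e * n%:R + 2 * \sum_(k < n) rho d (y k)))%:E * l th n y)%E].
Proof.
move=> e0 d0; have [r [K [r0 K0 hr]]] := word_weight_compare hmix hf hmu th0 e0.
have [s /(_ s (leqnn s)) sd] := half_pow_le d0.
exists (Num.min r d), (K * expR ((s + s)%:R * e)); split.
- by rewrite lt_min r0.
- by rewrite mulr_gt0 ?expR_gt0.
move=> th n y; rewrite lt_min => /andP[thr thd].
have mxx t : mdist t t <= d by rewrite mdistxx ltW.
have thd' : mdist th th0 <= d by rewrite metric_sym ltW.
have split_const : K * expR ((s + s)%:R * e) * expR (e * n%:R + 2 * \sum_(k < n) rho d (y k)) =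
    K * expR ((s + s + n)%:R * e) * expR (2 * \sum_(k < n) rho d (y k)).
  by rewrite -!mulrA -!expRD (natrD _ (s + s)); congr (_ * expR _); ring.
have [muX [minv _]] := hmu th; have [muX0 [minv0 _]] := hmu th0.
have pos t x u (Xx : X x) := ltW (hphi_pos t u Xx).
rewrite split_const.
have Ks : 0 <= K * expR ((s + s + n)%:R * e) by rewrite mulr_ge0 ?expR_ge0 // ltW.
split; apply: (lik_le_discretized (s := s)) => //.
- exact: pos.
- exact: pos.
- by move=> x x' u Xx Xx' xx'; apply: emission_near => //; exact: le_trans xx' sd.
- by move=> x x' u Xx Xx' xx'; apply: emission_near => //; exact: le_trans xx' sd.
- by move=> w sw; have [+ _] := hr th w thr; rewrite sw.
- exact: pos.
- exact: pos.
- by move=> x x' u Xx Xx' xx'; apply: emission_near => //; [exact: ltW|exact: le_trans xx' sd].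
- by move=> x x' u Xx Xx' xx'; apply: emission_near => //; exact: le_trans xx' sd.
- by move=> w sw; have [_ +] := hr th w thr; rewrite sw.
Qed.

Lemma rho_averages : exists dl : nat -> R, (forall j, 0 < dl j) /\
  {ae P, forall y : seqU U, exists J : nat, forall j, (J <= j)%N -> forall n,
    \sum_(k < n) rho (dl j) (y k) <= n%:R * 2^-1 ^+ j}.
Proof.
(* With mean below the square of [2^-1 ^+ j], the maximal inequality at level [2^-1 ^+ j] leaves an
   exceptional set of probability at most [2^-1 ^+ j], which is summable. *)
have /choice[dl hdl] : forall j : nat, exists d : R, 0 < d /\
    (\int[P]_y (rho d (y 0%N))%:E < ((2^-1 * 2^-1) ^+ j)%:E)%E.
  move=> j.
  set e : R := _ ^+ j; have e0 : 0 < e by rewrite exprn_gt0 // mulr_gt0.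
  have n0 : nbhs (0 : \bar R)%E [set x | (x < e%:E)%E].
    by apply: open_nbhs_nbhs; split; [exact: open_ereal_lt_ereal|rewrite /= lte_fin].
  have : \forall d \near (0 : R)^'+, 0 < d /\ (\int[P]_y (rho d (y 0%N))%:E < e%:E)%E.
    near=> d; split => //; near: d; exact: hrho_lim n0.
  by move=> /filter_ex.
exists dl; split => [j|]; first by have [] := hdl j.
have [pos cont int _] := is_emission_family thstar; have [_ [minv _]] := hmu thstar.
have PS (D : set (seqU U)) : measurable D -> P (nshift 1 @^-1` D) = P D.
  exact: (law_shift pos cont int minv (hPU thstar)).
have h2 j : 0 < (2^-1 : R) ^+ j by rewrite exprn_gt0.
have /choice[D hD] : forall j : nat, exists D : set (seqU U), [/\ measurable D,
    (P D <= (2^-1 ^+ j)%:E)%E & forall y, ~ D y -> forall n,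
      \sum_(k < n) rho (dl j) (y k) <= n%:R * 2^-1 ^+ j].
  move=> j.
  have [d0 hj] := hdl j; have [rm [rp _]] := hrho d0.
  have [D [mD PD hD]] := maximal_inequality PS rm (fun u => ltW (rp u)) (lt_trans hj (ltry _)) (h2 j).
  exists D; split => //.
  rewrite -(@lee_pmul2l _ (2^-1 ^+ j)%:E) ?lte_fn ?lte_fin //.
  by rewrite (le_trans PD) // (le_trans (ltW hj)) // -EFinM exprMn.
have ln2 : 0 < ln 2 :> R by rewrite ln_gt0 // ltr1n.
have PD n : (P (D n) <= (1 * expR (- ln 2 * n%:R))%:E)%E.
  have [_ + _] := hD n; by rewrite mul1r mulrC expRM_natl expRN lnK ?posrE.
apply: filterS (borel_cantelli_exp (fun j => let: And3 a _ _ := hD j in a) ler01 ln2 PD) => y [J hJ].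
by exists J => j Jj n; have [_ _] := hD j; apply; exact: hJ.
Unshelve. all: by end_near.
Qed.

(** The threshold that works for [y] is random. Fixing it makes the radii and constants of the
    comparison deterministic; its countably many values are reunited at the end. *)
Definition tame (dl : nat -> R) (J : nat) (y : nat -> U) := forall j, (J <= j)%N ->
  forall n, \sum_(k < n) rho (dl j) (y k) <= n%:R * 2^-1 ^+ j.

(** The null set and [N] are chosen before the parameter, so that the bound can be integrated over
    [S] against the prior. *)
Definition dominated (dl : nat -> R) (J : nat) (S : set Theta) := exists c : R, 0 < c /\
  {ae P, forall y : seqU U, tame dl J y -> exists N : nat, forall n, (N <= n)%N -> forall th, S th ->
    (l th n y <= (expR (- c * n%:R))%:E * l thstar n y)%E}.

Lemma tame_near dl J th0 (c : R) : (forall j, 0 < dl j) -> 0 < c -> exists r K : R, [/\ 0 < r, 0 < K &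
  forall th n y, tame dl J y -> mdist th0 th < r ->
    (l th n y <= (K * expR (c * n%:R))%:E * l th0 n y)%E /\
    (l th0 n y <= (K * expR (c * n%:R))%:E * l th n y)%E].
Proof.
move=> dl0 c0.
have c20 : 0 < c / 2 by rewrite divr_gt0.
have c40 : 0 < c / 4 by rewrite divr_gt0.
(* At this scale twice the sum of [rho] is at most [c / 2 * n]; the other half of the rate is spent
   on the word weights. *)
have [j [Jj jc]] : exists j, (J <= j)%N /\ (2^-1 : R) ^+ j <= c / 4.
  have [s hs] := half_pow_le c40; exists (maxn J s); split; first exact: leq_maxl.
  exact/hs/leq_maxr.
have [r [K [r0 K0 h]]] := likelihood_near th0 c20 (dl0 j).
exists r, K; split => // th n y /(_ j Jj n) hS /h -/(_ n y) [h1 h2].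
have le : K * expR (c / 2 * n%:R + 2 * \sum_(k < n) rho (dl j) (y k)) <= K * expR (c * n%:R).
  rewrite ler_wpM2l ?(ltW K0) // ler_expR.
  have : n%:R * 2^-1 ^+ j <= n%:R * (c / 4) by rewrite ler_wpM2l.
  lra.
by split; [apply: (le_trans h1)|apply: (le_trans h2)]; rewrite lee_wpmul2r ?lee_fin //; exact/ltW/likelihood_gt0.
Qed.

Lemma expR_absorb (K c : R) : 0 < c -> exists N : nat, forall n, (N <= n)%N ->
  K <= expR (c * n%:R).
Proof.
move=> c0; exists (Num.bound (`|K| / c)) => n Nn.
have : `|K| / c < n%:R.
  by apply: lt_le_trans (archi_boundP _) _; rewrite ?ler_nat // divr_ge0 // ltW.
rewrite ltr_pdivrMr // => h; have := expR_ge1Dx (c * n%:R); have := ler_norm K; lra.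
Qed.

Lemma dominated_near dl J th0 (D : set (seqU U)) : (forall j, 0 < dl j) ->
  measurable D -> PU th0 D <> P D ->
  exists r, 0 < r /\ dominated dl J [set th | mdist th0 th < r].
Proof.
move=> dl0 mD neq; have [c [c0 hc]] := observation_separation mD neq.
have c20 : 0 < c / 2 by rewrite divr_gt0.
have c40 : 0 < c / 4 by rewrite divr_gt0.
have [r [K [r0 K0 hr]]] := tame_near J th0 dl0 c20.
have [N0 hN0] := expR_absorb K c40.
(* Of the separation rate [c] at [th0], [c / 2] goes to the comparison with neighbours and [c / 4]
   to absorbing [K]. *)
exists r; split => //; exists (c / 4); split => //.
apply: filterS hc => y [N hN] ty; exists (maxn N0 N) => n; rewrite geq_max => /andP[n0 n1] th thr.
have [h _] := hr th n y ty thr; apply: (le_trans h).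
apply: (@le_trans _ _ ((K * expR (c / 2 * n%:R))%:E * ((expR (- c * n%:R))%:E * l thstar n y))%E).
  by rewrite lee_wpmul2l ?hN // lee_fin mulr_ge0 ?expR_ge0 // ltW.
rewrite muleA -EFinM lee_wpmul2r //; first exact/ltW/likelihood_gt0.
rewrite lee_fin -(mulrA K) -expRD.
rewrite (le_trans (ler_wpM2r (expR_ge0 _) (hN0 n n0))) // -expRD ler_expR.
lra.
Qed.

(* Otherwise the sets [B] for which [K `\` B] is dominated form a proper filter on [K];
   a cluster point of it would have no dominated neighbourhood. *)
Lemma dominated_compact dl J (K : set Theta) : compact K ->
  (forall th0, K th0 -> exists r, 0 < r /\ dominated dl J [set th | mdist th0 th < r]) ->
  dominated dl J K.
Proof.
move=> cK hK; apply: contrapT => nK.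
have dom_sub S T : S `<=` T -> dominated dl J T -> dominated dl J S.
  move=> ST [c [c0 h]]; exists c; split => //; apply: filterS h => y h /h [N hN].
  by exists N => n Nn th /ST; exact: hN.
have dom_union S T : dominated dl J S -> dominated dl J T -> dominated dl J (S `|` T).
  move=> [c [c0 h]] [c' [c'0 h']]; exists (Num.min c c'); split; first by rewrite lt_min c0.
  have weaken (b : R) n th y : Num.min c c' <= b -> (l th n y <= (expR (- b * n%:R))%:E * l thstar n y)%E ->
      (l th n y <= (expR (- Num.min c c' * n%:R))%:E * l thstar n y)%E.
    move=> bb /le_trans; apply; rewrite lee_wpmul2r //; first exact/ltW/likelihood_gt0.
    by rewrite lee_fin ler_expR ler_wpM2r // lerN2.
  apply: filterS2 h h' => y h h' ty; have [N hN] := h ty; have [N' hN'] := h' ty.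
  exists (maxn N N') => n; rewrite geq_max => /andP[n1 n2] th [Sth|Tth].
    by apply: (weaken c); [rewrite ge_min lexx|exact: hN].
  by apply: (weaken c'); [rewrite ge_min lexx orbT|exact: hN'].
have dom0 : dominated dl J set0.
  by exists 1; split => //; apply: aeW => y _; exists 0%N.
pose G : set_system Theta := [set B | dominated dl J (K `\` B)].
have GF : ProperFilter G.
  split; first by rewrite /G /= setD0.
  split.
  - by rewrite /G /= setDT.
  - by move=> B B' h h'; rewrite /G /= setDIr; exact: dom_union.
  - by move=> B B' BB'; apply: dom_sub; exact: setDS.
have GK : G K by rewrite /G /= setDv.
have [p [Kp pG]] := cK G GF GK.
have [r [r0 hr]] := hK p Kp.
have np : nbhs p [set th | mdist p th < r].
  by rewrite -metricType_numDomainType.filter_from_mdist_nbhs; exists r.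
have GC : G (~` [set th | mdist p th < r]).
  by apply: dom_sub hr; rewrite setDE setCK; exact: subIsetr.
by have [q []] := pG _ _ GC np.
Qed.

Lemma posterior_consistency (Pi0 : probability (borel Theta) R) : compact [set: Theta] ->
  (forall O : set Theta, open O -> O !=set0 -> (0 < Pi0 O)%E) ->
  forall E : set Theta, open E ->
  [set th | forall B : set (seqU U), measurable B -> PU th B = P B] `<=` E ->
  {ae P, forall y : seqU U, (fun n : nat => posterior Pi0 l (~` E) n y) @ \oo --> (0 : R)}.
Proof.
move=> cT hPi0 E oE sE; have [dl [dl0 tame_ae]] := rho_averages.
have clE : closed (~` E) by exact: open_closedC.
have dom J : dominated dl J (~` E).
  apply: dominated_compact; first by apply: subclosed_compact cT _.
  move=> th0 nE; have [D [mD neq]] : exists D : set (seqU U), measurable D /\ PU th0 D <> P D.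
    apply: contrapT => h; apply: nE; apply: sE => B mB; apply: contrapT => neq.
    by apply: h; exists B.
  exact: dominated_near neq.
(* Countably many thresholds [J] are intersected, and almost every [y] is tame for one of them. *)
suff vanish J : {ae P, forall y : seqU U, tame dl J y ->
    (fun n : nat => posterior Pi0 l (~` E) n y) @ \oo --> (0 : R)}.
  have /ae_foralln all_ae := vanish.
  by apply: filterS2 tame_ae all_ae => y [J hJ] /(_ J); apply.
have [c [c0 hc]] := dom J.
have c20 : 0 < c / 2 by rewrite divr_gt0.
have [r [K [r0 K0 hr]]] := tame_near J thstar dl0 c20.
pose V := (ball thstar r)^°.
have V0 : V thstar by apply: nbhsx_ballx.
have oV : open V by exact: open_interior.
have PV : (0 < Pi0 V)%E by apply: hPi0 => //; exists thstar.
apply: filterS hc => y hN ty; have [N {}hN] := hN ty.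
have v0 : 0 < fine (Pi0 V).
  by rewrite fine_gt0 // PV -ge0_fin_numE ?measure_ge0 // fin_num_measure //; exact: sub_sigma_algebra.
pose B := K / fine (Pi0 V).
(* Over the complement of [E] the likelihood has lost the rate [c] against the truth, over [V] at
   most [c / 2], so the quotient decays at rate [c / 2]. *)
have bound n : (N <= n)%N ->
    0 <= posterior Pi0 l (~` E) n y <= B * expR (- (c / 2)) ^+ n.
  move=> Nn; pose t := fine (l thstar n y).
  have tE : l thstar n y = t%:E by rewrite fineK // likelihood_fin.
  have t0 : 0 < t by rewrite -lte_fin -tE likelihood_gt0.
  have b0 : 0 < (K * expR (c / 2 * n%:R))^-1 by rewrite invr_gt0 mulr_gt0 ?expR_gt0.
  have -> : B * expR (- (c / 2)) ^+ n =
      expR (- c * n%:R) / ((K * expR (c / 2 * n%:R))^-1 * fine (Pi0 V)).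
    have -> : expR (- c * n%:R) = expR (- (c / 2)) ^+ n / expR (c / 2 * n%:R).
      rewrite -expRM_natl -expRN -expRD; congr expR; lra.
    rewrite /B; field; rewrite !gt_eqF ?expR_gt0 //.
  apply: (posterior_le _ clE oV PV t0 (expR_ge0 _) b0).
  - by move=> th; exact/ltW/likelihood_gt0.
  - by move=> th Eth; rewrite EFinM -tE; exact: hN.
  - move=> th /interior_subset; rewrite ballEmdist => /= /(hr th n y ty)[_].
    rewrite tE; have lf := likelihood_fin th n y; rewrite -(fineK lf) -!EFinM !lee_fin => h.
    by rewrite mulrC ler_pdivrMr ?mulr_gt0 ?expR_gt0 // mulrC.
have q1 : `|expR (- (c / 2))| < 1 by rewrite ger0_norm ?expR_ge0 // expR_lt1 oppr_lt0.
apply: (@squeeze_cvgr _ _ _ _ (cst 0) (fun n => B * expR (- (c / 2)) ^+ n)).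
- by exists N => // n; exact: bound.
- exact: cvg_cst.
- rewrite -[X in _ --> X](mulr0 B); apply: cvgMr; exact: cvg_expr.
Qed.

End HiddenGibbs.

Theorem theorem2p2
  (R : realType)
  (* hidden state space: a mixing SFT over the finite alphabet A *)
  (A : pfinType) (F : seq (seq A))
  (hmix : mixing (SFT F))
  (* compact metric parameter space, fully supported Borel prior *)
  (Theta : pmetricType R)
  (hTheta : compact [set: Theta])
  (Pi0 : probability (borel Theta) R)
  (hPi0 : forall O : set Theta, open O -> O !=set0 -> (0 < Pi0 O)%E)
  (* regular family of potentials and their invariant Gibbs measures *)
  (f : Theta -> (int -> A) -> R)
  (hf : regular_family (SFT F) f)
  (mu : Theta -> probability (seqX A) R)
  (hmu : forall th, invariant_Gibbs (SFT F) (f th) (mu th))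
  (* complete separable metric observation space, sigma-finite Borel measure *)
  (U : pmetricType R)
  (hUcomplete : forall G : set_system U, ProperFilter G -> cauchy G ->
                  exists l : U, G --> l)
  (hUsep : exists D : set U, countable D /\ dense D)
  (m : {measure set (borel U) -> \bar R})
  (hm : sigma_finite [set: borel U] m)
  (* emission densities phi_theta(u | x) *)
  (phi : Theta -> (int -> A) -> U -> R)
  (hphi_pos : forall th x u, SFT F x -> 0 < phi th x u)
  (hphi_cont : joint_continuous (SFT F) phi)
  (hphi_int : forall th x, SFT F x -> (\int[m]_u (phi th x u)%:E = 1)%E)
  (* process measures P^U_theta on U^N *)
  (PU : Theta -> probability (seqU U) R)
  (hPU : forall th (n : nat) (B : nat -> set U),
      (forall k, measurable (B k : set (borel U))) ->
      PU th [set y | forall k : nat, (k < n)%N -> B k (y k)] =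
      (\int[mu th]_(x in SFT F)
          \prod_(k < n) \int[m]_(u in (B k : set (borel U)))
                          (phi th (iter k Sshift x) u)%:E)%E)
  (* the true parameter *)
  (thstar : Theta)
  (* assumption (i) *)
  (hL1 : joint_continuous (SFT F) (negloglik phi))
  (* assumption (ii) *)
  (Lstar : U -> R)
  (hLstar_meas : measurable_fun [set: borel U] Lstar)
  (hLstar : forall th x u, SFT F x -> `|negloglik phi th x u| <= Lstar u)
  (hLstar_int : (\int[PU thstar]_y (Lstar (y 0%N))%:E < +oo)%E)
  (* assumption (iii) *)
  (rho : R -> U -> R)
  (hrho : forall d : R, 0 < d ->
      measurable_fun [set: borel U] (rho d) /\ (forall u, 0 < rho d u) /\
      forall th th' x x' u, SFT F x -> SFT F x' ->
        Num.max (mdist th th') (dX x x') <= d ->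
        `|negloglik phi th x u - negloglik phi th' x' u| <= rho d u)
  (hrho_lim : (fun d : R => \int[PU thstar]_y (rho d (y 0%N))%:E)%E
                @ at_right 0 --> 0%E)
  (* assumption (L2) *)
  (alpha : R) (halpha : 0 < alpha)
  (C : Theta -> U -> R)
  (hC_meas : measurable_fun [set: borel (Theta * U)%type]
               (fun p : Theta * U => C p.1 p.2))
  (hC_ge0 : forall th u, 0 <= C th u)
  (hC_hold : forall th u x y, SFT F x -> SFT F y ->
      `|negloglik phi th x u - negloglik phi th y u| <= C th u * dX x y `^ alpha)
  (hC_int : forall beta : R, 0 < beta ->
      (ereal_sup [set \int[m]_u (expR (beta * C p.1 u) * phi p.1 p.2 u)%:E
                 | p in [set p : Theta * (int -> A) | SFT F p.2]] < +oo)%E)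
  :
  forall E : set Theta, open E ->
    [set th | forall B : set (seqU U), measurable B -> PU th B = PU thstar B]
      `<=` E ->
    {ae PU thstar, forall y : nat -> U,
        (fun n : nat => posterior Pi0 (likelihood (SFT F) mu phi) (~` E) n y)
          @ \oo --> (0 : R)}.
Proof.
move=> E oE sE.
apply: (posterior_consistency (m := sigma_finite_version hm) hmix hf hmu hphi_pos hphi_cont
  hphi_int hPU hLstar hrho hrho_lim halpha hC_meas hC_ge0 hC_hold hC_int hTheta hPi0 oE sE).
Qed.
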